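(* Let $k$ be a commutative ring, let $R$ be an Azumaya $k$-algebra and let $L$ be a $\times_R$-bialgebra. Then $L$ can be obtained by $\sqrt{\text{Morita}}$-base change from an ordinary $k$-bialgebra $H$; that is, there are a $k$-bialgebra $H$ (regarded as a $\times_k$-bialgebra) and an equivalence of $k$-linear monoidal categories ${}_{k}\mathcal M\to{}_{R^e}\mathcal M$ such that $L$ is isomorphic, as a $\times_R$-bialgebra, to the $\times_R$-bialgebra obtained from $H$ by $\sqrt{\text{Morita}}$ base change along this equivalence.
   Context: $k$ is a commutative ring; all algebras, modules and unadorned tensor products are over $k$. ${}_A\mathcal M$ is the category of left $A$-modules. For a $k$-algebra $R$, $\overline R$ is the opposite algebra, $r\mapsto\overline r$ the canonical anti-isomorphism $R\to\overline R$, and $R^e=R\otimes\overline R$; write $r\overline s=r\otimes\overline s$. An $A$-ring is a $k$-algebra $L$ with a $k$-algebra map $A\to L$. Left $R^e$-modules are identified with $R$-bimodules via $r\overline s\,m=rms$, so ${}_{R^e}\mathcal M$ is monoidal with tensor product $M\diamond_R N:=M\otimes N/\langle \overline r m\otimes n-m\otimes rn\rangle$ ($=M\otimes_RN$), action $r\overline s(m\otimes n)=rm\otimes\overline s n$, and unit object $R$. For $R^e$-bimodules $M,N$, let $M\times_RN\subset M\diamond_RN$ be the set of elements $\sum m_i\otimes n_i$ with $\sum m_i\overline s\otimes n_i=\sum m_i\otimes n_is$ for all $s\in R$. If $M,N$ are $R^e$-rings, so is $M\times_RN$, with componentwise multiplication and $r\overline s\mapsto r\otimes\overline s$. $\operatorname{End}_k(R)$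 is an $R^e$-ring via $r\overline s\mapsto(t\mapsto rts)$. A $\times_R$-bialgebra is an $R^e$-ring $L$ with $R^e$-ring maps $\Delta\colon L\to L\times_RL$, $\Delta(\ell)=\ell_{(1)}\otimes\ell_{(2)}$, and $\varepsilon\colon L\to\operatorname{End}_k(R)$ such that $(\Delta\otimes\mathrm{id})\Delta=(\mathrm{id}\otimes\Delta)\Delta$ as maps $L\to L\diamond_RL\diamond_RL$ and $\overline{\varepsilon(\ell_{(2)})(1)}\,\ell_{(1)}=\ell=\varepsilon(\ell_{(1)})(1)\,\ell_{(2)}$ for all $\ell\in L$. Then ${}_L\mathcal M$ is monoidal with tensor product $M\diamond_RN$, action $\ell(m\otimes n)=\ell_{(1)}m\otimes\ell_{(2)}n$, and unit object $R$ with action via $\varepsilon$; the underlying functor ${}_L\mathcal M\to{}_{R^e}\mathcal M$ is strict monoidal. For $R=k$ a $\times_k$-bialgebra is an ordinary $k$-bialgebra. $\sqrt{\text{Morita}}$ base change: two $k$-algebras $R,S$ are $\sqrt{\text{Morita}}$-equivalent if there is an equivalence of $k$-linear monoidal categories $\mathcal F\colon{}_{R^e}\mathcal M\to{}_{S^e}\mathcal M$. Given such $\mathcal F$, it is isomorphic to $C\otimes_{R^e}(-)$ for a strict Morita context $(R^e,S^e,C,D,\phi,\psi)$, i.e. bimodules ${}_{S^e}C_{R^e}$, ${}_{R^e}D_{S^e}$ with bimodule isomorphisms $\phi\colon C\otimes_{R^e}D\to S^e$, $\psi\colon D\otimes_{S^e}C\to R^e$ satisfying the usual associativity conditions. For a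 $\times_R$-bialgebra $L$, set $\widetilde L=C\otimes_{R^e}L\otimes_{R^e}D$, an $S^e$-ring with unit map $S^e\cong C\otimes_{R^e}D\to C\otimes_{R^e}L\otimes_{R^e}D$ and multiplication induced by $\psi$ and the multiplication of $L$. The functor $\mathcal G(M)=C\otimes_{R^e}M$, with $\widetilde L$-action induced by $\psi$ and the $L$-action, is an equivalence ${}_L\mathcal M\to{}_{\widetilde L}\mathcal M$ lifting $\mathcal F$. Transporting the monoidal structure of ${}_L\mathcal M$ along $\mathcal G$, so that the underlying functor ${}_{\widetilde L}\mathcal M\to{}_{S^e}\mathcal M$ is strict monoidal and $\mathcal G$ lifts $\mathcal F$ as a monoidal functor, yields a unique $\times_S$-bialgebra structure on $\widetilde L$; this $\times_S$-bialgebra $\widetilde L$ is said to be obtained from $L$ by $\sqrt{\text{Morita}}$ base change. *)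

(* Defs.v *)
From HB Require Import structures.
From mathcomp Require Import all_boot all_algebra.
From mathcomp Require Import generic_quotient boolp.

Set Implicit Arguments.
Unset Strict Implicit.
Unset Printing Implicit Defensive.

Import GRing.Theory.
Local Open Scope ring_scope.
Local Open Scope quotient_scope.

(* The classical axioms of [boolp] serve only to form quotients.

   [tens al be] is the additive group generated by symbols [pure m n] subject
   to biadditivity and [pure (al i m) n = pure m (be i n)].  All the tensor
   products used below (over k, over an algebra, over R inside R^e-modules) are
   instances of it. *)
Section Tensor.
Context {M N : zmodType} {I : Type}.
Variables (al : I -> M -> M) (be : I -> N -> N).

Definition balanced (G : zmodType) (f : M -> N -> G) : Prop :=
  [/\ forall m m' n, f (m + m') n = f m n + f m' n,
      forall m n n', f m (n + n') = f m n + f m n'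
    & forall i m n, f (al i m) n = f m (be i n)].

Definition fsum (G : zmodType) (f : M -> N -> G) (s : seq (M * N)) : G :=
  \sum_(p <- s) f p.1 p.2.

(* A sequence stands for the formal sum of its pairs.  Two formal sums are
   identified when every balanced map agrees on them; since the quotient is
   itself the target of a balanced map, this is the congruence generated by
   the relations above. *)
Definition tens_rel (s t : seq (M * N)) : bool :=
  `[< forall (G : zmodType) (f : M -> N -> G), balanced f -> fsum f s = fsum f t >].

Lemma tens_rel_refl : reflexive tens_rel.
Proof. by move=> s; apply/asboolP. Qed.

Lemma tens_rel_sym : symmetric tens_rel.
Proof. by move=> s t; apply/asboolP/asboolP => h G f bf; rewrite h. Qed.

Lemma tens_rel_trans : transitive tens_rel.
Proof.
move=> t s u /asboolP h /asboolP h'; apply/asboolP => G f bf.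
by rewrite h // h'.
Qed.

Canonical tens_equiv :=
  EquivRel tens_rel tens_rel_refl tens_rel_sym tens_rel_trans.

Definition tens := {eq_quot tens_equiv}.
HB.instance Definition _ := Choice.on tens.
HB.instance Definition _ := EqQuotient.on tens.

Definition tsum (s : seq (M * N)) : tens := \pi_tens s.
End Tensor.

HB.lock Definition pure (M N : zmodType) (I : Type)
  (al : I -> M -> M) (be : I -> N -> N) (m : M) (n : N) : tens al be :=
  tsum al be [:: (m, n)].

(* The additive map induced by [f].  It is defined through a representative,
   so no proof has to be supplied, but it is meaningful only for a balanced
   [f] (see [tliftE] and [tliftD]). *)
HB.lock Definition tlift (M N : zmodType) (I : Type)
  (al : I -> M -> M) (be : I -> N -> N)
  (G : zmodType) (f : M -> N -> G) (x : tens al be) : G := fsum f (repr x).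
Arguments pure {M N I al be} m n.
Arguments tlift {M N I al be G} f x.

Section TensorTheory.
Context {M N : zmodType} {I : Type}.
Variables (al : I -> M -> M) (be : I -> N -> N).
Local Notation tens := (tens al be).
Local Notation balanced := (balanced al be).
Local Notation tsum := (tsum al be).
Local Notation pure := (pure : M -> N -> tens).

Lemma tsum_eq s t :
  (forall (G : zmodType) (f : M -> N -> G), balanced f -> fsum f s = fsum f t) ->
  tsum s = tsum t.
Proof. by move=> h; apply/eqmodP/asboolP. Qed.

Lemma tsumK (x : tens) : tsum (repr x) = x. Proof. exact: reprK. Qed.

Lemma tlift_tsum (G : zmodType) (f : M -> N -> G) s : @balanced G f -> tlift f (tsum s) = fsum f s.
Proof.
move=> bf; rewrite tlift.unlock.
have /eqmodP/asboolP h : tsum (repr (tsum s)) = tsum s by rewrite tsumK.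
exact: h.
Qed.

Lemma fsum_cat (G : zmodType) (f : M -> N -> G) s t : fsum f (s ++ t) = fsum f s + fsum f t.
Proof. exact: big_cat. Qed.

Lemma balancedNl (G : zmodType) (f : M -> N -> G) m n : @balanced G f -> f (- m) n = - f m n.
Proof.
case=> fDl _ _; have f0 : f 0 n = 0.
  by apply: (addrI (f 0 n)); rewrite -fDl !addr0.
by apply/eqP; rewrite -addr_eq0 -fDl addNr f0.
Qed.

Definition tens_zero : tens := tsum [::].
Definition tens_add (x y : tens) : tens := tsum (repr x ++ repr y).
Definition tens_opp (x : tens) : tens :=
  tsum [seq (- p.1, p.2) | p <- repr x].

Lemma tsum_cat s t : tens_add (tsum s) (tsum t) = tsum (s ++ t).
Proof.
apply: tsum_eq => G f bf; rewrite !fsum_cat.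
by have := tlift_tsum s bf; have := tlift_tsum t bf; rewrite tlift.unlock => -> ->.
Qed.

Lemma tens_addA : associative tens_add.
Proof.
move=> x y z; rewrite -(tsumK x) -(tsumK y) -(tsumK z) !tsum_cat.
by rewrite catA.
Qed.

Lemma tens_addC : commutative tens_add.
Proof. by move=> x y; apply: tsum_eq => G f _; rewrite !fsum_cat addrC. Qed.

Lemma tens_add0 : left_id tens_zero tens_add.
Proof. by move=> x; rewrite -(tsumK x) tsum_cat. Qed.

Lemma tens_addN : left_inverse tens_zero tens_opp tens_add.
Proof.
move=> x; rewrite -{2}(tsumK x) tsum_cat; apply: tsum_eq => G f bf.
rewrite fsum_cat /fsum big_map -big_split /= big_nil big1 // => p _.
by rewrite balancedNl // addNr.
Qed.

HB.instance Definition _ :=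
  GRing.isZmodule.Build tens tens_addA tens_addC tens_add0 tens_addN.

Lemma tsumD s t : tsum (s ++ t) = tsum s + tsum t.
Proof. by rewrite -tsum_cat. Qed.

Lemma tsumE s : tsum s = \sum_(p <- s) pure p.1 p.2.
Proof.
elim: s => [|[m n] s IH]; first by rewrite big_nil.
by rewrite -cat1s tsumD IH big_cons pure.unlock.
Qed.

Lemma tens_sum (x : tens) : x = \sum_(p <- repr x) pure p.1 p.2.
Proof. by rewrite -tsumE tsumK. Qed.

Lemma tens_ind (P : tens -> Prop) :
  (forall m n, P (pure m n)) -> P 0 -> (forall x y, P x -> P y -> P (x + y)) ->
  forall x, P x.
Proof.
move=> Pp P0 PD x; rewrite (tens_sum x).
by elim/big_ind: _ => [//|y z|p _]; [exact: PD | exact: Pp].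
Qed.

Lemma balanced_pure : balanced pure.
Proof.
split=> *; rewrite pure.unlock -?tsumD; apply: tsum_eq => G f [fl fr fb];
  by rewrite /fsum ?big_cons !big_nil /= ?addr0 ?fl ?fr ?fb.
Qed.

Lemma pureDl m m' n : pure (m + m') n = pure m n + pure m' n.
Proof. by case: balanced_pure. Qed.
Lemma pureDr m n n' : pure m (n + n') = pure m n + pure m n'.
Proof. by case: balanced_pure. Qed.
Lemma pureB i m n : pure (al i m) n = pure m (be i n).
Proof. by case: balanced_pure. Qed.

Lemma tliftE (G : zmodType) (f : M -> N -> G) m n : @balanced G f -> tlift f (pure m n) = f m n.
Proof. by move=> bf; rewrite pure.unlock tlift_tsum // /fsum big_seq1. Qed.

Lemma tliftD (G : zmodType) (f : M -> N -> G) : @balanced G f -> {morph (tlift f : tens -> G) : x y / x + y}.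
Proof.
move=> bf x y; rewrite -(tsumK x) -(tsumK y) -tsumD !tlift_tsum //.
exact: fsum_cat.
Qed.

Lemma tlift0 (G : zmodType) (f : M -> N -> G) : @balanced G f -> tlift f (0 : tens) = 0.
Proof. by move=> bf; rewrite -[0 in LHS]/(tsum [::]) tlift_tsum // /fsum big_nil. Qed.

Lemma eq_tlift (G : zmodType) (f g : M -> N -> G) (x : tens) :
  (forall m n, f m n = g m n) -> tlift f x = tlift g x.
Proof. by move=> fg; rewrite tlift.unlock; apply: eq_bigr => p _. Qed.

Lemma tlift_add (G : zmodType) (f g : M -> N -> G) (x : tens) :
  tlift (fun m n => f m n + g m n) x = tlift f x + tlift g x.
Proof. by rewrite tlift.unlock; exact: big_split. Qed.

End TensorTheory.
Arguments tens_ind {M N I al be} P.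
Arguments tsum_eq {M N I al be}.

Section TensorMap.
Context {M N M' N' : zmodType} {I J : Type}.
Context {al : I -> M -> M} {be : I -> N -> N}.
Context {al' : J -> M' -> M'} {be' : J -> N' -> N'}.

Definition tmap (f : M -> M') (g : N -> N') (x : tens al be) : tens al' be' :=
  tlift (fun m n => pure (f m) (g n)) x.

Definition tmap_compat (f : M -> M') (g : N -> N') : Prop :=
  [/\ {morph f : x y / x + y}, {morph g : x y / x + y} &
    forall i m n, pure (f (al i m)) (g n) = pure (f m) (g (be i n)) :> tens al' be'].

Lemma tmap_balanced f g : tmap_compat f g ->
  balanced al be (fun m n => pure (f m) (g n) : tens al' be').
Proof. by case=> fD gD fg; split=> *; rewrite ?fD ?gD ?pureDl ?pureDr. Qed.

Lemma tmapE f g m n : tmap_compat f g -> tmap f g (pure m n) = pure (f m) (g n).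
Proof. by move=> /tmap_balanced h; rewrite /tmap tliftE. Qed.

Lemma tmapD f g : tmap_compat f g -> {morph tmap f g : x y / x + y}.
Proof. by move=> /tmap_balanced h; apply: tliftD. Qed.

Lemma tmap0 f g : tmap_compat f g -> tmap f g 0 = 0.
Proof. by move=> /tmap_balanced h; apply: tlift0. Qed.
End TensorMap.

Section LeftAction.
Variables (E : pzRingType) (M : lmodType E) (N : zmodType) (I : Type).
Variables (al : I -> M -> M) (be : I -> N -> N).
Hypothesis alE : forall e i m, al i (e *: m) = e *: al i m.

Definition lact (e : E) : tens al be -> tens al be := tmap (fun m => e *: m) id.

Lemma lact_compat e : tmap_compat (al := al) (be := be) (al' := al) (be' := be)
  (fun m => e *: m) id.
Proof. by split=> [m m'|n n'|i m n] //; rewrite ?scalerDr // -alE pureB. Qed.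

Lemma lactE e m n : lact e (pure m n) = pure (e *: m) n.
Proof. exact: tmapE (lact_compat e). Qed.
Lemma lactDr e : {morph lact e : x y / x + y}.
Proof. exact: tmapD (lact_compat e). Qed.
Lemma lact0 e : lact e 0 = 0. Proof. exact: tmap0 (lact_compat e). Qed.

Lemma lactA a b x : lact a (lact b x) = lact (a * b) x.
Proof.
elim/(@tens_ind _ _ _ al be): x => [m n||x y IHx IHy]; rewrite ?lactE ?lact0 ?scalerA //.
by rewrite !lactDr IHx IHy.
Qed.
Lemma lact1 : left_id 1 lact.
Proof.
elim/(@tens_ind _ _ _ al be) => [m n||x y IHx IHy]; rewrite ?lactE ?lact0 ?scale1r //.
by rewrite !lactDr IHx IHy.
Qed.
Lemma lactDrr : right_distributive lact +%R. Proof. exact: lactDr. Qed.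
Lemma lactDl x : {morph lact^~ x : a b / a + b}.
Proof.
move=> a b; elim/(@tens_ind _ _ _ al be): x => [m n||x y IHx IHy].
- by rewrite !lactE scalerDl pureDl.
- by rewrite !lact0 addr0.
- by rewrite !lactDr IHx IHy addrACA.
Qed.
End LeftAction.

Section TensorOverK.
Variable k : comNzRingType.

Section Module.
Variables (M N : lmodType k).

Definition otimes : Type :=
  tens (fun (c : k) (m : M) => c *: m) (fun (c : k) (n : N) => c *: n).

HB.instance Definition _ := GRing.Zmodule.on otimes.

Fact otimes_comm (e c : k) (m : M) : c *: (e *: m) = e *: (c *: m).
Proof. by rewrite !scalerA mulrC. Qed.

HB.instance Definition _ := GRing.Zmodule_isLmodule.Build k otimes
  (lactA otimes_comm) (lact1 otimes_comm) (lactDrr otimes_comm) (lactDl otimes_comm).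

Definition ten (m : M) (n : N) : otimes := pure m n.

Lemma otimesZ c m n : c *: ten m n = ten (c *: m) n.
Proof. exact: lactE otimes_comm _ _ _. Qed.
Lemma tenZ c m n : ten (c *: m) n = ten m (c *: n).
Proof. exact: pureB. Qed.
End Module.

Section Algebra.
Variables (A B : algType k).
Local Notation AB := (otimes A B).

Definition otimes_mul (x y : AB) : AB :=
  tlift (fun a b => tlift (fun a' b' => ten (a * a') (b * b')) y) x.

Lemma omul_in_balanced a b : balanced
  (fun (c : k) (m : A) => c *: m) (fun (c : k) (n : B) => c *: n)
  (fun a' b' => ten (a * a') (b * b')).
Proof.
split=> *; rewrite ?mulrDr; [exact: pureDl|exact: pureDr|].
by rewrite -!scalerAr tenZ.
Qed.
Lemma omul_out_balanced y : balanced
  (fun (c : k) (m : A) => c *: m) (fun (c : k) (n : B) => c *: n)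
  (fun a b => tlift (fun a' b' => ten (a * a') (b * b')) (y : AB)).
Proof.
split=> *; rewrite -?tlift_add; apply: eq_tlift => *.
- by rewrite mulrDl; exact: pureDl.
- by rewrite mulrDl; exact: pureDr.
- by rewrite -!scalerAl tenZ.
Qed.
Lemma otimes_mulE a b a' b' :
  otimes_mul (ten a b) (ten a' b') = ten (a * a') (b * b').
Proof.
rewrite /otimes_mul (tliftE _ _ (omul_out_balanced _)).
exact: tliftE (omul_in_balanced a b).
Qed.
Lemma otimes_mulDl : left_distributive otimes_mul +%R.
Proof. by move=> x x' y; apply: tliftD; exact: omul_out_balanced. Qed.
Lemma otimes_mulDr : right_distributive otimes_mul +%R.
Proof.
move=> x y y'; rewrite /otimes_mul -tlift_add; apply: eq_tlift => a b.
by apply: tliftD; exact: omul_in_balanced.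
Qed.
Lemma otimes_mul0l y : otimes_mul 0 y = 0.
Proof. by apply: tlift0; exact: omul_out_balanced. Qed.
Lemma otimes_mul0r x : otimes_mul x 0 = 0.
Proof. by apply: (addrI (otimes_mul x 0)); rewrite -otimes_mulDr !addr0. Qed.

Lemma otimes_ind (P : AB -> Prop) :
  (forall a b, P (ten a b)) -> P 0 -> (forall x y, P x -> P y -> P (x + y)) ->
  forall x, P x.
Proof. exact: tens_ind. Qed.

Lemma otimes_mulA : associative otimes_mul.
Proof.
move=> x y z.
elim/otimes_ind: x => [a b||x x' IH IH']; last 2 first.
- by rewrite !otimes_mul0l.
- by rewrite !otimes_mulDl IH IH'.
elim/otimes_ind: y => [a' b'||y y' IH IH']; last 2 first.
- by rewrite !(otimes_mul0l, otimes_mul0r).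
- by rewrite !(otimes_mulDl, otimes_mulDr) IH IH'.
elim/otimes_ind: z => [a'' b''||z z' IH IH']; last 2 first.
- by rewrite !otimes_mul0r.
- by rewrite !otimes_mulDr IH IH'.
by rewrite !otimes_mulE !mulrA.
Qed.
Lemma otimes_mul1l : left_id (ten 1 1) otimes_mul.
Proof.
elim/otimes_ind => [a b||x x' IH IH']; rewrite ?otimes_mulE ?mul1r ?otimes_mul0r //.
by rewrite otimes_mulDr IH IH'.
Qed.
Lemma otimes_mul1r : right_id (ten 1 1) otimes_mul.
Proof.
elim/otimes_ind => [a b||x x' IH IH']; rewrite ?otimes_mulE ?mulr1 ?otimes_mul0l //.
by rewrite otimes_mulDl IH IH'.
Qed.

HB.instance Definition _ := GRing.Zmodule_isPzRing.Build AB
  otimes_mulA otimes_mul1l otimes_mul1r otimes_mulDl otimes_mulDr.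

Lemma tenM a b a' b' : ten a b * ten a' b' = ten (a * a') (b * b') :> AB.
Proof. exact: otimes_mulE. Qed.
End Algebra.
End TensorOverK.

Section Opposite.
Variables (k : comNzRingType) (A : algType k).

HB.instance Definition _ := @GRing.Zmodule_isLmodule.Build k A^c
  (@GRing.scale k A) (@scalerA k A) (@scale1r k A) (@scalerDr k A)
  (fun v a b => @scalerDl k A v a b).
HB.instance Definition _ := GRing.LSemiModule_isLSemiAlgebra.Build k A^c
  (fun c x y => @scalerAr k A c y x).
HB.instance Definition _ := GRing.LSemiAlgebra_isSemiAlgebra.Build k A^c
  (fun c x y => @scalerAl k A c y x).
End Opposite.

Definition restr (A B : pzRingType) (f : {rmorphism A -> B}) (M : lmodType B) : Type := M.

Section Restriction.
Variables (A B : pzRingType) (f : {rmorphism A -> B}) (M : lmodType B).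
HB.instance Definition _ := GRing.Zmodule.on (restr f M).
Definition restr_scale (a : A) (m : restr f M) : restr f M := f a *: (m : M).
Fact restrA a b m : restr_scale a (restr_scale b m) = restr_scale (a * b) m.
Proof. by rewrite /restr_scale rmorphM scalerA. Qed.
Fact restr1 : left_id 1 restr_scale.
Proof. by move=> m; rewrite /restr_scale rmorph1 scale1r. Qed.
Fact restrDr : right_distributive restr_scale +%R.
Proof. by move=> a m m'; rewrite /restr_scale scalerDr. Qed.
Fact restrDl m : {morph restr_scale^~ m : a b / a + b}.
Proof. by move=> a b; rewrite /restr_scale rmorphD scalerDl. Qed.
HB.instance Definition _ := GRing.Zmodule_isLmodule.Build A (restr f M)
  restrA restr1 restrDr restrDl.
End Restriction.

Section Enveloping.
Variables (k : comNzRingType) (R : algType k).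

(* R^e = R (x) R^op; [eten r s] is the element written r \bar s. *)
Definition env : Type := otimes R R^c.
HB.instance Definition _ := GRing.PzRing.on env.
HB.instance Definition _ := GRing.Lmodule.on env.

End Enveloping.
HB.lock Definition eten (k : comNzRingType) (R : algType k) (r s : R) : env R :=
  ten r (s : R^c).
Arguments eten {k R} r s.
HB.lock Definition esrc (k : comNzRingType) (R : algType k) (r : R) : env R :=
  eten r 1.
Arguments esrc {k R} r.
HB.lock Definition etgt (k : comNzRingType) (R : algType k) (s : R) : env R :=
  eten 1 s.
Arguments etgt {k R} s.

Section EnvelopingAlgebra.
Variables (k : comNzRingType) (R : algType k).
Local Notation env := (env R).

Lemma eten_ind (P : env -> Prop) :
  (forall r s, P (eten r s)) -> P 0 -> (forall x y, P x -> P y -> P (x + y)) ->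
  forall e, P e.
Proof. by rewrite eten.unlock; exact: otimes_ind. Qed.

Lemma etenM (r s r' s' : R) : eten r s * eten r' s' = eten (r * r') (s' * s).
Proof. by rewrite eten.unlock; exact: tenM. Qed.
Lemma eten1 : eten 1 1 = 1 :> env. Proof. by rewrite eten.unlock. Qed.
Lemma etenDl (r r' s : R) : eten (r + r' : R) s = eten r s + eten r' s :> env.
Proof. by rewrite eten.unlock; exact: pureDl. Qed.
Lemma etenDr (r s s' : R) : eten r (s + s' : R) = eten r s + eten r s'.
Proof. by rewrite eten.unlock; exact: pureDr. Qed.
Lemma etenZl c (r s : R) : eten (c *: r) s = c *: eten r s.
Proof. by rewrite eten.unlock [RHS]otimesZ. Qed.
Lemma etenZr c (r s : R) : eten r (c *: s) = c *: eten r s.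
Proof. by rewrite eten.unlock [RHS]otimesZ tenZ. Qed.

Definition elift (G : zmodType) (f : R -> R -> G) (e : env) : G :=
  tlift (fun (r : R) (s : R^c) => f r s) e.

Definition ebalanced (G : zmodType) (f : R -> R -> G) : Prop :=
  [/\ forall r r' s, f (r + r') s = f r s + f r' s,
      forall r s s', f r (s + s') = f r s + f r s'
    & forall (c : k) r s, f (c *: r) s = f r (c *: s)].

Lemma eliftE (G : zmodType) (f : R -> R -> G) (r s : R) : ebalanced f -> elift f (eten r s) = f r s.
Proof. by case=> fl fr fb; rewrite eten.unlock; apply: tliftE; split. Qed.
Lemma eliftD (G : zmodType) (f : R -> R -> G) : ebalanced f -> {morph elift f : x y / x + y}.
Proof. by case=> fl fr fb; apply: tliftD; split. Qed.
Lemma elift0 (G : zmodType) (f : R -> R -> G) : ebalanced f -> elift f 0 = 0.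
Proof. by case=> fl fr fb; apply: tlift0; split. Qed.

Fact env_oner_neq0 : (1 : env) != 0.
Proof.
have bf : ebalanced (fun r s : R => r * s).
  by split=> *; rewrite ?mulrDl ?mulrDr // -scalerAl scalerAr.
apply/eqP => /(congr1 (elift (fun r s : R => r * s))).
by rewrite -eten1 eliftE // elift0 // mulr1; apply/eqP/oner_neq0.
Qed.
HB.instance Definition _ := GRing.PzSemiRing_isNonZero.Build env env_oner_neq0.

Fact env_scaleAl (c : k) (x y : env) : c *: (x * y) = (c *: x) * y.
Proof.
elim/eten_ind: x => [r s||x x' IH IH']; last 2 first.
- by rewrite mul0r !scaler0 mul0r.
- by rewrite mulrDl !scalerDr mulrDl IH IH'.
elim/eten_ind: y => [r' s'||y y' IH IH']; last 2 first.
- by rewrite !mulr0 scaler0.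
- by rewrite !mulrDr scalerDr IH IH'.
by rewrite etenM -!etenZl etenM scalerAl.
Qed.
HB.instance Definition _ := GRing.LSemiModule_isLSemiAlgebra.Build k env env_scaleAl.

Fact env_scaleAr (c : k) (x y : env) : c *: (x * y) = x * (c *: y).
Proof.
elim/eten_ind: x => [r s||x x' IH IH']; last 2 first.
- by rewrite !mul0r scaler0.
- by rewrite !mulrDl scalerDr IH IH'.
elim/eten_ind: y => [r' s'||y y' IH IH']; last 2 first.
- by rewrite scaler0 !mulr0 scaler0.
- by rewrite mulrDr !scalerDr mulrDr IH IH'.
by rewrite etenM -!etenZl etenM scalerAr.
Qed.
HB.instance Definition _ := GRing.LSemiAlgebra_isSemiAlgebra.Build k env env_scaleAr.

Lemma esrcE (r : R) : esrc r = eten r 1. Proof. by rewrite esrc.unlock. Qed.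
Lemma etgtE (s : R) : etgt s = eten 1 s. Proof. by rewrite etgt.unlock. Qed.
Lemma esrcD (r r' : R) : esrc (r + r' : R) = esrc r + esrc r'.
Proof. by rewrite !esrcE etenDl. Qed.
Lemma etgtD (r r' : R) : etgt (r + r' : R) = etgt r + etgt r'.
Proof. by rewrite !etgtE etenDr. Qed.
Lemma esrcZ c (r : R) : esrc (c *: r : R) = c *: esrc r.
Proof. by rewrite !esrcE etenZl. Qed.
Lemma etgtZ c (r : R) : etgt (c *: r : R) = c *: etgt r.
Proof. by rewrite !etgtE etenZr. Qed.
Lemma esrc1 : esrc (1 : R) = 1. Proof. by rewrite esrcE eten1. Qed.
Lemma etgt1 : etgt (1 : R) = 1. Proof. by rewrite etgtE eten1. Qed.
Lemma esrcM (r r' : R) : esrc (r * r' : R) = esrc r * esrc r'.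
Proof. by rewrite !esrcE etenM mulr1. Qed.
Lemma etgtM (r r' : R) : etgt (r * r' : R) = etgt r' * etgt r.
Proof. by rewrite !etgtE etenM mulr1. Qed.
Lemma esrctgt (r s : R) : esrc r * etgt s = eten r s.
Proof. by rewrite esrcE etgtE etenM !mulr1. Qed.
Lemma etgtsrc (r s : R) : etgt s * esrc r = eten r s.
Proof. by rewrite esrcE etgtE etenM !mul1r. Qed.

(* R as a left R^e-module: (r \bar s) t = r t s. *)
Definition unitobj : Type := R.
HB.instance Definition _ := GRing.Zmodule.on unitobj.

Definition unitobj_scale (e : env) (t : unitobj) : unitobj :=
  elift (fun r s : R => r * t * s) e.

Fact unitobj_bal (t : R) : ebalanced (fun r s : R => r * t * s).
Proof.
by split=> *; rewrite ?mulrDl ?mulrDr // -!scalerAl scalerAr.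
Qed.

Lemma unitobj_scaleE (r s : R) t : unitobj_scale (eten r s) t = r * t * s :> R.
Proof. exact: eliftE (unitobj_bal t). Qed.
Fact unitobj_Dr : right_distributive unitobj_scale +%R.
Proof.
move=> e t t'; rewrite -[RHS]tlift_add; apply: eq_tlift => r s.
by rewrite mulrDr mulrDl.
Qed.
Fact unitobj_Dl t : {morph unitobj_scale^~ t : a b / a + b}.
Proof. exact: eliftD (unitobj_bal t). Qed.
Fact unitobj_0l t : unitobj_scale 0 t = 0.
Proof. exact: elift0 (unitobj_bal t). Qed.
Fact unitobj_0r e : unitobj_scale e 0 = 0.
Proof. by apply: (addrI (unitobj_scale e 0)); rewrite -unitobj_Dr !addr0. Qed.
Fact unitobj_A a b t : unitobj_scale a (unitobj_scale b t) = unitobj_scale (a * b) t.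
Proof.
elim/eten_ind: a => [r s||x x' IH IH']; last 2 first.
- by rewrite mul0r !unitobj_0l.
- by rewrite mulrDl !unitobj_Dl IH IH'.
elim/eten_ind: b => [r' s'||y y' IH IH']; last 2 first.
- by rewrite mulr0 !unitobj_0l unitobj_0r.
- by rewrite mulrDr !unitobj_Dl unitobj_Dr IH IH'.
by rewrite etenM !unitobj_scaleE !mulrA.
Qed.
Fact unitobj_1 : left_id 1 unitobj_scale.
Proof. by move=> t; rewrite -eten1 unitobj_scaleE mul1r mulr1. Qed.
HB.instance Definition _ := GRing.Zmodule_isLmodule.Build env unitobj
  unitobj_A unitobj_1 unitobj_Dr unitobj_Dl.

Definition src_act (M : lmodType env) (r : R) (m : M) : M := esrc r *: m.
Definition tgt_act (M : lmodType env) (s : R) (m : M) : M := etgt s *: m.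

Lemma src_actD (M : lmodType env) r : {morph @src_act M r : x y / x + y}.
Proof. by move=> x y; rewrite /src_act scalerDr. Qed.
Lemma tgt_actD (M : lmodType env) r : {morph @tgt_act M r : x y / x + y}.
Proof. by move=> x y; rewrite /tgt_act scalerDr. Qed.
Lemma src_act_tgt (M : lmodType env) r s (m : M) :
  src_act r (tgt_act s m) = eten r s *: m.
Proof. by rewrite /src_act scalerA esrctgt. Qed.
Lemma tgt_act_src (M : lmodType env) r s (m : M) :
  tgt_act s (src_act r m) = eten r s *: m.
Proof. by rewrite /tgt_act scalerA etgtsrc. Qed.
Lemma src_actDl (M : lmodType env) r r' (m : M) :
  src_act (r + r') m = src_act r m + src_act r' m.
Proof. by rewrite /src_act esrcD scalerDl. Qed.
Lemma tgt_actDl (M : lmodType env) r r' (m : M) :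
  tgt_act (r + r') m = tgt_act r m + tgt_act r' m.
Proof. by rewrite /tgt_act etgtD scalerDl. Qed.
Lemma src_actM (M : lmodType env) r r' (m : M) :
  src_act (r * r') m = src_act r (src_act r' m).
Proof. by rewrite /src_act esrcM scalerA. Qed.
Lemma tgt_actM (M : lmodType env) r r' (m : M) :
  tgt_act (r * r') m = tgt_act r' (tgt_act r m).
Proof. by rewrite /tgt_act etgtM scalerA. Qed.
Lemma src_act1 (M : lmodType env) (m : M) : src_act 1 m = m.
Proof. by rewrite /src_act esrc1 scale1r. Qed.
Lemma tgt_act1 (M : lmodType env) (m : M) : tgt_act 1 m = m.
Proof. by rewrite /tgt_act etgt1 scale1r. Qed.
Lemma src_actZ (M : lmodType env) (c : k) r (m : M) :
  src_act (c *: r) m = tgt_act c%:A (src_act r m).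
Proof.
by rewrite /src_act /tgt_act esrcZ etgtZ etgt1 scalerA -scalerAl mul1r.
Qed.
Lemma tgt_actZ (M : lmodType env) (c : k) r (m : M) :
  tgt_act (c *: r) m = src_act c%:A (tgt_act r m).
Proof.
by rewrite /src_act /tgt_act esrcZ etgtZ esrc1 scalerA -scalerAl mul1r.
Qed.

Section Diamond.
Variables M N : lmodType env.

(* M (x) N modulo \bar r m (x) n = m (x) r n.  The k-balancing of the tensor
   product over k is the case r = c 1. *)
Definition diamond : Type :=
  tens (@tgt_act M) (@src_act N).
HB.instance Definition _ := GRing.Zmodule.on diamond.

Definition dia (m : M) (n : N) : diamond := pure m n.

Lemma diaB (r : R) m n : dia (tgt_act r m) n = dia m (src_act r n).
Proof. exact: pureB. Qed.
Lemma diaDl m m' n : dia (m + m') n = dia m n + dia m' n.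
Proof. exact: pureDl. Qed.
Lemma diaDr m n n' : dia m (n + n') = dia m n + dia m n'.
Proof. exact: pureDr. Qed.
Lemma dia_ind (P : diamond -> Prop) :
  (forall m n, P (dia m n)) -> P 0 -> (forall x y, P x -> P y -> P (x + y)) ->
  forall x, P x.
Proof. exact: tens_ind. Qed.

Definition dia_lift (G : zmodType) (f : M -> N -> G) (x : diamond) : G := tlift f x.
Definition dia_balanced (G : zmodType) (f : M -> N -> G) : Prop :=
  balanced (@tgt_act M) (@src_act N) f.
Lemma dia_liftE (G : zmodType) (f : M -> N -> G) m n :
  dia_balanced f -> dia_lift f (dia m n) = f m n.
Proof. exact: tliftE. Qed.
Lemma dia_liftD (G : zmodType) (f : M -> N -> G) :
  dia_balanced f -> {morph dia_lift f : x y / x + y}.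
Proof. exact: tliftD. Qed.
Lemma dia_lift0 (G : zmodType) (f : M -> N -> G) :
  dia_balanced f -> dia_lift f 0 = 0.
Proof. exact: tlift0. Qed.
Lemma eq_dia_lift (G : zmodType) (f g : M -> N -> G) x :
  (forall m n, f m n = g m n) -> dia_lift f x = dia_lift g x.
Proof. exact: eq_tlift. Qed.
Lemma dia_lift_add (G : zmodType) (f g : M -> N -> G) x :
  dia_lift (fun m n => f m n + g m n) x = dia_lift f x + dia_lift g x.
Proof. exact: tlift_add. Qed.

Definition dia_act2 (r s : R) : diamond -> diamond :=
  tmap (src_act r) (tgt_act s).
Definition dia_scale (e : env) (x : diamond) : diamond :=
  elift (fun r s => dia_act2 r s x) e.

Fact dia_act2_compat r s : tmap_compat
  (al := @tgt_act M) (be := @src_act N) (al' := @tgt_act M) (be' := @src_act N)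
  (src_act r) (tgt_act s).
Proof.
split=> [x y|x y|i m n]; rewrite ?src_actD ?tgt_actD //.
by rewrite src_act_tgt -tgt_act_src pureB src_act_tgt tgt_act_src.
Qed.
Lemma dia_act2E r s m n :
  dia_act2 r s (dia m n) = dia (src_act r m) (tgt_act s n).
Proof. exact: tmapE (dia_act2_compat r s). Qed.
Lemma dia_act2D r s : {morph dia_act2 r s : x y / x + y}.
Proof. exact: tmapD (dia_act2_compat r s). Qed.
Lemma dia_act20 r s : dia_act2 r s 0 = 0.
Proof. exact: tmap0 (dia_act2_compat r s). Qed.
Fact dia_scale_bal x : ebalanced (fun r s => dia_act2 r s x).
Proof.
split.
- move=> r r' s; elim/dia_ind: x => [m n||x y IH IH'].
  + by rewrite !dia_act2E src_actDl diaDl.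
  + by rewrite !dia_act20 addr0.
  + by rewrite !dia_act2D IH IH' addrACA.
- move=> r r' s; elim/dia_ind: x => [m n||x y IH IH'].
  + by rewrite !dia_act2E tgt_actDl diaDr.
  + by rewrite !dia_act20 addr0.
  + by rewrite !dia_act2D IH IH' addrACA.
- move=> c r s; elim/dia_ind: x => [m n||x y IH IH'].
  + by rewrite !dia_act2E src_actZ tgt_actZ diaB.
  + by rewrite !dia_act20.
  + by rewrite !dia_act2D IH IH'.
Qed.
Lemma dia_scaleE (r s : R) m n :
  dia_scale (eten r s) (dia m n) = dia (src_act r m) (tgt_act s n).
Proof. by rewrite -dia_act2E; exact: eliftE (dia_scale_bal (dia m n)). Qed.
Fact dia_Dr : right_distributive dia_scale +%R.
Proof.
by move=> e t t'; rewrite -[RHS]tlift_add; apply: eq_tlift => r s; rewrite dia_act2D.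
Qed.
Fact dia_Dl t : {morph dia_scale^~ t : a b / a + b}.
Proof. exact: eliftD (dia_scale_bal t). Qed.
Fact dia_0l t : dia_scale 0 t = 0.
Proof. exact: elift0 (dia_scale_bal t). Qed.
Fact dia_0r e : dia_scale e 0 = 0.
Proof. by apply: (addrI (dia_scale e 0)); rewrite -dia_Dr !addr0. Qed.
Fact dia_A a b t : dia_scale a (dia_scale b t) = dia_scale (a * b) t.
Proof.
elim/eten_ind: a => [r s||x x' IH IH']; last 2 first.
- by rewrite mul0r !dia_0l.
- by rewrite mulrDl !dia_Dl IH IH'.
elim/eten_ind: b => [r' s'||y y' IH IH']; last 2 first.
- by rewrite mulr0 !dia_0l dia_0r.
- by rewrite mulrDr !dia_Dl dia_Dr IH IH'.
elim/dia_ind: t => [m n||x y IH IH']; last 2 first.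
- by rewrite !dia_0r.
- by rewrite !dia_Dr IH IH'.
by rewrite etenM !dia_scaleE src_actM tgt_actM.
Qed.
Fact dia_1 : left_id 1 dia_scale.
Proof.
elim/dia_ind => [m n||x y IH IH']; last 2 first.
- by rewrite !dia_0r.
- by rewrite !dia_Dr IH IH'.
by rewrite -eten1 dia_scaleE src_act1 tgt_act1.
Qed.
HB.instance Definition _ := GRing.Zmodule_isLmodule.Build env diamond
  dia_A dia_1 dia_Dr dia_Dl.

Lemma dia_actE (r s : R) m n : eten r s *: dia m n = dia (src_act r m) (tgt_act s n).
Proof. exact: dia_scaleE. Qed.
End Diamond.
End EnvelopingAlgebra.

Section DiamondMap.
Variables (k : comNzRingType) (R : algType k).
Local Notation env := (env R).

Lemma linear_src (M N : lmodType env) (f : {linear M -> N}) r m :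
  f (src_act r m) = src_act r (f m).
Proof. by rewrite /src_act /tgt_act linearZZ. Qed.
Lemma linear_tgt (M N : lmodType env) (f : {linear M -> N}) r m :
  f (tgt_act r m) = tgt_act r (f m).
Proof. by rewrite /src_act /tgt_act linearZZ. Qed.

Lemma env_linear (M N : lmodType env) (f : M -> N) :
  {morph f : x y / x + y} -> (forall r s m, f (eten r s *: m) = eten r s *: f m) ->
  linear f.
Proof.
move=> fD fZ e x y; rewrite fD; congr (_ + _).
have f0 : f 0 = 0 by apply: (addrI (f 0)); rewrite -fD !addr0.
elim/eten_ind: e => [r s||a b IH IH'].
- exact: fZ.
- by rewrite !scale0r.
- by rewrite !scalerDl fD IH IH'.
Qed.

Section Map.
Variables (M M' N N' : lmodType env) (f : {linear M -> M'}) (g : {linear N -> N'}).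

Definition dia_map (x : diamond M N) : diamond M' N' := tmap f g x.

Fact dia_map_compat : tmap_compat (al := @tgt_act _ _ M) (be := @src_act _ _ N)
  (al' := @tgt_act _ _ M') (be' := @src_act _ _ N') f g.
Proof.
split=> [x y|x y|i m n]; rewrite ?raddfD //.
by rewrite linear_tgt linear_src pureB.
Qed.
Lemma dia_mapE m n : dia_map (dia m n) = dia (f m) (g n).
Proof. exact: tmapE dia_map_compat. Qed.
Lemma dia_mapD : {morph dia_map : x y / x + y}.
Proof. exact: tmapD dia_map_compat. Qed.
Fact dia_map_linear : linear dia_map.
Proof.
apply: env_linear => [|r s m]; first exact: dia_mapD.
elim/dia_ind: m => [m n||x y IH IH'].
- by rewrite dia_actE !dia_mapE dia_actE linear_src linear_tgt.
- by rewrite scaler0 [dia_map 0](tmap0 dia_map_compat) scaler0.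
- by rewrite scalerDr !dia_mapD IH IH' scalerDr.
Qed.
HB.instance Definition _ := GRing.isLinear.Build env (diamond M N) (diamond M' N')
  *:%R dia_map dia_map_linear.
End Map.

Section Coherence.
Variables (M N P : lmodType env).

Definition dia_assoc_in (p : P) (u : diamond M N) : diamond M (diamond N P) :=
  tlift (fun m n => dia m (dia n p)) u.
Definition dia_assoc (x : diamond (diamond M N) P) : diamond M (diamond N P) :=
  tlift (fun u p => dia_assoc_in p u) x.

Lemma src_dia r (n : N) (p : P) : src_act r (dia n p) = dia (src_act r n) p.
Proof. by rewrite [LHS]/src_act esrcE dia_actE tgt_act1. Qed.
Lemma tgt_dia r (n : N) (p : P) : tgt_act r (dia n p) = dia n (tgt_act r p).
Proof. by rewrite [LHS]/tgt_act etgtE dia_actE src_act1. Qed.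
End Coherence.

Section Associator.
Variables (M N P : lmodType env).

Fact dia_assoc_in_bal (p : P) : balanced (@tgt_act _ _ M) (@src_act _ _ N)
  (fun m n => dia m (dia n p)).
Proof. by split=> *; rewrite ?diaDl ?diaDr // diaB src_dia. Qed.
Lemma dia_assoc_inE p (m : M) (n : N) : dia_assoc_in p (dia m n) = dia m (dia n p) :> diamond M (diamond N P).
Proof. exact: tliftE (dia_assoc_in_bal p). Qed.
Lemma dia_assoc_inD (p : P) : {morph @dia_assoc_in M N P p : x y / x + y}.
Proof. exact: tliftD (dia_assoc_in_bal p). Qed.
Lemma dia_assoc_in0 (p : P) : @dia_assoc_in M N P p 0 = 0.
Proof. exact: tlift0 (dia_assoc_in_bal p). Qed.
Fact dia_assoc_bal : balanced (@tgt_act _ _ (diamond M N)) (@src_act _ _ P)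
  (fun u p => @dia_assoc_in M N P p u).
Proof.
split=> [u u' p|u p p'|r u p].
- exact: dia_assoc_inD.
- by rewrite -tlift_add; apply: eq_tlift => m n; rewrite diaDr diaDr.
- elim/dia_ind: u => [m n||x y IH IH'].
  + by rewrite tgt_dia !dia_assoc_inE diaB.
  + by rewrite /tgt_act scaler0 !dia_assoc_in0.
  + by rewrite tgt_actD !dia_assoc_inD IH IH'.
Qed.
Lemma dia_assocE m n p :
  dia_assoc (dia (dia m n) p) = dia m (dia n p) :> diamond M (diamond N P).
Proof. by rewrite -dia_assoc_inE; exact: tliftE dia_assoc_bal. Qed.
Lemma dia_assocD : {morph @dia_assoc M N P : x y / x + y}.
Proof. exact: tliftD dia_assoc_bal. Qed.
Lemma dia_assoc0 : @dia_assoc M N P 0 = 0.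
Proof. exact: tlift0 dia_assoc_bal. Qed.
Fact dia_assoc_linear : linear (@dia_assoc M N P).
Proof.
apply: env_linear => [|r s x]; first exact: dia_assocD.
elim/dia_ind: x => [u p||x y IH IH']; last 2 first.
- by rewrite scaler0 dia_assoc0 scaler0.
- by rewrite scalerDr !dia_assocD IH IH' scalerDr.
elim/dia_ind: u => [m n||x y IH IH'].
- by rewrite !(dia_actE, src_dia, dia_assocE, tgt_dia).
- have -> : dia (0 : diamond M N) p = 0.
    by apply: (addrI (dia 0 p)); rewrite -diaDl !addr0.
  by rewrite scaler0 dia_assoc0 scaler0.
- by rewrite diaDl scalerDr !dia_assocD IH IH' scalerDr.
Qed.
HB.instance Definition _ := GRing.isLinear.Build env _ _ *:%R
  (@dia_assoc M N P) dia_assoc_linear.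

Definition dia_lunit (x : diamond (unitobj R) M) : M :=
  tlift (fun (t : unitobj R) (m : M) => src_act (t : R) m) x.
Definition dia_runit (x : diamond M (unitobj R)) : M :=
  tlift (fun (m : M) (t : unitobj R) => tgt_act (t : R) m) x.

Lemma unitobj_actE r s (t : unitobj R) :
  eten r s *: t = (r * (t : R) * s : R).
Proof. exact: unitobj_scaleE. Qed.
Lemma src_unit r (t : unitobj R) : src_act r t = (r * (t : R) : R).
Proof. by rewrite /src_act esrcE unitobj_actE mulr1. Qed.
Lemma tgt_unit r (t : unitobj R) : tgt_act r t = ((t : R) * r : R).
Proof. by rewrite /tgt_act etgtE unitobj_actE mul1r. Qed.

Fact dia_lunit_bal : balanced (@tgt_act _ _ (unitobj R)) (@src_act _ _ M)
  (fun (t : unitobj R) (m : M) => src_act (t : R) m).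
Proof.
split=> [t t' m|t m m'|r t m].
- exact: src_actDl.
- exact: src_actD.
- by rewrite tgt_unit src_actM.
Qed.
Lemma dia_lunitE t m : dia_lunit (dia t m) = src_act (t : R) m.
Proof. exact: tliftE dia_lunit_bal. Qed.
Lemma dia_lunitD : {morph dia_lunit : x y / x + y}.
Proof. exact: tliftD dia_lunit_bal. Qed.
Fact dia_lunit_linear : linear dia_lunit.
Proof.
apply: env_linear => [|r s x]; first exact: dia_lunitD.
elim/dia_ind: x => [t m||x y IH IH'].
- rewrite dia_actE !dia_lunitE src_unit -tgt_act_src -src_actM.
  by rewrite src_act_tgt tgt_act_src.
- by rewrite scaler0 [dia_lunit 0](tlift0 dia_lunit_bal) scaler0.
- by rewrite scalerDr !dia_lunitD IH IH' scalerDr.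
Qed.
HB.instance Definition _ := GRing.isLinear.Build env _ _ *:%R
  dia_lunit dia_lunit_linear.

Fact dia_runit_bal : balanced (@tgt_act _ _ M) (@src_act _ _ (unitobj R))
  (fun (m : M) (t : unitobj R) => tgt_act (t : R) m).
Proof.
split=> [m m' t|m t t'|r m t].
- exact: tgt_actD.
- exact: tgt_actDl.
- by rewrite src_unit tgt_actM.
Qed.
Lemma dia_runitE m t : dia_runit (dia m t) = tgt_act (t : R) m.
Proof. exact: tliftE dia_runit_bal. Qed.
Lemma dia_runitD : {morph dia_runit : x y / x + y}.
Proof. exact: tliftD dia_runit_bal. Qed.
Fact dia_runit_linear : linear dia_runit.
Proof.
apply: env_linear => [|r s x]; first exact: dia_runitD.
elim/dia_ind: x => [m t||x y IH IH'].
- rewrite dia_actE !dia_runitE tgt_unit tgt_actM -[RHS]tgt_act_src.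
  by rewrite [tgt_act t (src_act r m)]tgt_act_src src_act_tgt.
- by rewrite scaler0 [dia_runit 0](tlift0 dia_runit_bal) scaler0.
- by rewrite scalerDr !dia_runitD IH IH' scalerDr.
Qed.
HB.instance Definition _ := GRing.isLinear.Build env _ _ *:%R
  dia_runit dia_runit_linear.
End Associator.
End DiamondMap.

Section Functors.
Variable k : comNzRingType.

Record modfunctor (A B : algType k) := ModFunctor {
  fun_ob :> lmodType A -> lmodType B;
  fun_map : forall M N : lmodType A, {linear M -> N} -> {linear fun_ob M -> fun_ob N};
  fun_id : forall M : lmodType A, fun_map (idfun : {linear M -> M}) =1 id;
  fun_comp : forall (M N P : lmodType A) (g : {linear N -> P}) (f : {linear M -> N}),
    fun_map (g \o f) =1 fun_map g \o fun_map f
}.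

(* k acts on the hom-sets through k -> A; additivity is the case c = 1. *)
Definition klinear (A B : algType k) (F : modfunctor A B) : Prop :=
  forall (M N : lmodType A) (c : k) (f g h : {linear M -> N}),
    (forall x, h x = c%:A *: f x + g x) ->
    forall y, fun_map F h y = c%:A *: fun_map F f y + fun_map F g y.

Definition is_equivalence (A B : algType k) (F : modfunctor A B) : Prop :=
  exists (G : modfunctor B A)
    (eta : forall M : lmodType A, {linear M -> G (F M)})
    (eps : forall N : lmodType B, {linear F (G N) -> N}),
  [/\ forall M, bijective (eta M),
      forall N, bijective (eps N),
      forall (M M' : lmodType A) (f : {linear M -> M'}) x,
        eta M' (f x) = fun_map G (fun_map F f) (eta M x)
    & forall (N N' : lmodType B) (g : {linear N -> N'}) y,
        eps N' (fun_map F (fun_map G g) y) = g (eps N y)].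

Record monoidal_functor (R S : algType k) := MonoidalFunctor {
  mf_fun :> modfunctor (env R) (env S);
  mf_xi : forall M N : lmodType (env R),
    {linear diamond (mf_fun M) (mf_fun N) -> mf_fun (diamond M N)};
  mf_xi0 : {linear unitobj S -> mf_fun (unitobj R)};
  mf_xi_bij : forall M N, bijective (mf_xi M N);
  mf_xi0_bij : bijective mf_xi0;
  mf_xi_nat : forall (M M' N N' : lmodType (env R))
      (f : {linear M -> M'}) (g : {linear N -> N'}) x,
    mf_xi M' N' (dia_map (fun_map mf_fun f) (fun_map mf_fun g) x) =
    fun_map mf_fun (dia_map f g) (mf_xi M N x);
  mf_assoc : forall (M N P : lmodType (env R)) x,
    fun_map mf_fun (@dia_assoc _ _ M N P)
      (mf_xi (diamond M N) P (dia_map (mf_xi M N) idfun x)) =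
    mf_xi M (diamond N P) (dia_map idfun (mf_xi N P) (dia_assoc x));
  mf_lunit : forall (M : lmodType (env R)) x,
    fun_map mf_fun (@dia_lunit _ _ M)
      (mf_xi (unitobj R) M (dia_map mf_xi0 idfun x)) = dia_lunit x;
  mf_runit : forall (M : lmodType (env R)) x,
    fun_map mf_fun (@dia_runit _ _ M)
      (mf_xi M (unitobj R) (dia_map idfun mf_xi0 x)) = dia_runit x
}.

Definition klinear_monoidal_equivalence (R S : algType k) (F : monoidal_functor R S) :=
  klinear F /\ is_equivalence F.
End Functors.

Section Bimodules.
Variable k : comNzRingType.

(* (A, B)-bimodules on which the two actions of k agree. *)
Record bimod (A B : algType k) := Bimod {
  bm_left :> lmodType A;
  bm_act : bm_left -> B -> bm_left;
  bm_actA : forall x b b', bm_act (bm_act x b) b' = bm_act x (b * b');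
  bm_act1 : forall x, bm_act x 1 = x;
  bm_actDl : forall x y b, bm_act (x + y) b = bm_act x b + bm_act y b;
  bm_actDr : forall x b b', bm_act x (b + b') = bm_act x b + bm_act x b';
  bm_actC : forall a x b, bm_act (a *: x) b = a *: bm_act x b;
  bm_actk : forall (c : k) x, bm_act x c%:A = c%:A *: x
}.
Arguments bm_act {A B b} _ _ : rename.

Section LeftTensor.
Variables (A B : algType k) (C : bimod A B) (N : lmodType B).

(* C (x)_B N *)
Definition lten : Type :=
  tens (fun (b : B) (c : C) => bm_act c b) (fun (b : B) (n : N) => b *: n).
HB.instance Definition _ := GRing.Zmodule.on lten.

Fact lten_comm (e : A) (b : B) (c : C) : bm_act (e *: c) b = e *: bm_act c b.
Proof. exact: bm_actC. Qed.

HB.instance Definition _ := GRing.Zmodule_isLmodule.Build A lten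
  (lactA lten_comm) (lact1 lten_comm) (lactDrr lten_comm) (lactDl lten_comm).

Definition lpure (c : C) (n : N) : lten := pure c n.

Lemma lten_ind (P : lten -> Prop) :
  (forall c n, P (lpure c n)) -> P 0 -> (forall x y, P x -> P y -> P (x + y)) ->
  forall x, P x.
Proof. exact: tens_ind. Qed.
Lemma lpureDl c c' n : lpure (c + c') n = lpure c n + lpure c' n.
Proof. exact: pureDl. Qed.
Lemma lpureDr c n n' : lpure c (n + n') = lpure c n + lpure c n'.
Proof. exact: pureDr. Qed.
Lemma lpureB b c n : lpure (bm_act c b) n = lpure c (b *: n).
Proof. exact: pureB. Qed.
Lemma lpureZ a c n : a *: lpure c n = lpure (a *: c) n.
Proof. exact: lactE lten_comm _ _ _. Qed.
Lemma lpure0r c : lpure c 0 = 0.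
Proof. by apply: (addrI (lpure c 0)); rewrite -lpureDr !addr0. Qed.
End LeftTensor.

Section LeftTensorMap.
Variables (A B : algType k) (C : bimod A B) (N N' : lmodType B).
Variable f : {linear N -> N'}.
Definition lten_map (x : lten C N) : lten C N' :=
  tlift (fun c n => lpure c (f n)) x.
End LeftTensorMap.

Section BimoduleTensor.
Variables (A B E : algType k) (C : bimod A B) (D : bimod B E).

Definition bten_act (x : lten C D) (e : E) : lten C D :=
  tlift (fun c d => lpure c (bm_act d e)) x.

Fact bten_bal e : balanced (fun (b : B) (c : C) => bm_act c b)
  (fun (b : B) (d : D) => b *: d) (fun c d => lpure c (bm_act d e)).
Proof.
split=> *; first by rewrite lpureDl.
  by rewrite bm_actDl lpureDr.
by rewrite lpureB bm_actC.
Qed.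
Lemma bten_actE c d e : bten_act (lpure c d) e = lpure c (bm_act d e).
Proof. exact: tliftE (bten_bal e). Qed.
Fact bten_actDl x y e : bten_act (x + y) e = bten_act x e + bten_act y e.
Proof. exact: tliftD (bten_bal e) _ _. Qed.
Fact bten_act0 e : bten_act 0 e = 0.
Proof. exact: tlift0 (bten_bal e). Qed.
Fact bten_actA x e e' : bten_act (bten_act x e) e' = bten_act x (e * e').
Proof.
elim/lten_ind: x => [c d||x y IH IH'].
- by rewrite !bten_actE bm_actA.
- by rewrite !bten_act0.
- by rewrite !bten_actDl IH IH'.
Qed.
Fact bten_act1 x : bten_act x 1 = x.
Proof.
elim/lten_ind: x => [c d||x y IH IH'].
- by rewrite !bten_actE bm_act1.
- by rewrite !bten_act0.
- by rewrite !bten_actDl IH IH'.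
Qed.
Fact bten_actDr x e e' : bten_act x (e + e') = bten_act x e + bten_act x e'.
Proof.
by rewrite /bten_act -tlift_add; apply: eq_tlift => c d; rewrite bm_actDr lpureDr.
Qed.
Fact bten_actC a x e : bten_act (a *: x) e = a *: bten_act x e.
Proof.
elim/lten_ind: x => [c d||x y IH IH'].
- by rewrite lpureZ !bten_actE lpureZ.
- by rewrite scaler0 !bten_act0 scaler0.
- by rewrite scalerDr !bten_actDl IH IH' scalerDr.
Qed.
Fact bten_actk (c : k) x : bten_act x c%:A = c%:A *: x.
Proof.
elim/lten_ind: x => [x y||x y IH IH'].
- by rewrite bten_actE bm_actk -lpureB bm_actk lpureZ.
- by rewrite bten_act0 scaler0.
- by rewrite scalerDr bten_actDl IH IH'.
Qed.
Definition bten : bimod A E :=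
  @Bimod A E (lten C D) bten_act bten_actA bten_act1 bten_actDl bten_actDr
    bten_actC bten_actk.
End BimoduleTensor.

(* Strict Morita contexts: both pairings are isomorphisms. *)
Record morita_context (A B : algType k) := MoritaContext {
  mcC : bimod B A;
  mcD : bimod A B;
  mc_phi : {linear bten mcC mcD -> B^o};
  mc_phiV : B -> bten mcC mcD;
  mc_phiK : cancel mc_phi mc_phiV;
  mc_phiVK : cancel mc_phiV mc_phi;
  mc_phiR : forall x b, mc_phi (bm_act x b) = mc_phi x * b;
  mc_psi : {linear bten mcD mcC -> A^o};
  mc_psi_bij : bijective mc_psi;
  mc_psiR : forall x a, mc_psi (bm_act x a) = mc_psi x * a;
  mc_assocC : forall c d c', mc_phi (lpure c d) *: c' = bm_act c (mc_psi (lpure d c'));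
  mc_assocD : forall d c d', mc_psi (lpure d c) *: d' = bm_act d (mc_phi (lpure c d'))
}.

Record algring (A : algType k) := AlgRing {
  ar_alg :> algType k;
  ar_map : {lrmorphism A -> ar_alg}
}.
Arguments ar_map {A} a.

Section AlgRingModule.
Variables (A : algType k) (L : algring A).

(* Restriction along A -> L. *)
Definition ar_lmod (M : lmodType L) : Type := restr (ar_map L) M.
HB.instance Definition _ M := GRing.Lmodule.on (ar_lmod M).
Definition ar_reg : Type := ar_lmod L^o.
HB.instance Definition _ := GRing.Lmodule.on ar_reg.

Definition ar_act (x : ar_reg) (a : A) : ar_reg := (x : L) * ar_map L a.
Fact ar_actA x b b' : ar_act (ar_act x b) b' = ar_act x (b * b').
Proof. by rewrite /ar_act rmorphM mulrA. Qed.
Fact ar_act1 x : ar_act x 1 = x. Proof. by rewrite /ar_act rmorph1 mulr1. Qed.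
Fact ar_actDl x y b : ar_act (x + y) b = ar_act x b + ar_act y b.
Proof. exact: mulrDl. Qed.
Fact ar_actDr x b b' : ar_act x (b + b') = ar_act x b + ar_act x b'.
Proof. by rewrite /ar_act rmorphD mulrDr. Qed.
Fact ar_actC a x b : ar_act (a *: x) b = a *: ar_act x b.
Proof. by rewrite /ar_act -[RHS]/(ar_map L a * (x * ar_map L b)) mulrA. Qed.
Fact ar_actk (c : k) x : ar_act x c%:A = c%:A *: x.
Proof.
rewrite /ar_act -[RHS]/(ar_map L c%:A * (x : L)) !rmorph_alg.
by rewrite -scalerAr -scalerAl mulr1 mul1r.
Qed.
Definition ar_bimod : bimod A A :=
  Bimod ar_actA ar_act1 ar_actDl ar_actDr ar_actC ar_actk.
End AlgRingModule.
End Bimodules.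

Section BaseChangeRing.
Variables (k : comNzRingType) (A B : algType k).
Variables (X : morita_context A B) (L : algring A).
Local Notation C := (mcC X).
Local Notation D := (mcD X).
Local Notation psi := (fun d c => mc_psi X (lpure d c) : A).

(* C (x)_A L (x)_A D *)
Definition ltilde : Type := lten (bten C (ar_bimod L)) D.
HB.instance Definition _ := GRing.Zmodule.on ltilde.

Definition tri (c : C) (l : L) (d : D) : ltilde :=
  lpure (lpure c (l : ar_bimod L) : bten C (ar_bimod L)) d.

Definition trilift (G : zmodType) (f : C -> L -> D -> G) (x : ltilde) : G :=
  tlift (fun u d => tlift (fun c (l : ar_bimod L) => f c l d) u) x.

Definition tribalanced (G : zmodType) (f : C -> L -> D -> G) : Prop :=
  [/\ forall c c' l d, f (c + c') l d = f c l d + f c' l d,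
      forall c l l' d, f c (l + l') d = f c l d + f c l' d,
      forall c l d d', f c l (d + d') = f c l d + f c l d',
      forall c a l d, f (bm_act c a) l d = f c (ar_map L a * l) d
    & forall c l a d, f c (l * ar_map L a) d = f c l (a *: d)].

Lemma tri_ind (P : ltilde -> Prop) :
  (forall c l d, P (tri c l d)) -> P 0 -> (forall x y, P x -> P y -> P (x + y)) ->
  forall x, P x.
Proof.
move=> Pt P0 PD; apply: tens_ind => // u d.
elim/lten_ind: u => [c l||u v Pu Pv].
- exact: Pt.
- have -> : pure 0 d = 0 :> lten (bten C (ar_bimod L)) D; last exact: P0.
  by apply: (addrI (pure 0 d)); rewrite -pureDl !addr0.
- by rewrite pureDl; exact: PD.
Qed.

Fact trilift_in_bal (G : zmodType) (f : C -> L -> D -> G) d : tribalanced f ->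
  balanced (fun (a : A) (c : C) => bm_act c a)
    (fun (a : A) (l : ar_bimod L) => a *: l) (fun c l => f c l d).
Proof. by case=> f1 f2 f3 f4 f5; split=> *; [exact: f1|exact: f2|exact: f4]. Qed.

Fact trilift_bal (G : zmodType) (f : C -> L -> D -> G) : tribalanced f ->
  balanced (fun (a : A) (u : bten C (ar_bimod L)) => bm_act u a)
    (fun (a : A) (d : D) => a *: d)
    (fun u d => tlift (fun c (l : ar_bimod L) => f c l d) u).
Proof.
move=> bf; have bin d := trilift_in_bal d bf; case: bf => f1 f2 f3 f4 f5.
split=> [u u' d|u d d'|a u d].
- exact: tliftD (bin d) _ _.
- by rewrite -tlift_add; apply: eq_tlift => *; rewrite f3.
- elim/lten_ind: u => [c l||u v IH IH'].
  + by rewrite [bm_act _ _]bten_actE !(tliftE _ _ (bin _)) -f5.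
  + by rewrite [bm_act _ _]bten_act0 !(tlift0 (bin _)).
  + by rewrite [bm_act _ _]bten_actDl !(tliftD (bin _)) IH IH'.
Qed.

Lemma triliftE (G : zmodType) (f : C -> L -> D -> G) c l d :
  tribalanced f -> trilift f (tri c l d) = f c l d.
Proof.
move=> bf; rewrite /trilift /tri /lpure (tliftE _ _ (trilift_bal bf)).
exact: tliftE (trilift_in_bal d bf).
Qed.
Lemma triliftD (G : zmodType) (f : C -> L -> D -> G) :
  tribalanced f -> {morph trilift f : x y / x + y}.
Proof. by move=> bf; exact: tliftD (trilift_bal bf). Qed.
Lemma trilift0 (G : zmodType) (f : C -> L -> D -> G) :
  tribalanced f -> trilift f 0 = 0.
Proof. by move=> bf; exact: tlift0 (trilift_bal bf). Qed.
Lemma eq_trilift (G : zmodType) (f g : C -> L -> D -> G) x :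
  (forall c l d, f c l d = g c l d) -> trilift f x = trilift g x.
Proof. by move=> fg; apply: eq_tlift => u d; apply: eq_tlift => c l; exact: fg. Qed.
Lemma trilift_add (G : zmodType) (f g : C -> L -> D -> G) x :
  trilift (fun c l d => f c l d + g c l d) x = trilift f x + trilift g x.
Proof.
by rewrite /trilift -tlift_add; apply: eq_tlift => u d; rewrite -tlift_add.
Qed.

Fact tri_tribalanced : tribalanced tri.
Proof.
split=> [c c' l d|c l l' d|c l d d'|c a l d|c l a d]; rewrite /tri.
- by rewrite lpureDl [LHS]lpureDl.
- by rewrite lpureDr [LHS]lpureDl.
- exact: lpureDr.
- by rewrite lpureB.
- by rewrite -lpureB [bm_act _ _]bten_actE.
Qed.
Lemma triDl c c' l d : tri (c + c') l d = tri c l d + tri c' l d.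
Proof. by case: tri_tribalanced. Qed.
Lemma triDm c l l' d : tri c (l + l') d = tri c l d + tri c l' d.
Proof. by case: tri_tribalanced. Qed.
Lemma triDr c l d d' : tri c l (d + d') = tri c l d + tri c l d'.
Proof. by case: tri_tribalanced. Qed.
Lemma triBl c a l d : tri (bm_act c a) l d = tri c (ar_map L a * l) d.
Proof. by case: tri_tribalanced. Qed.
Lemma triBr c l a d : tri c (l * ar_map L a) d = tri c l (a *: d).
Proof. by case: tri_tribalanced. Qed.

Definition ltilde_bimod : bimod B B := bten (bten C (ar_bimod L)) D.
Definition ltilde_scaleB (b : B) (x : ltilde) : ltilde :=
  b *: (x : ltilde_bimod).

Lemma ltilde_scaleBE b c l d : ltilde_scaleB b (tri c l d) = tri (b *: c) l d.
Proof. by rewrite /ltilde_scaleB /tri [LHS]lpureZ lpureZ. Qed.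

(* (c (x) l (x) d) (c' (x) l' (x) d') = c (x) l psi(d (x) c') l' (x) d' *)
Definition ltilde_mul (x y : ltilde) : ltilde :=
  trilift (fun c l d => trilift (fun c' l' d' =>
    tri c (l * ar_map L (psi d c') * l') d') y) x.
(* The composite B = C (x)_A D -> C (x)_A L (x)_A D. *)
Definition ltilde_unit (b : B) : ltilde :=
  tlift (fun c d => tri c 1 d) (mc_phiV X b).

Fact mul_in_bal c l d : tribalanced (fun c' l' d' =>
    tri c (l * ar_map L (psi d c') * l') d').
Proof.
split=> [c' c'' l' d'|c' l' l'' d'|c' l' d' d''|c' a l' d'|c' l' a d'] /=.
- by rewrite lpureDr raddfD /= rmorphD mulrDr mulrDl triDm.
- by rewrite mulrDr triDm.
- exact: triDr.
- by rewrite -(bten_actE d c' a) mc_psiR rmorphM !mulrA.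
- by rewrite mulrA triBr.
Qed.
Fact mul_out_bal y : tribalanced (fun c l d => trilift (fun c' l' d' =>
    tri c (l * ar_map L (psi d c') * l') d') y).
Proof.
split=> [c c' l d|c l l' d|c l d d'|c a l d|c l a d] /=;
  rewrite -?trilift_add; apply: eq_trilift => c0 l0 d0.
- exact: triDl.
- by rewrite !mulrDl triDm.
- by rewrite lpureDl raddfD /= rmorphD mulrDr mulrDl triDm.
- by rewrite triBl !mulrA.
- by rewrite -lpureZ linearZZ /= rmorphM !mulrA.
Qed.
Lemma ltilde_mulE c l d c' l' d' :
  ltilde_mul (tri c l d) (tri c' l' d') =
  tri c (l * ar_map L (psi d c') * l') d'.
Proof.
by rewrite /ltilde_mul (triliftE _ _ _ (mul_out_bal _)) (triliftE _ _ _ (mul_in_bal _ _ _)).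
Qed.
Fact ltilde_mulDl : left_distributive ltilde_mul +%R.
Proof. by move=> x x' y; exact: (triliftD (mul_out_bal y)). Qed.
Fact ltilde_mulDr : right_distributive ltilde_mul +%R.
Proof.
move=> x y y'; rewrite /ltilde_mul -trilift_add; apply: eq_trilift => c l d.
exact: triliftD (mul_in_bal c l d) _ _.
Qed.
Fact ltilde_mul0l y : ltilde_mul 0 y = 0.
Proof. exact: trilift0 (mul_out_bal y). Qed.
Fact ltilde_mul0r x : ltilde_mul x 0 = 0.
Proof. by apply: (addrI (ltilde_mul x 0)); rewrite -ltilde_mulDr !addr0. Qed.
Fact ltilde_mulA : associative ltilde_mul.
Proof.
move=> x y z.
elim/tri_ind: x => [c l d||x x' IH IH']; last 2 first.
- by rewrite !ltilde_mul0l.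
- by rewrite !ltilde_mulDl IH IH'.
elim/tri_ind: y => [c' l' d'||y y' IH IH']; last 2 first.
- by rewrite !(ltilde_mul0l, ltilde_mul0r).
- by rewrite !(ltilde_mulDl, ltilde_mulDr) IH IH'.
elim/tri_ind: z => [c'' l'' d''||z z' IH IH']; last 2 first.
- by rewrite !ltilde_mul0r.
- by rewrite !ltilde_mulDr IH IH'.
by rewrite !ltilde_mulE !mulrA.
Qed.

Fact ltilde_scaleBD b : {morph ltilde_scaleB b : x y / x + y}.
Proof. by move=> x y; rewrite /ltilde_scaleB scalerDr. Qed.
Fact ltilde_scaleB0 b : ltilde_scaleB b 0 = 0.
Proof. exact: scaler0. Qed.
Fact ltilde_scaleBMl b x y :
  ltilde_mul (ltilde_scaleB b x) y = ltilde_scaleB b (ltilde_mul x y).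
Proof.
elim/tri_ind: x => [c l d||x x' IH IH']; last 2 first.
- by rewrite !(ltilde_scaleB0, ltilde_mul0l).
- by rewrite !(ltilde_scaleBD, ltilde_mulDl) IH IH'.
elim/tri_ind: y => [c' l' d'||y y' IH IH']; last 2 first.
- by rewrite !(ltilde_mul0r, ltilde_scaleB0).
- by rewrite !(ltilde_mulDr, ltilde_scaleBD) IH IH'.
by rewrite !(ltilde_scaleBE, ltilde_mulE).
Qed.

Fact unit_bal : balanced (fun (a : A) (c : C) => bm_act c a)
    (fun (a : A) (d : D) => a *: d) (fun c d => tri c 1 d).
Proof.
split=> *; first exact: triDl.
  exact: triDr.
by rewrite triBl mulr1 -triBr mul1r.
Qed.
Fact unit_aux_D : {morph (fun x : lten C D => tlift (fun c d => tri c 1 d) x) : x y / x + y}.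
Proof. exact: tliftD unit_bal. Qed.

Lemma ltilde_unit_phi c d : ltilde_unit (mc_phi X (lpure c d)) = tri c 1 d.
Proof. by rewrite /ltilde_unit mc_phiK; exact: tliftE unit_bal. Qed.

Lemma B_ind (P : B -> Prop) :
  (forall c d, P (mc_phi X (lpure c d))) -> P 0 ->
  (forall x y, P x -> P y -> P (x + y)) -> forall b, P b.
Proof.
move=> Pp P0 PD b; rewrite -(mc_phiVK X b).
elim/lten_ind: (mc_phiV X b) => [c d||x y IH IH']; rewrite ?raddf0 ?raddfD //.
exact: PD.
Qed.
Fact ltilde_unitD : {morph ltilde_unit : x y / x + y}.
Proof.
move=> b b'; rewrite -(mc_phiVK X b) -(mc_phiVK X b') -raddfD /ltilde_unit !mc_phiK.
exact: unit_aux_D.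
Qed.
Fact ltilde_unit0 : ltilde_unit 0 = 0.
Proof. by apply: (addrI (ltilde_unit 0)); rewrite -ltilde_unitD !addr0. Qed.
Lemma ltilde_unitMl b x : ltilde_mul (ltilde_unit b) x = ltilde_scaleB b x.
Proof.
elim/B_ind: b => [c d||b b' IH IH']; last 2 first.
- by rewrite ltilde_unit0 ltilde_mul0l /ltilde_scaleB scale0r.
- by rewrite ltilde_unitD ltilde_mulDl IH IH' /ltilde_scaleB scalerDl.
elim/tri_ind: x => [c' l' d'||y y' IH IH']; last 2 first.
- by rewrite ltilde_mul0r ltilde_scaleB0.
- by rewrite ltilde_mulDr ltilde_scaleBD IH IH'.
rewrite ltilde_unit_phi ltilde_mulE ltilde_scaleBE mul1r -triBl.
by rewrite mc_assocC.
Qed.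
Lemma ltilde_unitMr b x : ltilde_mul x (ltilde_unit b) = bm_act (x : ltilde_bimod) b.
Proof.
elim/B_ind: b => [c d||b b' IH IH']; last 2 first.
- rewrite ltilde_unit0 ltilde_mul0r; apply: (addrI (bm_act (x : ltilde_bimod) 0)).
  by rewrite -bm_actDr !addr0.
- by rewrite ltilde_unitD ltilde_mulDr IH IH' bm_actDr.
elim/tri_ind: x => [c' l' d'||y y' IH IH']; last 2 first.
- by rewrite ltilde_mul0l [RHS]bten_act0.
- by rewrite ltilde_mulDl IH IH' [RHS]bten_actDl.
by rewrite ltilde_unit_phi ltilde_mulE mulr1 triBr mc_assocD [RHS]bten_actE.
Qed.
Fact ltilde_mul1l : left_id (ltilde_unit 1) ltilde_mul.
Proof. by move=> x; rewrite ltilde_unitMl /ltilde_scaleB scale1r. Qed.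
Fact ltilde_mul1r : right_id (ltilde_unit 1) ltilde_mul.
Proof. by move=> x; rewrite ltilde_unitMr bm_act1. Qed.
HB.instance Definition _ := GRing.Zmodule_isPzRing.Build ltilde
  ltilde_mulA ltilde_mul1l ltilde_mul1r ltilde_mulDl ltilde_mulDr.

Fact ltilde_oner_neq0 : (1 : ltilde) != 0.
Proof.
apply/eqP => e10.
have tri0 c l d : tri c l d = 0 by rewrite -[LHS](mulr1 (_ : ltilde)) e10 mulr0.
pose f c0 d0 c l d : L := ar_map L (psi d0 c) * l * ar_map L (psi d c0).
have bf c0 d0 : tribalanced (f c0 d0).
  split=> [c c' l d|c l l' d|c l d d'|c a l d|c l a d]; rewrite /f.
  - by rewrite lpureDr raddfD /= rmorphD !mulrDl.
  - by rewrite mulrDr mulrDl.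
  - by rewrite lpureDl raddfD /= rmorphD !mulrDr.
  - by rewrite -(bten_actE d0 c a) mc_psiR rmorphM !mulrA.
  - by rewrite -lpureZ linearZZ /= rmorphM !mulrA.
have f0 c0 d0 c l d : f c0 d0 c l d = 0.
  by rewrite -(triliftE _ _ _ (bf c0 d0)) tri0 (trilift0 (bf c0 d0)).
have [psiV psiK psiVK] := mc_psi_bij X.
have A_ind (P : A -> Prop) : (forall d c, P (psi d c)) -> P 0 ->
    (forall x y, P x -> P y -> P (x + y)) -> forall a, P a.
  move=> Pp P0 PD a; rewrite -(psiVK a).
  by elim/lten_ind: (psiV a) => [d c||x y IH IH']; rewrite ?raddf0 ?raddfD //; exact: PD.
have g0 c d (a : A) : ar_map L (psi d c) * ar_map L a = 0.
  elim/A_ind: a => [d' c'||x y IH IH']; first by rewrite -[RHS](f0 c' d c 1 d') /f mulr1.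
    by rewrite rmorph0 mulr0.
  by rewrite rmorphD mulrDr IH IH' addr0.
have h0 (a : A) : ar_map L a = 0.
  elim/A_ind: a => [d' c'||x y IH IH']; first by rewrite -[LHS]mulr1 -(rmorph1 (ar_map L)) g0.
    by rewrite rmorph0.
  by rewrite raddfD /= IH IH' addr0.
by have := rmorph1 (ar_map L); rewrite /= h0 => /esym/eqP; rewrite (negPf (oner_neq0 L)).
Qed.
HB.instance Definition _ := GRing.PzSemiRing_isNonZero.Build ltilde ltilde_oner_neq0.

Definition ltilde_scale (c : k) (x : ltilde) : ltilde := ltilde_scaleB c%:A x.
Fact ltilde_scaleA a b x : ltilde_scale a (ltilde_scale b x) = ltilde_scale (a * b) x.
Proof. by rewrite /ltilde_scale /ltilde_scaleB scalerA -scalerAl mul1r scalerA. Qed.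
Fact ltilde_scale1 : left_id 1 ltilde_scale.
Proof. by move=> x; rewrite /ltilde_scale /ltilde_scaleB !scale1r. Qed.
Fact ltilde_scaleDr : right_distributive ltilde_scale +%R.
Proof. by move=> c x y; exact: ltilde_scaleBD. Qed.
Fact ltilde_scaleDl x : {morph ltilde_scale^~ x : a b / a + b}.
Proof. by move=> a b; rewrite /ltilde_scale /ltilde_scaleB !scalerDl. Qed.
HB.instance Definition _ := GRing.Zmodule_isLmodule.Build k ltilde
  ltilde_scaleA ltilde_scale1 ltilde_scaleDr ltilde_scaleDl.
Fact ltilde_scaleAl (c : k) (x y : ltilde) : c *: (x * y) = (c *: x) * y.
Proof. exact/esym/ltilde_scaleBMl. Qed.
HB.instance Definition _ := GRing.LSemiModule_isLSemiAlgebra.Build k ltilde ltilde_scaleAl.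
Fact ltilde_scaleAr (c : k) (x y : ltilde) : c *: (x * y) = x * (c *: y).
Proof.
have e z : c *: z = ltilde_unit c%:A * z by rewrite [RHS]ltilde_unitMl.
have e' z : c *: z = z * ltilde_unit c%:A.
  by rewrite [RHS]ltilde_unitMr bm_actk.
by rewrite e' -mulrA -e'.
Qed.
HB.instance Definition _ := GRing.LSemiAlgebra_isSemiAlgebra.Build k ltilde ltilde_scaleAr.

Fact ltilde_unit_monoid : monoid_morphism ltilde_unit.
Proof.
split=> // b b'; rewrite [RHS]ltilde_unitMl.
elim/B_ind: b' => [c d||x y IH IH'].
- by rewrite ltilde_unit_phi ltilde_scaleBE -ltilde_unit_phi -lpureZ linearZZ.
- by rewrite mulr0 ltilde_unit0 ltilde_scaleB0.
- by rewrite mulrDr !ltilde_unitD ltilde_scaleBD IH IH'.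
Qed.
Fact ltilde_unit_linear : linear ltilde_unit.
Proof.
move=> c b b'; rewrite ltilde_unitD; congr (_ + _).
rewrite -[RHS]/(ltilde_scaleB _ _) -[LHS]mul1r -[c *: b]mul1r -scalerAr scalerAl.
by rewrite mul1r ltilde_unit_monoid.2 [LHS]ltilde_unitMl.
Qed.
HB.instance Definition _ := GRing.isLinear.Build k B ltilde *:%R ltilde_unit ltilde_unit_linear.
HB.instance Definition _ := GRing.isMonoidMorphism.Build B ltilde ltilde_unit ltilde_unit_monoid.

Definition base_change_ring : algring B := @AlgRing k B ltilde ltilde_unit.

(* The action of C (x)_A L (x)_A D on C (x)_A M, for an action of L on M:
   (c (x) l (x) d) (c' (x) m) = c (x) l psi(d (x) c') m. *)
Definition base_change_act (M : lmodType A) (act : L -> M -> M)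
    (x : base_change_ring) (w : lten C M) : lten C M :=
  trilift (fun c l d =>
    tlift (fun c' m => lpure c (act (l * ar_map L (psi d c')) m)) w) x.
End BaseChangeRing.

Section XBialgebra.
Variables (k : comNzRingType) (R : algType k).
Local Notation env := (env R).

Section Comultiplication.
Variable L : algring env.

Definition xsrc (r : R) : L := ar_map L (esrc r).
Definition xtgt (s : R) : L := ar_map L (etgt s).

Definition xsq : Type := diamond (ar_reg L) (ar_reg L).
HB.instance Definition _ := GRing.Lmodule.on xsq.
Definition xten (a b : L) : xsq := dia (a : ar_reg L) (b : ar_reg L).
Definition xlift (G : zmodType) (f : L -> L -> G) (x : xsq) : G :=
  dia_lift (M := ar_reg L) (N := ar_reg L) f x.

Lemma eq_xlift (G : zmodType) (f g : L -> L -> G) x :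
  (forall a b, f a b = g a b) -> xlift f x = xlift g x.
Proof. by move=> fg; rewrite /xlift; apply: eq_dia_lift. Qed.
Lemma xlift_add (G : zmodType) (f g : L -> L -> G) x :
  xlift (fun a b => f a b + g a b) x = xlift f x + xlift g x.
Proof. by rewrite /xlift -dia_lift_add. Qed.

Definition takeuchi (x : xsq) : Prop := forall s : R,
  xlift (fun a b => xten (a * xtgt s) b) x = xlift (fun a b => xten a (b * xsrc s)) x.

(* Componentwise multiplication; it is well defined when [x] is in the Takeuchi
   product. *)
Definition xsq_mul (x y : xsq) : xsq :=
  xlift (fun a b => xlift (fun a' b' => xten (a * a') (b * b')) y) x.

(* The conditions on [xb_delta] say that it is a map of R^e-rings from L to the
   Takeuchi product L x_R L inside L <> L; those on [xb_eps] that it is a map of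
   R^e-rings from L to End_k(R). *)
Record xbialg_on := XBialgOn {
  xb_delta : {additive L -> xsq};
  xb_eps : L -> {linear R -> R};
  xb_takeuchi : forall l, takeuchi (xb_delta l);
  xb_delta_env : forall r s, xb_delta (ar_map L (eten r s)) = xten (xsrc r) (xtgt s);
  xb_deltaM : forall l l', xb_delta (l * l') = xsq_mul (xb_delta l) (xb_delta l');
  xb_epsD : forall l l' t, xb_eps (l + l') t = xb_eps l t + xb_eps l' t;
  xb_eps_env : forall r s t, xb_eps (ar_map L (eten r s)) t = r * t * s;
  xb_epsM : forall l l' t, xb_eps (l * l') t = xb_eps l (xb_eps l' t);
  xb_coassoc : forall l,
    xlift (fun a b => dia_assoc (dia (xb_delta a) (b : ar_reg L))) (xb_delta l) =
    xlift (fun a b => dia (a : ar_reg L) (xb_delta b)) (xb_delta l);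
  xb_counitr : forall l, xlift (fun a b => xtgt (xb_eps b 1) * a) (xb_delta l) = l;
  xb_counitl : forall l, xlift (fun a b => xsrc (xb_eps a 1) * b) (xb_delta l) = l
}.

(* l (m (x) n) = l_(1) m (x) l_(2) n *)
Definition xdiag (X : xbialg_on) (M N : lmodType env)
    (actM : L -> M -> M) (actN : L -> N -> N) (l : L) (z : diamond M N) : diamond M N :=
  dia_lift (fun m n => xlift (fun a b => dia (actM a m) (actN b n)) (xb_delta X l)) z.

Definition ar_scale (M : lmodType L) (l : L) (m : ar_lmod M) : ar_lmod M :=
  l *: (m : M).
End Comultiplication.

Record xbialg := XBialg {
  xb_ring :> algring env;
  xb_on :> xbialg_on xb_ring
}.

Definition xbialg_iso (L L' : xbialg) : Prop :=
  exists f : {lrmorphism L -> L'},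
  [/\ bijective f,
      forall e, f (ar_map L e) = ar_map L' e,
      forall l, xb_delta L' (f l) = xlift (fun a b => xten (f a) (f b)) (xb_delta L l)
    & forall l t, xb_eps L' (f l) t = xb_eps L l t].
End XBialgebra.

Section BaseChange.
Variables (k : comNzRingType) (R S : algType k).
Variables (F : monoidal_functor R S) (L : xbialg R).

Section Transport.
Variable X : morita_context (env R) (env S).
Variable theta : forall M : lmodType (env R), {linear lten (mcC X) M -> F M}.
Variable Y : xbialg_on (base_change_ring X L).

(* [theta] identifies C (x) - with F, and so carries the monoidal structure of F
   to C (x) -: the elements [z] and [w] correspond under the resulting
   isomorphism (C (x) M) <> (C (x) N) = C (x) (M <> N).  The condition says that
   for all L-modules M and N this isomorphism is linear for the diagonal action
   given by [Y] on the left hand side and the action induced by the L-module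
   M <> N on the right hand side, and likewise for the unit objects below.
   That is, C (x) - lifts F to a monoidal functor from L-modules to modules
   over the base change ring, with strict monoidal underlying functors; this
   determines [Y]. *)
Definition transported_tensor : Prop :=
  forall (M N : lmodType L) (x : base_change_ring X L)
    (z : diamond (lten (mcC X) (ar_lmod M)) (lten (mcC X) (ar_lmod N)))
    (w : lten (mcC X) (diamond (ar_lmod M) (ar_lmod N))),
  mf_xi F _ _ (dia_map (theta _) (theta _) z) = theta _ w ->
  mf_xi F _ _ (dia_map (theta _) (theta _)
    (xdiag Y (base_change_act (@ar_scale _ _ _ M)) (base_change_act (@ar_scale _ _ _ N)) x z)) =
  theta _ (base_change_act (xdiag L (@ar_scale _ _ _ M) (@ar_scale _ _ _ N)) x w).

Definition transported_unit : Prop :=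
  forall (x : base_change_ring X L) (t : unitobj S) (w : lten (mcC X) (unitobj R)),
  mf_xi0 F t = theta _ w ->
  mf_xi0 F (xb_eps Y x t) =
  theta _ (base_change_act (fun l (r : unitobj R) => xb_eps L l r : unitobj R) x w).
End Transport.

Definition sqrt_morita_base_change (Lt : xbialg S) : Prop :=
  exists (X : morita_context (env R) (env S))
    (theta : forall M : lmodType (env R), {linear lten (mcC X) M -> F M})
    (Y : xbialg_on (base_change_ring X L)),
  [/\ forall M, bijective (theta M),
      forall (M N : lmodType (env R)) (f : {linear M -> N}) x,
        theta N (lten_map f x) = fun_map F f (theta M x),
      transported_tensor theta Y, transported_unit theta Y
    & Lt = XBialg Y].
End BaseChange.

Section Azumaya.
Variables (k : comNzRingType) (R : algType k).

Definition finitely_generated (M : lmodType k) : Prop :=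
  exists (n : nat) (x : 'I_n -> M), forall m, exists a : 'I_n -> k,
    m = \sum_(i < n) a i *: x i.

Definition projective (P : lmodType k) : Prop :=
  forall (M N : lmodType k) (g : {linear M -> N}) (f : {linear P -> N}),
    (forall y, exists x, g x = y) ->
    exists h : {linear P -> M}, forall p, g (h p) = f p.

Definition faithful (M : lmodType k) : Prop :=
  forall c : k, (forall m : M, c *: m = 0) -> c = 0.

Definition azumaya : Prop :=
  [/\ finitely_generated R, projective R, faithful R
    & forall f : {linear R -> R},
        exists! e : env R, forall t : R, e *: (t : unitobj R) = f t].
End Azumaya.

Section Bialgebra.
Variable k : comNzRingType.

Definition otimes_assoc (A B C : lmodType k) (x : otimes (otimes A B) C) :
    otimes A (otimes B C) :=
  tlift (fun (u : otimes A B) (c : C) =>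
    tlift (fun (a : A) (b : B) => ten a (ten b c)) u) x.

Record bialg := Bialg {
  bi_alg :> algType k;
  bi_delta : {rmorphism bi_alg -> otimes bi_alg bi_alg};
  bi_deltaZ : scalable bi_delta;
  bi_eps : {lrmorphism bi_alg -> k^o};
  bi_coassoc : forall h,
    tlift (fun a b : bi_alg => otimes_assoc (ten (bi_delta a) b)) (bi_delta h) =
    tlift (fun a b : bi_alg => ten a (bi_delta b)) (bi_delta h);
  bi_counitl : forall h, tlift (fun a b : bi_alg => bi_eps a *: b) (bi_delta h) = h;
  bi_counitr : forall h, tlift (fun a b : bi_alg => bi_eps b *: a) (bi_delta h) = h
}.
End Bialgebra.

Section OrdinaryBialgebra.
Variables (k : comNzRingType) (H : bialg k).

(* An ordinary bialgebra as a x_k-bialgebra: k is the algebra [k^o], and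
   R^e = k (x) k^op acts through a (x) b |-> a b.  Likewise the left modules
   over [env k^o] are the k-modules. *)
Definition k_env_map (e : env k^o) : H := elift (fun a b : k^o => (a * b : k) *: (1 : H)) e.

Fact k_env_bal : ebalanced (fun a b : k^o => (a * b : k) *: (1 : H)).
Proof.
split=> *; rewrite ?mulrDl ?mulrDr ?scalerDl //.
by rewrite -scalerAl scalerAr.
Qed.
Lemma k_env_mapE a b : k_env_map (eten a b) = (a * b : k) *: 1.
Proof. exact: eliftE k_env_bal. Qed.
Fact k_env_mapD : {morph k_env_map : x y / x + y}.
Proof. exact: eliftD k_env_bal. Qed.
Fact k_env_map0 : k_env_map 0 = 0.
Proof. exact: elift0 k_env_bal. Qed.
Fact k_env_map_linear : linear k_env_map.
Proof.
move=> c x y; rewrite k_env_mapD; congr (_ + _).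
elim/eten_ind: x => [a b||u v IH IH'].
- by rewrite -etenZl !k_env_mapE scalerA mulrA.
- by rewrite scaler0 k_env_map0 scaler0.
- by rewrite scalerDr !k_env_mapD IH IH' scalerDr.
Qed.
Fact k_env_map_monoid : monoid_morphism k_env_map.
Proof.
split=> [|x y]; first by rewrite -eten1 k_env_mapE mulr1 scale1r.
elim/eten_ind: x => [a b||u v IH IH']; last 2 first.
- by rewrite mul0r k_env_map0 mul0r.
- by rewrite mulrDl !k_env_mapD IH IH' mulrDl.
elim/eten_ind: y => [a' b'||u v IH IH']; last 2 first.
- by rewrite mulr0 k_env_map0 mulr0.
- by rewrite mulrDr !k_env_mapD IH IH' mulrDr.
rewrite etenM !k_env_mapE -[RHS]scalerAl mul1r scalerA; congr (_ *: _).
by rewrite [b' * b]mulrC mulrACA.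
Qed.
HB.instance Definition _ := GRing.isNmodMorphism.Build (env k^o) H k_env_map
  (conj k_env_map0 k_env_mapD).
HB.instance Definition _ := GRing.isMonoidMorphism.Build (env k^o) H k_env_map
  k_env_map_monoid.
Fact k_env_map_scalable : scalable k_env_map.
Proof.
by move=> c x; have := k_env_map_linear c x 0; rewrite k_env_map0 !addr0.
Qed.
HB.instance Definition _ := GRing.isScalable.Build k (env k^o) H *:%R k_env_map
  k_env_map_scalable.

Definition bialg_ring : algring (env k^o) := @AlgRing k (env k^o) H k_env_map.
Local Notation L := bialg_ring.

Fact bialg_src c : xsrc L c = c *: 1.
Proof. by rewrite /xsrc esrcE [LHS]k_env_mapE mulr1. Qed.
Fact bialg_tgt c : xtgt L c = c *: 1.
Proof. by rewrite /xtgt etgtE [LHS]k_env_mapE mul1r. Qed.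
Fact bialg_src_act c (a : ar_reg L) : src_act c a = c *: (a : H).
Proof. by rewrite -[LHS]/(xsrc L c * (a : H)) bialg_src -scalerAl mul1r. Qed.
Fact bialg_tgt_act c (a : ar_reg L) : tgt_act c a = c *: (a : H).
Proof. by rewrite -[LHS]/(xtgt L c * (a : H)) bialg_tgt -scalerAl mul1r. Qed.

Definition bialg_cmp (x : otimes H H) : xsq L := tlift (fun a b : H => xten (a : L) b) x.

Lemma xtenDl (a a' b : L) : xten (a + a') b = xten a b + xten a' b.
Proof. exact: diaDl. Qed.
Lemma xtenDr (a b b' : L) : xten a (b + b') = xten a b + xten a b'.
Proof. exact: diaDr. Qed.
Lemma xtenZ (c : k) (a b : H) : xten (c *: a : L) b = xten (a : L) (c *: b : L).
Proof. by rewrite /xten -bialg_tgt_act diaB bialg_src_act. Qed.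

Fact bialg_cmp_bal : balanced (fun (c : k) (a : H) => c *: a)
  (fun (c : k) (b : H) => c *: b) (fun a b : H => xten (a : L) b).
Proof. by split=> *; [exact: xtenDl|exact: xtenDr|exact: xtenZ]. Qed.
Lemma bialg_cmpE a b : bialg_cmp (ten a b) = xten (a : L) b.
Proof. exact: tliftE bialg_cmp_bal. Qed.
Lemma bialg_cmpD : {morph bialg_cmp : x y / x + y}.
Proof. exact: tliftD bialg_cmp_bal. Qed.
Lemma bialg_cmp0 : bialg_cmp 0 = 0.
Proof. exact: tlift0 bialg_cmp_bal. Qed.

Definition xbilin (G : zmodType) (f : L -> L -> G) : Prop :=
  [/\ forall a a' b, f (a + a') b = f a b + f a' b,
      forall a b b', f a (b + b') = f a b + f a b'
    & forall (c : k) a b, f (c *: a) b = f a (c *: b)].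

Fact xbilin_bal (G : zmodType) (f : L -> L -> G) : xbilin f ->
  dia_balanced (M := ar_reg L) (N := ar_reg L) f.
Proof.
case=> f1 f2 f3; split=> [a a' b|a b b'|c a b]; [exact: f1|exact: f2|].
by rewrite bialg_tgt_act bialg_src_act; exact: f3.
Qed.
Lemma xliftE (G : zmodType) (f : L -> L -> G) a b : xbilin f -> xlift f (xten a b) = f a b.
Proof. by move=> /xbilin_bal bf; exact: dia_liftE bf. Qed.
Lemma xliftD (G : zmodType) (f : L -> L -> G) : xbilin f -> {morph xlift f : x y / x + y}.
Proof. by move=> /xbilin_bal bf; exact: dia_liftD bf. Qed.
Lemma xlift0 (G : zmodType) (f : L -> L -> G) : xbilin f -> xlift f 0 = 0.
Proof. by move=> /xbilin_bal bf; exact: dia_lift0 bf. Qed.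
Lemma xlift_cmp (G : zmodType) (f : L -> L -> G) x : xbilin f ->
  xlift f (bialg_cmp x) = tlift (fun a b : H => f a b) x.
Proof.
move=> bf; have bf' : balanced (fun (c : k) (a : H) => c *: a)
  (fun (c : k) (b : H) => c *: b) f by case: bf; split.
elim/otimes_ind: x => [a b||x y IH IH'].
- by rewrite bialg_cmpE xliftE //; exact/esym/tliftE.
- by rewrite bialg_cmp0 xlift0 //; exact/esym/tlift0.
- by rewrite bialg_cmpD xliftD // IH IH'; exact/esym/tliftD.
Qed.

Definition bialg_delta (h : L) : xsq L := bialg_cmp (bi_delta H h).
Fact bialg_deltaD : {morph bialg_delta : x y / x + y}.
Proof. by move=> x y; rewrite /bialg_delta raddfD bialg_cmpD. Qed.
HB.instance Definition _ := GRing.isNmodMorphism.Build L (xsq L) bialg_delta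
  (conj (etrans (congr1 bialg_cmp (raddf0 (bi_delta H))) bialg_cmp0) bialg_deltaD).

Definition bialg_eps (h : L) (t : k^o) : k^o := bi_eps H h * t.
Fact bialg_eps_linear h : linear (bialg_eps h).
Proof. by move=> c x y; rewrite /bialg_eps mulrDr -scalerAr. Qed.
HB.instance Definition _ h := GRing.isLinear.Build k k^o k^o *:%R (bialg_eps h)
  (bialg_eps_linear h).

Fact bialg_deltaZ (c : k) (h : H) : bi_delta H (c *: h) = c *: bi_delta H h.
Proof. exact: bi_deltaZ. Qed.

Fact bialg_takeuchi l : takeuchi (bialg_delta l).
Proof.
move=> s; apply: eq_xlift => a b; rewrite bialg_tgt bialg_src.
by rewrite -!scalerAr !mulr1 xtenZ.
Qed.

Fact bialg_delta_env r s :
  bialg_delta (ar_map L (eten r s)) = xten (xsrc L r) (xtgt L s).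
Proof.
rewrite /bialg_delta [ar_map L _]k_env_mapE bialg_deltaZ rmorph1.
rewrite [_ *: _]otimesZ bialg_cmpE bialg_src bialg_tgt -xtenZ scalerA.
by rewrite [s * r]mulrC.
Qed.

Fact xsq_in_bal (a b : L) : xbilin (fun a' b' : L => xten (a * a') (b * b')).
Proof.
split=> *; rewrite ?mulrDr ?xtenDl ?xtenDr //.
by rewrite -!scalerAr xtenZ.
Qed.
Fact xsq_out_bal y : xbilin (fun a b : L =>
  xlift (fun a' b' => xten (a * a') (b * b')) y).
Proof.
split=> *; rewrite -?xlift_add; apply: eq_xlift => *.
- by rewrite mulrDl xtenDl.
- by rewrite mulrDl xtenDr.
- by rewrite -!scalerAl xtenZ.
Qed.

Fact bialg_deltaM l l' :
  bialg_delta (l * l') = xsq_mul (bialg_delta l) (bialg_delta l').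
Proof.
rewrite /bialg_delta rmorphM.
elim/otimes_ind: (bi_delta H l) => [a b||x y IH IH']; last 2 first.
- by rewrite mul0r bialg_cmp0 [RHS]xlift0 //; exact: xsq_out_bal.
- rewrite mulrDl !bialg_cmpD IH IH' [RHS]xliftD //; exact: xsq_out_bal.
rewrite bialg_cmpE [RHS]xliftE; last exact: xsq_out_bal.
elim/otimes_ind: (bi_delta H l') => [a' b'||x y IH IH']; last 2 first.
- by rewrite mulr0 bialg_cmp0 [RHS]xlift0 //; exact: xsq_in_bal.
- rewrite mulrDr !bialg_cmpD IH IH' [RHS]xliftD //; exact: xsq_in_bal.
by rewrite [_ * _]tenM !bialg_cmpE [RHS]xliftE //; exact: xsq_in_bal.
Qed.

Fact bialg_cmpZ (c : k) (x : otimes H H) :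
  bialg_cmp (c *: x) = tgt_act (c : k^o) (bialg_cmp x).
Proof.
elim/otimes_ind: x => [a b||x y IH IH'].
- by rewrite otimesZ !bialg_cmpE tgt_dia bialg_tgt_act xtenZ.
- by rewrite scaler0 bialg_cmp0 /tgt_act scaler0.
- by rewrite scalerDr !bialg_cmpD IH IH' tgt_actD.
Qed.
Fact bialg_cmpZs (c : k) (x : otimes H H) :
  bialg_cmp (c *: x) = src_act (c : k^o) (bialg_cmp x).
Proof.
elim/otimes_ind: x => [a b||x y IH IH'].
- by rewrite otimesZ !bialg_cmpE src_dia bialg_src_act.
- by rewrite scaler0 bialg_cmp0 /src_act scaler0.
- by rewrite scalerDr !bialg_cmpD IH IH' src_actD.
Qed.

Definition bialg_cmp3 (x : otimes H (otimes H H)) : diamond (ar_reg L) (xsq L) :=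
  tlift (fun (a : H) (u : otimes H H) => dia (a : ar_reg L) (bialg_cmp u)) x.
Fact bialg_cmp3_bal : balanced (fun (c : k) (a : H) => c *: a)
  (fun (c : k) (b : otimes H H) => c *: b)
  (fun (a : H) (u : otimes H H) => dia (a : ar_reg L) (bialg_cmp u)).
Proof.
split=> [a a' u|a u u'|c a u].
- exact: diaDl.
- by rewrite bialg_cmpD diaDr.
- by rewrite bialg_cmpZs -diaB bialg_tgt_act.
Qed.
Lemma bialg_cmp3E a u : bialg_cmp3 (ten a u) = dia (a : ar_reg L) (bialg_cmp u).
Proof. exact: tliftE bialg_cmp3_bal. Qed.
Lemma bialg_cmp3D : {morph bialg_cmp3 : x y / x + y}.
Proof. exact: tliftD bialg_cmp3_bal. Qed.
Lemma bialg_cmp30 : bialg_cmp3 0 = 0.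
Proof. exact: tlift0 bialg_cmp3_bal. Qed.

Fact oassoc_in_bal (c : H) : balanced (fun (c : k) (a : H) => c *: a)
  (fun (c : k) (b : H) => c *: b) (fun a b : H => ten a (ten b c)).
Proof.
split=> [a a' b|a b b'|e a b].
- exact: pureDl.
- by rewrite [ten (b + b') c]pureDl [LHS]pureDr.
- by rewrite tenZ otimesZ.
Qed.
Fact oassoc_bal : balanced (fun (c : k) (a : otimes H H) => c *: a)
  (fun (c : k) (b : H) => c *: b) (fun (u : otimes H H) (c : H) =>
    tlift (fun (a : H) (b : H) => ten a (ten b c)) u).
Proof.
split=> [u u' c|u c c'|e u c].
- exact: tliftD (oassoc_in_bal c) _ _.
- rewrite -tlift_add; apply: eq_tlift => a b.
  by rewrite [ten b (c + c')]pureDr [LHS]pureDr.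
- elim/otimes_ind: u => [a b||x y IH IH'].
  + rewrite otimesZ !(tliftE _ _ (oassoc_in_bal _)) tenZ.
    by rewrite otimesZ tenZ.
  + by rewrite scaler0 !(tlift0 (oassoc_in_bal _)).
  + by rewrite scalerDr !(tliftD (oassoc_in_bal _)) IH IH'.
Qed.
Lemma bialg_cmp3_assoc u (b : H) :
  bialg_cmp3 (otimes_assoc (ten u b)) =
  dia_assoc (dia (bialg_cmp u) (b : ar_reg L)).
Proof.
rewrite /otimes_assoc (tliftE _ _ oassoc_bal).
elim/otimes_ind: u => [a a'||x y IH IH'].
- by rewrite (tliftE _ _ (oassoc_in_bal b)) bialg_cmp3E !bialg_cmpE dia_assocE.
- rewrite (tlift0 (oassoc_in_bal b)) bialg_cmp30 bialg_cmp0.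
  have -> : dia (0 : xsq L) (b : ar_reg L) = 0.
    by apply: (addrI (dia (0 : xsq L) (b : ar_reg L))); rewrite -diaDl !addr0.
  by rewrite raddf0.
- by rewrite (tliftD (oassoc_in_bal b)) bialg_cmp3D IH IH' bialg_cmpD diaDl raddfD.
Qed.

Lemma tlift_morph (U V : zmodType) (f : H -> H -> U) (g : U -> V) (x : otimes H H) :
  g 0 = 0 -> {morph g : a b / a + b} ->
  g (tlift f x) = tlift (fun a b => g (f a b)) x.
Proof.
by move=> g0 gD; rewrite tlift.unlock /fsum (big_morph g gD g0).
Qed.

Fact bialg_coassoc l :
  xlift (fun a b : L => dia_assoc (dia (bialg_delta a) (b : ar_reg L))) (bialg_delta l) =
  xlift (fun a b : L => dia (a : ar_reg L) (bialg_delta b)) (bialg_delta l).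
Proof.
rewrite /bialg_delta !xlift_cmp; last 2 first.
- split=> [a a' b|a b b'|c a b].
  + exact: diaDl.
  + by rewrite raddfD bialg_cmpD diaDr.
  + by rewrite bialg_deltaZ bialg_cmpZs -diaB bialg_tgt_act.
- split=> [a a' b|a b b'|c a b].
  + by rewrite raddfD bialg_cmpD diaDl raddfD.
  + by rewrite diaDr raddfD.
  + by rewrite bialg_deltaZ bialg_cmpZ diaB bialg_src_act.
have := congr1 bialg_cmp3 (bi_coassoc l).
rewrite !(tlift_morph _ _ bialg_cmp30 bialg_cmp3D).
under eq_tlift do rewrite bialg_cmp3_assoc.
by under [in RHS]eq_tlift do rewrite bialg_cmp3E.
Qed.

Fact bialg_counitr l :
  xlift (fun a b : L => xtgt L (bialg_eps b 1) * a) (bialg_delta l) = l.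
Proof.
rewrite xlift_cmp; last first.
  split=> [a a' b|a b b'|c a b].
  - by rewrite mulrDr.
  - by rewrite /bialg_eps raddfD mulrDl !bialg_tgt scalerDl mulrDl.
  - rewrite /bialg_eps linearZZ !bialg_tgt -!scalerAl !mul1r scalerA !mulr1.
    by congr (_ *: _); exact: (mulrC (_ : k)).
rewrite -[RHS]bi_counitr; apply: eq_tlift => a b.
by rewrite bialg_tgt /bialg_eps mulr1 -scalerAl mul1r.
Qed.
Fact bialg_counitl l :
  xlift (fun a b : L => xsrc L (bialg_eps a 1) * b) (bialg_delta l) = l.
Proof.
rewrite xlift_cmp; last first.
  split=> [a a' b|a b b'|c a b].
  - by rewrite /bialg_eps raddfD mulrDl !bialg_src scalerDl mulrDl.
  - by rewrite mulrDr.
  - rewrite /bialg_eps linearZZ !bialg_src -!scalerAl !mul1r !mulr1 scalerA.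
    by congr (_ *: _); exact: (mulrC c).
rewrite -[RHS]bi_counitl; apply: eq_tlift => a b.
by rewrite bialg_src /bialg_eps mulr1 -scalerAl mul1r.
Qed.
Fact bialg_epsD l l' t : bialg_eps (l + l') t = bialg_eps l t + bialg_eps l' t.
Proof. by rewrite /bialg_eps raddfD mulrDl. Qed.
Fact bialg_eps_env r s t : bialg_eps (ar_map L (eten r s)) t = r * t * s.
Proof.
by rewrite /bialg_eps [ar_map L _]k_env_mapE linearZZ rmorph1 [_ *: _]mulr1 mulrAC.
Qed.
Fact bialg_epsM l l' t : bialg_eps (l * l') t = bialg_eps l (bialg_eps l' t).
Proof. by rewrite /bialg_eps rmorphM mulrA. Qed.

Definition xbialg_of_bialg : xbialg k^o :=
  XBialg (@XBialgOn k k^o L bialg_delta (fun h => bialg_eps h : {linear k^o -> k^o})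
    bialg_takeuchi bialg_delta_env bialg_deltaM bialg_epsD bialg_eps_env bialg_epsM
    bialg_coassoc bialg_counitr bialg_counitl).
End OrdinaryBialgebra.

(* Main.v *)
Require Import Defs.
From HB Require Import structures.
From mathcomp Require Import all_boot all_algebra.
From mathcomp Require Import fingroup perm boolp.
Import GRing.Theory.
Local Open Scope ring_scope.

(** Since R is Azumaya, R^e = End_k(R), so R and its k-linear dual D form a strict
    Morita context between k and R^e, and M |-> R (x) M is a monoidal equivalence.
    D is realised inside R^e as the elements [d] with [r d = \bar r d], acting on R
    by [t |-> d(t) 1]. With a dual basis [x_i], [f_i] of R one has
    [\sum_i x_i f_i = 1] and [d x d' = d(x) d'] in R^e.

    The bialgebra is the centralizer H of R^e in L. The maps
    [c (x) h (x) d |-> c d h] and [l |-> \sum_(i, j) x_i (x) T(f_i l x_j) (x) f_j],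
    with [T l = \sum_p x_p e_0 l f_p] for a functional [e_0] such that [e_0(1) = 1],
    are inverse isomorphisms between R (x) H (x) D and L. For [h] in H the
    element [Delta h] of L <> L lies in the image of H (x) H: it commutes with
    [Delta(R^e)], and by the Takeuchi condition [Delta h (f_p (x) f_q)] is killed by
    all [r - \bar r]. The axioms of a bialgebra for H follow from those of L because
    H (x) H -> L <> L and H (x) (H (x) H) -> L <> (L <> L) have left inverses. *)

(** Faithfulness of R enters through [e_0]: the values at 1 of the functionals on R form an ideal of
    k, and the determinant trick shows that it contains 1. No flatness is available for L or H, so H
    (x) H cannot be taken for a part of L <> L without proof; this is why explicit left inverses are
    built from the dual basis. A second obstacle is that the product of L <> L makes sense only
    under the Takeuchi condition. Right multiplications [rmul a b] are defined on all of L <> L and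
    carry the computations instead. One rule is used throughout: if [r v = \bar r v] for all r, then
    every e in R^e acts on v as the element [e . 1] of R. Elements of D, and all vectors [d v] with
    d in D, have this property; keeping D inside R^e makes the rule a statement about products. The
    base change structure has to live on the ring R (x) H (x) D itself, so the structure of L is
    carried there along the isomorphism. The conditions that characterise base change are then
    checked on the elements [r \bar s h] with h in H, which span L and act on R (x) M in the
    simplest way. *)

Set Implicit Arguments.
Unset Strict Implicit.
Unset Printing Implicit Defensive.

(** * Coordinates on an Azumaya algebra *)

Section LinearMaps.
Variables (A : pzRingType) (M N : lmodType A).

(** Stated with [M] and [N] as arguments because one carrier bears several module structures, for
    instance [R] and [unitobj R], or [L] and [ar_reg L]. *)
Definition is_linear (f : M -> N) : Prop := linear f.
Definition mk_linear (f : M -> N) (fl : is_linear f) : {linear M -> N} :=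
  HB.pack_for {linear M -> N} f (GRing.isLinear.Build A M N *:%R f fl).
Lemma mk_linearE f fl u : @mk_linear f fl u = f u. Proof. by []. Qed.
End LinearMaps.

Section Evaluation.
Variables (k : comNzRingType) (R : algType k).
Implicit Types (e : env R) (r s t : R).

(** The canonical algebra map from R^e to End_k(R), whose bijectivity is part of the Azumaya
    condition. *)
Definition ev (e : env R) (t : R) : R := e *: (t : unitobj R).

Lemma ev_eten r s t : ev (eten r s) t = r * t * s.
Proof. exact: unitobj_actE. Qed.
Lemma ev_esrc r t : ev (esrc r) t = r * t.
Proof. by rewrite esrcE ev_eten mulr1. Qed.
Lemma ev_etgt r t : ev (etgt r) t = t * r.
Proof. by rewrite etgtE ev_eten mul1r. Qed.
Lemma evM e e' t : ev (e * e') t = ev e (ev e' t).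
Proof. by rewrite /ev scalerA. Qed.
Lemma ev1 t : ev 1 t = t.
Proof. exact: (scale1r (t : unitobj R)). Qed.
Lemma evDl e e' t : ev (e + e') t = ev e t + ev e' t.
Proof. exact: (scalerDl (t : unitobj R)). Qed.
Lemma ev0l t : ev 0 t = 0.
Proof. exact: (scale0r (t : unitobj R)). Qed.
Lemma evDr e t t' : ev e (t + t') = ev e t + ev e t'.
Proof. exact: (scalerDr e (t : unitobj R)). Qed.
Lemma ev0r e : ev e 0 = 0.
Proof. exact: (@scaler0 _ (unitobj R)). Qed.
Lemma ev_suml I (r : seq I) (F : I -> env R) t :
  ev (\sum_(i <- r) F i) t = \sum_(i <- r) ev (F i) t.
Proof. exact: (big_morph (ev^~ t) (fun a b => evDl a b t) (ev0l t)). Qed.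
Lemma ev_sumr I (r : seq I) (F : I -> R) e :
  ev e (\sum_(i <- r) F i) = \sum_(i <- r) ev e (F i).
Proof. exact: (big_morph (ev e) (evDr e) (ev0r e)). Qed.

Lemma ev_linear e : linear (ev e).
Proof.
move=> c x y; rewrite evDr; congr (_ + _).
elim/eten_ind: e => [r s||e e' IH IH'].
- by rewrite !ev_eten -scalerAr -scalerAl.
- by rewrite !ev0l scaler0.
- by rewrite !evDl IH IH' scalerDr.
Qed.
HB.instance Definition _ e :=
  GRing.isLinear.Build k R R *:%R (ev e) (ev_linear e).
Lemma evZr e (c : k) t : ev e (c *: t) = c *: ev e t.
Proof. exact: linearZZ. Qed.
Lemma evZl e (c : k) t : ev (c *: e) t = c *: ev e t.
Proof.
elim/eten_ind: e => [r s||e e' IH IH'].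
- by rewrite -etenZl !ev_eten -!scalerAl.
- by rewrite scaler0 !ev0l scaler0.
- by rewrite scalerDr !evDl IH IH' scalerDr.
Qed.
End Evaluation.

Section DeterminantTrick.
Variable (k : comNzRingType).

(** Modulo the ideal [I] the matrix is the identity. In the expansion of the determinant the
    identity permutation contributes a product of factors [1 - A i i], and any other permutation has
    an off-diagonal factor, which lies in [I]. *)
Lemma det_sub1_ideal (I : k -> Prop) n (A : 'M[k]_n) :
  I 0 -> (forall a b, I a -> I b -> I (a + b)) -> (forall c a, I a -> I (c * a)) ->
  (forall i j, I (A i j)) -> I (1 - \det (1%:M - A)).
Proof.
move=> I0 ID IM IA.
have IN a : I a -> I (- a) by move=> Ia; rewrite -mulN1r; exact: IM.
have prodI (s : seq 'I_n) : I (1 - \prod_(i <- s) (1%:M - A) i i).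
  elim: s => [|i s IH]; first by rewrite big_nil subrr.
  rewrite big_cons !mxE eqxx /= mulrBl mul1r opprB addrCA mulrC.
  exact: ID _ _ (IM _ _ (IA i i)) IH.
rewrite /determinant (bigD1 (1%g : 'S_n)) //= odd_perm1 expr0 mul1r opprD addrA.
apply: (ID).
  rewrite (eq_bigr (fun i => (1%:M - A) i i)); first exact: prodI.
  by move=> i _; rewrite perm1.
apply: (IN); apply: (big_ind I I0 ID) => s s1; apply: (IM).
have [i si] : exists i, s i != i.
  apply/existsP; apply: contraNT s1; rewrite negb_exists => /forallP h.
  by apply/eqP/permP => i; rewrite perm1; apply/eqP; rewrite -[_ == _]negbK.
rewrite (bigD1 i) //= mulrC; apply: (IM).
by rewrite !mxE eq_sym (negPf si) sub0r; exact: IN.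
Qed.
End DeterminantTrick.

Section Frame.
Variables (k : comNzRingType) (R : algType k).

(* [fr_c] are the coordinates along [fr_x]; [fr_f] and [fr_e] are the elements of
   R^e representing the rank one operators [fr_c i t 1] and [fr_s t 1]. *)
Record frame := Frame {
  fr_n : nat;
  fr_x : 'I_fr_n -> R;
  fr_c : 'I_fr_n -> {linear R -> k^o};
  fr_s : {linear R -> k^o};
  fr_f : 'I_fr_n -> env R;
  fr_e : env R;
  fr_coord : forall t, t = \sum_i (fr_c i t : k) *: fr_x i;
  fr_s1 : fr_s 1 = 1;
  fr_fE : forall i t, ev (fr_f i) t = (fr_c i t : k) *: 1;
  fr_eE : forall t, ev fr_e t = (fr_s t : k) *: 1;
  fr_inj : forall e e' : env R, ev e =1 ev e' -> e = e'
}.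

(** Generators give a surjection from k^n onto R; projectivity provides a section, whose coordinates
    are the functionals. *)
Lemma dual_basis : finitely_generated R -> projective R ->
  exists n (x : 'I_n -> R) (c : 'I_n -> {linear R -> k^o}),
    forall t, t = \sum_i (c i t : k) *: x i.
Proof.
move=> [n [x gen]] proj.
pose g (v : 'rV[k]_n) : R := \sum_i v 0 i *: x i.
have g_lin : linear g.
  move=> a u v; rewrite /g scaler_sumr -big_split /=; apply: eq_bigr => i _.
  by rewrite !mxE scalerDl scalerA.
pose gL := HB.pack_for {linear 'rV[k]_n -> R} g
  (GRing.isLinear.Build k 'rV[k]_n R *:%R g g_lin).
have [|h hK] := proj _ _ gL (idfun : {linear R -> R}).
  move=> y; have [a ->] := gen y; exists (\row_i a i).
  by rewrite /= /g; apply: eq_bigr => i _; rewrite mxE.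
pose c i (t : R) : k^o := h t 0 i.
have c_lin i : linear (c i) by move=> a u v; rewrite /c linearP !mxE.
exists n, x, (fun i => HB.pack_for {linear R -> k^o} (c i)
  (GRing.isLinear.Build k R k^o *:%R (c i) (c_lin i))).
by move=> t; exact/esym/hK.
Qed.

(** Let [I] be the ideal of all values [d 1]. The matrix [A] of the [c i (x j)] has entries in [I]
    and fixes the column of the [x i], so the adjugate shows that [\det (1 - A)] kills every [x i]
    and hence R. By faithfulness this determinant is 0, while it is 1 modulo [I]; thus 1 lies in
    [I]. *)
Lemma unit_functional : finitely_generated R -> projective R -> faithful R ->
  exists s : {linear R -> k^o}, s 1 = 1.
Proof.
move=> fg pr fa; have [n [x [c xc]]] := dual_basis fg pr.
pose I (a : k) := exists d : {linear R -> k^o}, d 1 = a.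
have I0 : I 0 by exists (\0 : {linear R -> k^o}).
have ID a b : I a -> I b -> I (a + b).
  by move=> [d <-] [d' <-]; exists (d \+ d' : {linear R -> k^o}).
have IM e a : I a -> I (e * a).
  by move=> [d <-]; exists (e \*: d : {linear R -> k^o}).
pose A := \matrix_(j, i) (c i (x j) : k).
have IA j i : I (A j i).
  (* The functional [t |-> c i (t * x j)] takes the value [c i (x j)] at 1. *)
  exists (c i \o (x j \o* (idfun : {linear R -> R})) : {linear R -> k^o}).
  by rewrite /= mul1r mxE.
have Ax j : \sum_i ((1%:M - A) j i) *: x i = 0.
  rewrite (eq_bigr (fun i => (j == i)%:R *: x i - (c i (x j) : k) *: x i)).
    rewrite sumrB -xc (bigD1 j) //= eqxx scale1r big1 ?addr0 ?subrr // => i ij.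
    by rewrite eq_sym (negPf ij) scale0r.
  by move=> i _; rewrite !mxE scalerBl.
have det0 i : \det (1%:M - A) *: x i = 0.
  have : \sum_j (\adj (1%:M - A) i j) *: \sum_l ((1%:M - A) j l) *: x l = 0.
    by rewrite big1 // => j _; rewrite Ax scaler0.
  rewrite (eq_bigr (fun j => \sum_l (\adj (1%:M - A) i j * (1%:M - A) j l) *: x l)); last first.
    by move=> j _; rewrite scaler_sumr; apply: eq_bigr => l _; rewrite scalerA.
  rewrite exchange_big /= (eq_bigr (fun l => (\adj (1%:M - A) *m (1%:M - A)) i l *: x l)); last first.
    by move=> l _; rewrite mxE scaler_suml.
  rewrite mul_adj_mx (bigD1 i) //= mxE eqxx mulr1n big1 ?addr0 // => l li.
  by rewrite mxE eq_sym (negPf li) mulr0n scale0r.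
have d0 : \det (1%:M - A) = 0.
  apply: fa => t; rewrite (xc t) scaler_sumr big1 // => i _.
  by rewrite scalerA mulrC -scalerA det0 scaler0.
have := det_sub1_ideal I0 ID IM IA; by rewrite d0 subr0.
Qed.

(** The two halves of the Azumaya condition are used separately: existence represents the rank one
    operators in R^e, uniqueness makes [ev] faithful. *)
Lemma azumaya_frame : azumaya R -> exists _ : frame, True.
Proof.
move=> [fg pr fa az].
have [n [x [c xc]]] := dual_basis fg pr; have [s s1] := unit_functional fg pr fa.
have rk (d : {linear R -> k^o}) : exists e : env R, forall t, ev e t = (d t : k) *: 1.
  pose g (t : R) : R := (d t : k) *: 1; have l : linear g.
    by move=> a u v; rewrite /g linearP scalerDl scalerA.
  have [e [he _]] := az (HB.pack_for {linear R -> R} g (GRing.isLinear.Build k R R *:%R g l)).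
  by exists e => t; exact: he.
have [f fE] := choice (fun i => rk (c i)); have [e eE] := rk s.
suff inj (a b : env R) : ev a =1 ev b -> a = b.
  by exists (@Frame n x c s f e xc s1 fE eE inj).
move=> ab; have [g [_ gU]] := az (ev a : {linear R -> R}).
by rewrite -(gU a) // -(gU b) // => t; exact/esym/ab.
Qed.
End Frame.

(** * The Morita context between k and the enveloping algebra *)

Section GroundRing.
Variable k : comNzRingType.

(** The isomorphism from k (x) k^op to k. Modules over k appear here as modules over [env k^o], so
    scalars have to be read off through it. *)
Definition kev (a : env k^o) : k := ev a 1.

Lemma kevE (a : env k^o) : a = kev a *: 1.
Proof.
elim/eten_ind: a => [r s||a b IH IH'].
- rewrite /kev ev_eten mulr1 -eten1 -scalerA -etenZr -etenZl.
  by congr eten; exact/esym/mulr1.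
- by rewrite /kev ev0l scale0r.
- by rewrite /kev evDl scalerDl {1}IH {1}IH'.
Qed.
Lemma kevD a b : kev (a + b) = kev a + kev b.
Proof. exact: (@evDl k k^o). Qed.
Lemma kevZ1 (c : k) : kev c%:A = c.
Proof. by rewrite /kev evZl ev1 [LHS]mulr1. Qed.
Lemma kev1 : kev 1 = 1.
Proof. by rewrite -[1 in LHS]scale1r kevZ1. Qed.
Lemma kevM a b : kev (a * b) = kev a * kev b.
Proof.
by rewrite {1}[a]kevE {1}[b]kevE -scalerAl -scalerAr mul1r scalerA kevZ1.
Qed.
Lemma kev_scale (M : lmodType (env k^o)) (a : env k^o) (m : M) :
  a *: m = (kev a)%:A *: m.
Proof. by rewrite -kevE. Qed.
End GroundRing.

Section Dual.
Variables (k : comNzRingType) (R : algType k).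

Definition invpred : {pred env R} := fun e => `[< forall r, esrc r * e = etgt r * e >].
Lemma invpredP e : reflect (forall r, esrc r * e = etgt r * e) (e \in invpred).
Proof. exact: asboolP. Qed.

Fact invpred_zmod : zmod_closed invpred.
Proof.
split=> [|a b /invpredP ha /invpredP hb]; apply/invpredP => r.
  by rewrite !mulr0.
by rewrite !mulrBr ha hb.
Qed.
HB.instance Definition _ := GRing.isZmodClosed.Build (env R) invpred invpred_zmod.

(* [e |-> e . t] identifies the elements [e] of R^e with [r e = \bar r e] with
   the k-linear functionals on R, [e] taking values in k 1. *)
Record dual := Dual { dual_val :> env R; dual_valP : dual_val \in invpred }.
HB.instance Definition _ := [isSub for dual_val].
HB.instance Definition _ := [Choice of dual by <:].
HB.instance Definition _ := [SubChoice_isSubZmodule of dual by <:].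

Implicit Types d : dual.

Lemma dual_valD d d' : dual_val (d + d') = dual_val d + dual_val d'.
Proof. exact: (raddfD val). Qed.
Lemma dual_val_sum I (r : seq I) (F : I -> dual) :
  dual_val (\sum_(i <- r) F i) = \sum_(i <- r) dual_val (F i).
Proof. exact: (raddf_sum val). Qed.
Lemma src_dual r d : esrc r * dual_val d = etgt r * dual_val d.
Proof. by have /invpredP := dual_valP d. Qed.
(** For [e = r \bar s] one has [\bar s d = s d], so [e d = r s d], and [r s] is [e . 1]. *)
Lemma mul_dual e d : e * dual_val d = esrc (ev e 1) * dual_val d.
Proof.
elim/eten_ind: e => [r s||a b IH IH'].
- by rewrite ev_eten mulr1 esrcM -[RHS]mulrA src_dual mulrA esrctgt.
- by rewrite ev0l mul0r esrcE -[0 in RHS](scale0r (1 : R)) etenZl scale0r mul0r.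
- by rewrite evDl esrcD !mulrDl IH IH'.
Qed.

Fact dual_mulP d (e : env R) : dual_val d * e \in invpred.
Proof. by apply/invpredP => r; rewrite !mulrA src_dual. Qed.
Definition dual_mul d (e : env R) : dual := Dual (dual_mulP d e).
Fact dual_scaleP (a : k) d : a *: dual_val d \in invpred.
Proof. by apply/invpredP => r; rewrite -!scalerAr src_dual. Qed.
Definition dual_scale (a : env k^o) d : dual := Dual (dual_scaleP (kev a) d).

Fact dual_scaleA a b d : dual_scale a (dual_scale b d) = dual_scale (a * b) d.
Proof. by apply: val_inj; rewrite /= kevM scalerA. Qed.
Fact dual_scale1 : left_id 1 dual_scale.
Proof. by move=> d; apply: val_inj; rewrite /= kev1 scale1r. Qed.
Fact dual_scaleDr : right_distributive dual_scale +%R.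
Proof. by move=> a d d'; apply: val_inj; rewrite /= scalerDr. Qed.
Fact dual_scaleDl d : {morph dual_scale^~ d : a b / a + b}.
Proof. by move=> a b; apply: val_inj; rewrite /= kevD scalerDl. Qed.
HB.instance Definition _ := GRing.Zmodule_isLmodule.Build (env k^o) dual
  dual_scaleA dual_scale1 dual_scaleDr dual_scaleDl.

Lemma dual_valZ (a : env k^o) d : dual_val (a *: d) = kev a *: dual_val d.
Proof. by []. Qed.

Fact dual_actA d b b' : dual_mul (dual_mul d b) b' = dual_mul d (b * b').
Proof. by apply: val_inj; rewrite /= mulrA. Qed.
Fact dual_act1 d : dual_mul d 1 = d.
Proof. by apply: val_inj; rewrite /= mulr1. Qed.
Fact dual_actDl d d' b : dual_mul (d + d') b = dual_mul d b + dual_mul d' b.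
Proof. by apply: val_inj; rewrite /= mulrDl. Qed.
Fact dual_actDr d b b' : dual_mul d (b + b') = dual_mul d b + dual_mul d b'.
Proof. by apply: val_inj; rewrite /= mulrDr. Qed.
Fact dual_actC a d b : dual_mul (a *: d) b = a *: dual_mul d b.
Proof. by apply: val_inj; rewrite /= -scalerAl. Qed.
Fact dual_actk (c : k) d : dual_mul d c%:A = c%:A *: d.
Proof. by apply: val_inj; rewrite /= kevZ1 -scalerAr mulr1. Qed.
Definition dual_bimod : bimod (env k^o) (env R) :=
  Bimod dual_actA dual_act1 dual_actDl dual_actDr dual_actC dual_actk.

Definition unit_act (t : unitobj R) (a : env k^o) : unitobj R := kev a *: (t : R).
Fact unit_actA t b b' : unit_act (unit_act t b) b' = unit_act t (b * b').
Proof. by rewrite /unit_act kevM scalerA mulrC. Qed.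
Fact unit_act1 t : unit_act t 1 = t.
Proof. by rewrite /unit_act kev1 scale1r. Qed.
Fact unit_actDl t t' b : unit_act (t + t') b = unit_act t b + unit_act t' b.
Proof. exact: (scalerDr (kev b) (t : R)). Qed.
Fact unit_actDr t b b' : unit_act t (b + b') = unit_act t b + unit_act t b'.
Proof. by rewrite /unit_act kevD scalerDl. Qed.
Fact unit_actC e t b : unit_act (e *: t) b = e *: unit_act t b.
Proof. by rewrite /unit_act -[RHS]/(ev e _) evZr. Qed.
Fact unit_actk (c : k) t : unit_act t c%:A = c%:A *: t.
Proof. by rewrite /unit_act kevZ1 -[RHS]/(ev _ _) evZl ev1. Qed.
Definition unit_bimod : bimod (env R) (env k^o) :=
  Bimod unit_actA unit_act1 unit_actDl unit_actDr unit_actC unit_actk.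
End Dual.

Section FrameDual.
Variables (k : comNzRingType) (R : algType k) (Fr : frame R).

(** Left and right multiplication by [r] agree on k 1; faithfulness of [ev] turns this equality of
    operators into one in R^e. *)
Lemma scalar_invpred (e : env R) (g : R -> k) :
  (forall t, ev e t = g t *: 1) -> e \in @invpred k R.
Proof.
move=> eE; apply/invpredP => r; apply: (fr_inj Fr) => t.
by rewrite !evM !eE ev_esrc ev_etgt -scalerAl -scalerAr mul1r mulr1.
Qed.
End FrameDual.

HB.lock Definition fr_df (k : comNzRingType) (R : algType k) (Fr : frame R)
  (i : 'I_(fr_n Fr)) : dual R := Dual (scalar_invpred Fr (fr_fE i)).
Arguments fr_df {k R Fr} i.
HB.lock Definition fr_de (k : comNzRingType) (R : algType k) (Fr : frame R) : dual R :=
  Dual (scalar_invpred Fr (fr_eE Fr)).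

Section FrameTheory.
Variables (k : comNzRingType) (R : algType k) (Fr : frame R).
Local Notation x := (fr_x (f := Fr)).
Local Notation c := (fr_c (f := Fr)).
Local Notation s := (fr_s Fr).
Local Notation f := fr_df.
Local Notation e0 := (fr_de Fr).
Implicit Type d : dual R.

Lemma ev_f i t : ev (f i) t = (c i t : k) *: 1.
Proof. by rewrite fr_df.unlock; exact: fr_fE. Qed.
Lemma ev_e t : ev e0 t = (s t : k) *: 1.
Proof. by rewrite fr_de.unlock; exact: fr_eE. Qed.
Lemma ev_e1 : ev e0 1 = 1. Proof. by rewrite ev_e fr_s1 scale1r. Qed.

(* [e . z = (e . 1) z] for every [e]; take [e = e0]. *)
Lemma central_scalar (z : R) : (forall r, r * z = z * r) -> z = (s z : k) *: 1.
Proof.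
move=> zc; have evz (e : env R) : ev e z = ev e 1 * z.
  elim/eten_ind: e => [r r'||a b IH IH'].
  - by rewrite !ev_eten mulr1 -!mulrA zc.
  - by rewrite !ev0l mul0r.
  - by rewrite !evDl mulrDl IH IH'.
by rewrite -ev_e evz ev_e1 mul1r.
Qed.

(** The value of the functional [d]: [ev d t] lies in k 1, and [s] reads off the scalar because
    [s 1 = 1]. *)
Definition dval d (t : R) : k := s (ev d t).
(** The element [d . t] is central, as [r (d . t) = (r d) . t = (\bar r d) . t = (d . t) r]. *)
Lemma ev_dual d t : ev d t = dval d t *: 1.
Proof.
apply: central_scalar => r.
by rewrite -[LHS]ev_esrc -[RHS]ev_etgt -!evM src_dual.
Qed.
Lemma dvalDl d d' t : dval (d + d') t = dval d t + dval d' t.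
Proof. by rewrite /dval dual_valD evDl linearD. Qed.
Lemma dvalDr d t t' : dval d (t + t') = dval d t + dval d t'.
Proof. by rewrite /dval evDr linearD. Qed.
Lemma dvalZl (a : env k^o) d t : dval (a *: d) t = kev a * dval d t.
Proof. by rewrite /dval dual_valZ evZl linearZ. Qed.
Lemma dvalZr (a : k) d t : dval d (a *: t) = a * dval d t.
Proof. by rewrite /dval evZr linearZ. Qed.
Lemma dval_mul d e t : dval (dual_mul d e) t = dval d (ev e t).
Proof. by rewrite /dval evM. Qed.
Lemma dval_f i t : dval (f i) t = c i t.
Proof. by rewrite /dval ev_f linearZ /= fr_s1 [LHS]mulr1. Qed.
Lemma dval_e t : dval e0 t = s t.
Proof. by rewrite /dval ev_e linearZ /= fr_s1 [LHS]mulr1. Qed.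

Lemma esrcZ1 (a : k) : esrc (a *: 1 : R) = a *: 1.
Proof. by rewrite esrcZ esrc1. Qed.

Lemma dual_src_mul d t d' : dual_val d * (esrc t * dual_val d') = dval d t *: dual_val d'.
Proof.
by rewrite mulrA mul_dual evM ev_esrc mulr1 ev_dual esrcZ1 -scalerAl mul1r.
Qed.
Lemma e0_mul d : dual_val e0 * dual_val d = dual_val d.
Proof. by rewrite mul_dual ev_e1 esrc1 mul1r. Qed.

Lemma frame_sum : \sum_i esrc (x i) * dual_val (f i) = 1.
Proof.
apply: (fr_inj Fr) => t; rewrite ev_suml ev1 [RHS](fr_coord Fr).
by apply: eq_bigr => i _; rewrite evM ev_f ev_esrc -scalerAr mulr1.
Qed.
Lemma frame_env (e : env R) : e = \sum_i esrc (ev e (x i)) * dual_val (f i).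
Proof.
rewrite -[LHS]mulr1 -frame_sum mulr_sumr; apply: eq_bigr => i _.
by rewrite mulrA mul_dual evM ev_esrc mulr1.
Qed.
Lemma frame_dual d : d = \sum_i (dval d (x i))%:A *: f i.
Proof.
apply: val_inj; rewrite /= dual_val_sum [LHS]frame_env; apply: eq_bigr => i _.
by rewrite dual_valZ ev_dual esrcZ1 -scalerAl mul1r kevZ1.
Qed.
Lemma frame_dual_env d : dual_val d = \sum_i dval d (x i) *: dual_val (f i).
Proof.
rewrite [LHS]frame_env; apply: eq_bigr => i _.
by rewrite ev_dual esrcZ1 -scalerAl mul1r.
Qed.
End FrameTheory.

Section Context.
Variables (k : comNzRingType) (R : algType k) (Fr : frame R).
Local Notation C := (unit_bimod R).
Local Notation D := (dual_bimod R).

Definition phi_fun (x : bten C D) : (env R)^o :=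
  tlift (fun (t : C) (d : D) => esrc (t : R) * dual_val d) x.
Fact phi_bal : balanced (fun (a : env k^o) (t : C) => bm_act t a)
  (fun (a : env k^o) (d : D) => a *: d) (fun (t : C) (d : D) => esrc (t : R) * dual_val d).
Proof.
split=> [t t' d|t d d'|a t d].
- by rewrite [esrc _]esrcD mulrDl.
- by rewrite dual_valD mulrDr.
- by rewrite dual_valZ [esrc _]esrcZ -scalerAl scalerAr.
Qed.
Lemma phiE t d : phi_fun (lpure t d) = esrc (t : R) * dual_val d.
Proof. exact: tliftE phi_bal. Qed.
Lemma phiD : {morph phi_fun : x y / x + y}. Proof. exact: tliftD phi_bal. Qed.
Lemma phi_fun0 : phi_fun 0 = 0. Proof. exact: tlift0 phi_bal. Qed.
Fact phi_linear : is_linear (M := bten C D) (N := (env R)^o) phi_fun.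
Proof.
move=> e u v; rewrite phiD; congr (_ + _).
elim/lten_ind: u => [t d||u w IH IH'].
- rewrite lpureZ !phiE -[RHS]/(e * (esrc (t : R) * dual_val d)).
  by rewrite mulrA [in RHS]mul_dual evM ev_esrc mulr1.
- by rewrite scaler0 phi_fun0 scaler0.
- by rewrite scalerDr !phiD IH IH' scalerDr.
Qed.
Fact phiR (u : bten C D) b : phi_fun (bm_act u b) = phi_fun u * b.
Proof.
elim/lten_ind: u => [t d||u v IH IH'].
- by rewrite [bm_act _ _]bten_actE !phiE mulrA.
- by rewrite [bm_act _ _]bten_act0 phi_fun0 mul0r.
- by rewrite [bm_act _ _]bten_actDl !phiD mulrDl IH IH'.
Qed.

Definition phiV (b : env R) : bten C D :=
  \sum_i lpure (ev b (fr_x (f := Fr) i) : C) (fr_df i : D).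
Fact phiVD : {morph phiV : a b / a + b}.
Proof.
move=> a b; rewrite /phiV -big_split /=; apply: eq_bigr => i _.
by rewrite evDl -lpureDl.
Qed.
Fact phiV0 : phiV 0 = 0.
Proof. by apply: (addrI (phiV 0)); rewrite -phiVD !addr0. Qed.
Fact phiK : cancel phi_fun phiV.
Proof.
move=> u; elim/lten_ind: u => [t d||u v IH IH'].
- rewrite phiE [d in RHS](frame_dual Fr) /phiV.
  rewrite (big_morph (lpure t) (lpureDr t) (lpure0r _ t)); apply: eq_bigr => i _.
  rewrite -lpureB; congr lpure.
  by rewrite evM ev_esrc (ev_dual Fr) -scalerAr mulr1 /bm_act /= /unit_act kevZ1.
- by rewrite phi_fun0 phiV0.
- by rewrite phiD phiVD IH IH'.
Qed.
Fact phiVK : cancel phiV phi_fun.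
Proof.
move=> b; rewrite /phiV (big_morph phi_fun phiD phi_fun0) [RHS](frame_env Fr).
by apply: eq_bigr => i _; rewrite phiE.
Qed.

Definition psi_fun (x : bten D C) : (env k^o)^o :=
  tlift (fun (d : D) (t : C) => (dval Fr d (t : R))%:A) x.
Fact psi_bal : balanced (fun (a : env R) (d : D) => bm_act d a)
  (fun (a : env R) (t : C) => a *: t) (fun (d : D) (t : C) => (dval Fr d (t : R))%:A : env k^o).
Proof.
split=> [d d' t|d t t'|e d t].
- by rewrite dvalDl scalerDl.
- by rewrite -scalerDl -dvalDr.
- by rewrite dval_mul.
Qed.
Lemma psiE d t : psi_fun (lpure d t) = (dval Fr d (t : R))%:A.
Proof. exact: tliftE psi_bal. Qed.
Lemma psiD : {morph psi_fun : x y / x + y}. Proof. exact: tliftD psi_bal. Qed.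
Lemma psi_fun0 : psi_fun 0 = 0. Proof. exact: tlift0 psi_bal. Qed.
Fact psi_linear : is_linear (M := bten D C) (N := (env k^o)^o) psi_fun.
Proof.
move=> a u v; rewrite psiD; congr (_ + _).
elim/lten_ind: u => [d t||u w IH IH'].
- rewrite lpureZ !psiE dvalZl -[RHS]/(a * _) [a in RHS]kevE.
  by rewrite -scalerAl mul1r scalerA.
- by rewrite scaler0 psi_fun0 scaler0.
- by rewrite scalerDr !psiD IH IH' scalerDr.
Qed.
Fact psiR (u : bten D C) b : psi_fun (bm_act u b) = psi_fun u * b.
Proof.
elim/lten_ind: u => [d t||u v IH IH'].
- rewrite [bm_act _ _]bten_actE !psiE -[RHS]/((_%:A : env k^o) * b) -scalerAl mul1r.
  by rewrite [b in RHS]kevE scalerA mulrC -dvalZr.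
- by rewrite [bm_act _ _]bten_act0 psi_fun0 mul0r.
- by rewrite [bm_act _ _]bten_actDl !psiD mulrDl IH IH'.
Qed.

(* [d (x) g t = d t (x) g 1 = e0 (d t) (x) g 1 = e0 (x) d(t) g 1] *)
Lemma dual_lpure (N : lmodType (env R)) (g : {linear unitobj R -> N}) (d : D) t :
  lpure d (g t) = (dval Fr d (t : R))%:A *: lpure (fr_de Fr : D) (g (1 : R)) :> lten D N.
Proof.
have -> : g t = esrc (t : R) *: g (1 : R).
  by rewrite -linearZZ; congr (g _); rewrite -[RHS]/(ev _ _) ev_esrc mulr1.
rewrite -lpureB -[bm_act _ _]/(dual_mul d _).
set d' := dual_mul d _.
have -> : d' = dual_mul (fr_de Fr) d' by apply: val_inj; exact/esym/e0_mul.
rewrite -[dual_mul (fr_de Fr) _]/(bm_act (fr_de Fr : D) _) lpureB lpureZ.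
have -> : dual_val d' *: g (1 : R) = (dval Fr d (t : R))%:A *: g (1 : R).
  rewrite -!linearZZ; congr (g _).
  rewrite -[LHS]/(ev d' 1) -[RHS]/(ev _ _) evM ev_esrc mulr1 (ev_dual Fr) evZl.
  by rewrite ev1.
by rewrite -lpureB [bm_act _ _]dual_actk.
Qed.
Fact psi_bij : bijective psi_fun.
Proof.
(* The generator [e0 (x) 1] is sent to [e_0(1) = 1]; [dual_lpure] with the identity shows that every
   pure tensor is a multiple of it. *)
exists (fun a => a *: lpure (fr_de Fr : D) ((1 : R) : C)) => [u|a].
- elim/lten_ind: u => [d t||u v IH IH'].
  + by rewrite psiE -(dual_lpure idfun).
  + by rewrite psi_fun0 scale0r.
  + by rewrite psiD scalerDl IH IH'.
- rewrite lpureZ psiE dvalZl dval_e fr_s1 [RHS]kevE; congr (_ *: _); exact: mulr1.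
Qed.

Fact context_assocC (t : C) (d : D) (t' : C) :
  phi_fun (lpure t d) *: t' = bm_act t (psi_fun (lpure d t')).
Proof.
rewrite phiE psiE -[LHS]/(ev _ _) evM ev_esrc (ev_dual Fr) -scalerAr mulr1.
by rewrite -[RHS]/(kev _ *: _) kevZ1.
Qed.
Fact context_assocD (d : D) (t : C) (d' : D) :
  psi_fun (lpure d t) *: d' = bm_act d (phi_fun (lpure t d')).
Proof.
by apply: val_inj; rewrite phiE psiE /= (dual_src_mul Fr) kevZ1.
Qed.

Definition azumaya_context : morita_context (env k^o) (env R) :=
  @MoritaContext k (env k^o) (env R) C D (mk_linear phi_linear) phiV phiK phiVK phiR (mk_linear psi_linear) psi_bij psiR
    context_assocC context_assocD.
End Context.

(** * The equivalence R (x) - *)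

Section Spanning.

(** Generation as an additive monoid, put as an induction principle. Pure tensors satisfy it since
    their opposites are again pure. *)
Definition spanning (V : zmodType) (T : Type) (g : T -> V) : Prop :=
  forall P : V -> Prop, (forall t, P (g t)) -> P 0 ->
    (forall x y, P x -> P y -> P (x + y)) -> forall v, P v.

Lemma morph_add0 (V G : zmodType) (f : V -> G) : {morph f : x y / x + y} -> f 0 = 0.
Proof. by move=> fD; apply: (addrI (f 0)); rewrite -fD !addr0. Qed.

Lemma spanning_ext (V G : zmodType) (T : Type) (g : T -> V) (f f' : V -> G) :
  spanning g -> {morph f : x y / x + y} -> {morph f' : x y / x + y} ->
  (forall t, f (g t) = f' (g t)) -> f =1 f'.
Proof.
move=> sg fD fD' ff'; apply: sg => [//||x y IH IH'].
  by rewrite !morph_add0.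
by rewrite fD fD' IH IH'.
Qed.

Lemma spanning_id (V : zmodType) : spanning (id : V -> V).
Proof. by []. Qed.

Lemma spanning_pure (M N : zmodType) I (al : I -> M -> M) (be : I -> N -> N)
    (T U : Type) (gM : T -> M) (gN : U -> N) :
  spanning gM -> spanning gN ->
  spanning (fun p : T * U => pure (gM p.1) (gN p.2) : tens al be).
Proof.
move=> sM sN P Pp P0 PD; apply: tens_ind => // m n; move: m.
apply: sM => [t||m m' IH IH']; last by rewrite pureDl; exact: PD.
- move: n; apply: sN => [u||n n' IH IH'].
  + exact: (Pp (t, u)).
  + by rewrite (morph_add0 (pureDr al be (gM t))).
  + by rewrite pureDr; exact: PD.
- by rewrite (morph_add0 (fun a b => pureDl al be a b n)).
Qed.
Lemma spanning_pure1 (M N : zmodType) I (al : I -> M -> M) (be : I -> N -> N) :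
  spanning (fun p : M * N => pure p.1 p.2 : tens al be).
Proof. by move=> P Pp P0 PD; apply: tens_ind => // m n; exact: (Pp (m, n)). Qed.

Lemma lten_ext (k : comNzRingType) (A B : algType k) (C : bimod B A) (M : lmodType A)
    (G : zmodType) (f f' : lten C M -> G) :
  {morph f : x y / x + y} -> {morph f' : x y / x + y} ->
  (forall c m, f (lpure c m) = f' (lpure c m)) -> f =1 f'.
Proof.
by move=> fD fD' ff'; apply: (spanning_ext (@spanning_pure1 _ _ _ _ _) fD fD') => -[].
Qed.

Lemma spanning_lten (k : comNzRingType) (A B : algType k) (C : bimod B A) (M : lmodType A) :
  spanning (fun p : C * M => lpure p.1 p.2 : lten C M).
Proof. exact: spanning_pure1. Qed.

Section Diamond.
Variables (k : comNzRingType) (R : algType k) (M N : lmodType (env R)).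
Variables (T U : Type) (gM : T -> M) (gN : U -> N).
Hypotheses (sM : spanning gM) (sN : spanning gN).

Lemma spanning_dia : spanning (fun p : T * U => dia (gM p.1) (gN p.2) : diamond M N).
Proof. exact: spanning_pure. Qed.
Lemma dia_ext (G : zmodType) (f f' : diamond M N -> G) :
  {morph f : x y / x + y} -> {morph f' : x y / x + y} ->
  (forall t u, f (dia (gM t) (gN u)) = f' (dia (gM t) (gN u))) -> f =1 f'.
Proof. by move=> fD fD' ff'; apply: (spanning_ext spanning_dia fD fD') => -[]. Qed.
End Diamond.
End Spanning.

Section TensorFunctor.
Variables (k : comNzRingType) (A B : algType k) (C : bimod B A).

Section Map.
Variables (M N : lmodType A) (f : {linear M -> N}).

Fact lten_map_bal : balanced (fun (b : A) (c : C) => bm_act c b)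
  (fun (b : A) (n : M) => b *: n) (fun c n => lpure c (f n) : lten C N).
Proof.
split=> [c c' n|c n n'|a c n].
- exact: lpureDl.
- by rewrite raddfD lpureDr.
- by rewrite lpureB linearZZ.
Qed.
Lemma lten_mapE c m : lten_map f (lpure c m) = lpure c (f m) :> lten C N.
Proof. exact: tliftE lten_map_bal. Qed.
Lemma lten_mapD : {morph (lten_map f : lten C M -> lten C N) : x y / x + y}.
Proof. exact: tliftD lten_map_bal. Qed.
Fact lten_map_linear : is_linear (lten_map f : lten C M -> lten C N).
Proof.
move=> b x y; rewrite lten_mapD; congr (_ + _).
elim/lten_ind: x => [c m||u v IH IH'].
- by rewrite lpureZ !lten_mapE lpureZ.
- by rewrite scaler0 (morph_add0 lten_mapD) scaler0.
- by rewrite scalerDr !lten_mapD IH IH' scalerDr.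
Qed.
Definition lten_mapL := mk_linear lten_map_linear.
End Map.

Fact lten_map_id (M : lmodType A) : lten_mapL (idfun : {linear M -> M}) =1 id.
Proof.
apply: lten_ext => [||c m] //; first exact: lten_mapD.
exact: lten_mapE.
Qed.
Fact lten_map_comp (M N P : lmodType A) (g : {linear N -> P}) (f : {linear M -> N}) :
  lten_mapL (g \o f) =1 lten_mapL g \o lten_mapL f.
Proof.
apply: lten_ext => [||c m].
- exact: lten_mapD.
- by move=> u v; rewrite /= !lten_mapD.
- by rewrite /= [LHS]lten_mapE !(lten_mapE, lten_mapE g).
Qed.
Definition lten_functor : modfunctor A B := ModFunctor lten_map_id lten_map_comp.

Lemma lten_functorE (M N : lmodType A) (f : {linear M -> N}) c m :
  fun_map lten_functor f (lpure c m) = lpure c (f m).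
Proof. exact: lten_mapE. Qed.

Lemma lpurek c (a : k) (M : lmodType A) (m : M) :
  lpure c (a%:A *: m) = a%:A *: lpure c m :> lten C M.
Proof. by rewrite -lpureB bm_actk lpureZ. Qed.

Lemma lten_functor_klinear : klinear lten_functor.
Proof.
move=> M N a f g h hE; apply: lten_ext => [||c m].
- exact: lten_mapD.
- by move=> u v; rewrite /= !lten_mapD scalerDr addrACA.
- by rewrite !lten_functorE hE lpureDr lpurek.
Qed.
End TensorFunctor.

Section Equivalence.
Variables (k : comNzRingType) (R : algType k) (Fr : frame R).
Local Notation C := (unit_bimod R).
Local Notation D := (dual_bimod R).

Section Unit.
Variable M : lmodType (env k^o).
(** The element [e0 (x) 1] is the preimage of 1 under the pairing of D and C, so this is the unit
    given by the Morita context. *)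
Definition eta_fun (m : M) : lten D (lten C M) := lpure (fr_de Fr : D) (lpure ((1 : R) : C) m).
Fact eta_linear : is_linear eta_fun.
Proof.
move=> a m m'; rewrite /eta_fun lpureDr lpureDr; congr (_ + _).
by rewrite kev_scale [in RHS]kev_scale !lpurek.
Qed.
Lemma etaD : {morph eta_fun : m m' / m + m'}.
Proof. exact: raddfD (mk_linear eta_linear). Qed.
Fact lpure_linear (m : M) : is_linear (fun t : unitobj R => lpure (t : C) m).
Proof. by move=> e t t'; rewrite lpureDl lpureZ. Qed.
Definition lpureL m := mk_linear (lpure_linear m).
Definition etaV_in (d : D) (v : lten C M) : M :=
  tlift (fun (t : C) (m : M) => (dval Fr d (t : R))%:A *: m) v.
Fact etaV_in_bal d : balanced (fun (a : env k^o) (t : C) => bm_act t a)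
  (fun (a : env k^o) (m : M) => a *: m) (fun (t : C) (m : M) => (dval Fr d (t : R))%:A *: m).
Proof.
split=> [t t' m|t m m'|a t m].
- by rewrite [dval _ _ _]dvalDr !scalerDl.
- by rewrite scalerDr.
- by rewrite [dval _ _ _]dvalZr [in RHS]kev_scale scalerA -scalerAl mul1r scalerA mulrC.
Qed.
Lemma etaV_inE d t m : etaV_in d (lpure t m) = (dval Fr d (t : R))%:A *: m.
Proof. exact: tliftE (etaV_in_bal d). Qed.
Lemma etaV_inD d : {morph etaV_in d : x y / x + y}.
Proof. exact: tliftD (etaV_in_bal d). Qed.
Definition etaV (u : lten D (lten C M)) : M := tlift etaV_in u.
Fact etaV_bal : balanced (fun (a : env R) (d : D) => bm_act d a)
  (fun (a : env R) (v : lten C M) => a *: v) etaV_in.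
Proof.
split=> [d d' v|d v v'|a d v].
- by rewrite /etaV_in -tlift_add; apply: eq_tlift => t m; rewrite dvalDl !scalerDl.
- exact: etaV_inD.
- elim/lten_ind: v => [t m||v v' IH IH'].
  + by rewrite lpureZ !etaV_inE dval_mul.
  + by rewrite scaler0 !(morph_add0 (@etaV_inD _)).
  + by rewrite scalerDr !etaV_inD IH IH'.
Qed.
Lemma etaVE d v : etaV (lpure d v) = etaV_in d v.
Proof. exact: tliftE etaV_bal. Qed.
Lemma etaVD : {morph etaV : x y / x + y}.
Proof. exact: tliftD etaV_bal. Qed.
Fact eta_bij : bijective eta_fun.
Proof.
exists etaV => [m|].
  by rewrite etaVE etaV_inE dval_e fr_s1 !scale1r.
elim/lten_ind => [d v||u u' IH IH'].
- elim/lten_ind: v => [t m||v v' IH IH'].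
  + by rewrite etaVE etaV_inE /eta_fun (dual_lpure Fr (lpureL m)) !lpurek.
  + by rewrite (morph_add0 (lpureDr d)) (morph_add0 etaVD) (morph_add0 etaD).
  + by rewrite lpureDr etaVD etaD IH IH'.
- by rewrite (morph_add0 etaVD) (morph_add0 etaD).
- by rewrite etaVD etaD IH IH'.
Qed.
End Unit.

Section Counit.
Variable N : lmodType (env R).
Definition eps_in (t : C) (v : lten D N) : N :=
  tlift (fun (d : D) (n : N) => (esrc (t : R) * dual_val d) *: n) v.
Fact eps_in_bal t : balanced (fun (a : env R) (d : D) => bm_act d a)
  (fun (a : env R) (n : N) => a *: n)
  (fun (d : D) (n : N) => (esrc (t : R) * dual_val d) *: n).
Proof.
split=> [d d' n|d n n'|a d n].
- by rewrite dual_valD mulrDr scalerDl.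
- by rewrite scalerDr.
- by rewrite scalerA -mulrA.
Qed.
Lemma eps_inE t d n : eps_in t (lpure d n) = (esrc (t : R) * dual_val d) *: n.
Proof. exact: tliftE (eps_in_bal t). Qed.
Lemma eps_inD t : {morph eps_in t : x y / x + y}.
Proof. exact: tliftD (eps_in_bal t). Qed.
Definition eps_fun (u : lten C (lten D N)) : N := tlift eps_in u.
Fact eps_bal : balanced (fun (a : env k^o) (t : C) => bm_act t a)
  (fun (a : env k^o) (v : lten D N) => a *: v) eps_in.
Proof.
split=> [t t' v|t v v'|a t v].
- rewrite /eps_in -tlift_add; apply: eq_tlift => d n.
  by rewrite [esrc _]esrcD mulrDl scalerDl.
- exact: eps_inD.
- elim/lten_ind: v => [d n||v v' IH IH'].
  + by rewrite lpureZ !eps_inE dual_valZ [esrc _]esrcZ -scalerAl scalerAr.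
  + by rewrite scaler0 !(morph_add0 (@eps_inD _)).
  + by rewrite scalerDr !eps_inD IH IH'.
Qed.
Lemma epsE t d n : eps_fun (lpure t (lpure d n)) = (esrc (t : R) * dual_val d) *: n.
Proof. by rewrite -eps_inE; exact: tliftE eps_bal. Qed.
Lemma epsD : {morph eps_fun : x y / x + y}.
Proof. exact: tliftD eps_bal. Qed.
Lemma spanning_CD : spanning (fun p : C * (D * N) =>
  lpure p.1 (lpure p.2.1 p.2.2) : lten C (lten D N)).
Proof.
move=> P Pp P0 PD; elim/lten_ind => [t v||//]; last exact: P0.
elim/lten_ind: v => [d n||v v' IH IH'].
- exact: (Pp (t, (d, n))).
- by rewrite lpure0r.
- by rewrite lpureDr; exact: PD.
Qed.
Lemma CD_ext (G : zmodType) (f f' : lten C (lten D N) -> G) :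
  {morph f : x y / x + y} -> {morph f' : x y / x + y} ->
  (forall t d n, f (lpure t (lpure d n)) = f' (lpure t (lpure d n))) -> f =1 f'.
Proof. by move=> fD fD' ff'; apply: (spanning_ext spanning_CD fD fD') => -[t [d n]]. Qed.
Fact eps_linear : is_linear eps_fun.
Proof.
move=> e u v; rewrite epsD; congr (_ + _); move: u.
apply: CD_ext => [u w|u w|t d n] /=.
- by rewrite scalerDr epsD.
- by rewrite epsD scalerDr.
- rewrite lpureZ !epsE scalerA; congr (_ *: _).
  by rewrite mulrA [in RHS]mul_dual evM ev_esrc mulr1.
Qed.
Definition epsV (n : N) : lten C (lten D N) :=
  \sum_i lpure (fr_x (f := Fr) i : C) (lpure (fr_df i : D) n).
Fact epsVD : {morph epsV : n n' / n + n'}.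
Proof.
move=> n n'; rewrite /epsV -big_split /=; apply: eq_bigr => i _.
by rewrite !lpureDr.
Qed.
Fact eps_bij : bijective eps_fun.
Proof.
exists epsV => [|n]; last first.
  rewrite /epsV (big_morph eps_fun epsD (morph_add0 epsD)) -[RHS]scale1r -(frame_sum Fr).
  by rewrite scaler_suml; apply: eq_bigr => i _; rewrite epsE.
apply: CD_ext => [u w|//|t d n] /=.
  by rewrite epsD epsVD.
rewrite epsE /epsV.
under eq_bigr => i _.
  (* In R^e, [f_i t d = c_i(t) d]. The scalar is moved to the left across both tensor signs, where
     [\sum_i c_i(t) x_i = t]. *)
  rewrite -lpureB [bm_act _ _](_ : _ = (fr_c i t : k)%:A *: (d : D)); last first.
    apply: val_inj; rewrite /= (dual_src_mul Fr (fr_df i)) dval_f kevZ1 //.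
  rewrite -lpureZ -lpureB [bm_act _ _]unit_actk.
  over.
rewrite -(big_morph (fun t => lpure t (lpure d n)) (fun a b => lpureDl a b (lpure d n))
  (morph_add0 (fun a b => lpureDl a b (lpure d n)))).
congr lpure; rewrite [RHS](fr_coord Fr); apply: eq_bigr => i _.
by rewrite -[LHS]/(ev _ _) evZl ev1.
Qed.
End Counit.

Lemma lten_functor_equivalence : is_equivalence (lten_functor C).
Proof.
exists (lten_functor D), (fun M => mk_linear (@eta_linear M)), (fun N => mk_linear (@eps_linear N)).
split=> [M|N|M M' f m|N N' g].
- exact: eta_bij.
- exact: eps_bij.
- by rewrite [RHS]lten_functorE lten_functorE.
- apply: CD_ext => [u w|u w|t d n].
  + by rewrite !raddfD.
  + by rewrite !raddfD.
  + by rewrite !lten_functorE !mk_linearE !epsE linearZZ.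
Qed.
End Equivalence.

(** * Its monoidal structure *)

Section GroundDiamond.
Variable k : comNzRingType.

Lemma src_actk (M : lmodType (env k^o)) (a : k) (m : M) : src_act (a : k^o) m = a%:A *: m.
Proof. by rewrite /src_act esrcE (kevE (eten _ _)) /kev ev_eten !mulr1. Qed.
Lemma tgt_actk (M : lmodType (env k^o)) (a : k) (m : M) : tgt_act (a : k^o) m = a%:A *: m.
Proof. by rewrite /tgt_act etgtE (kevE (eten _ _)) /kev ev_eten !mul1r. Qed.
Lemma dia_zl (M N : lmodType (env k^o)) (a : env k^o) (m : M) (n : N) :
  a *: dia m n = dia (a *: m) n.
Proof.
by rewrite [a]kevE -!src_actk src_dia.
Qed.
Lemma dia_zr (M N : lmodType (env k^o)) (a : env k^o) (m : M) (n : N) :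
  a *: dia m n = dia m (a *: n).
Proof. by rewrite [a]kevE -!tgt_actk tgt_dia. Qed.
End GroundDiamond.

Section Diamond0.
Variables (k : comNzRingType) (R : algType k) (M N : lmodType (env R)).
Lemma dia0l (n : N) : dia (0 : M) n = 0.
Proof. exact: (morph_add0 (fun a b => diaDl a b n)). Qed.
Lemma dia0r (m : M) : dia m (0 : N) = 0.
Proof. exact: (morph_add0 (diaDr m)). Qed.
Lemma src_actZ1 (a : k) (m : M) : src_act (a *: 1 : R) m = (a%:A : env R) *: m.
Proof. by rewrite /src_act esrcZ esrc1. Qed.
Lemma tgt_actZ1 (a : k) (m : M) : tgt_act (a *: 1 : R) m = (a%:A : env R) *: m.
Proof. by rewrite /tgt_act etgtZ etgt1. Qed.
End Diamond0.

Section UnitFunctor.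
Variables (k : comNzRingType) (R : algType k).
Local Notation C := (unit_bimod R).
Local Notation F := (lten_functor C).
Implicit Types (t : C) (M N P : lmodType (env k^o)).

Definition cmul (t t' : C) : C := ((t : R) * (t' : R) : R).

Lemma actC t (a : env k^o) : bm_act t a = kev a *: (t : R) :> R.
Proof. by []. Qed.
Lemma src_lpure (r : R) M t (m : M) : src_act r (lpure t m) = lpure (cmul r t) m.
Proof. by rewrite /src_act lpureZ; congr lpure; exact: ev_esrc. Qed.
Lemma tgt_lpure (r : R) M t (m : M) : tgt_act r (lpure t m) = lpure (cmul t r) m.
Proof. by rewrite /tgt_act lpureZ; congr lpure; exact: ev_etgt. Qed.
Lemma lpure_1l M t (m : M) : lpure t m = src_act (t : R) (lpure ((1 : R) : C) m).
Proof. by rewrite src_lpure /cmul mulr1. Qed.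

Section Xi.
Variables M N : lmodType (env k^o).

(** The monoidal structure is [(t (x) m) (x) (t' (x) n) |-> t t' (x) (m (x) n)]. It is built one
    tensor factor at a time; balancedness over R is associativity of R. *)
Definition xi_in (t : C) (m : M) (v : lten C N) : lten C (diamond M N) :=
  tlift (fun (t' : C) (n : N) => lpure (cmul t t') (dia m n)) v.
Fact xi_in_bal t (m : M) : balanced (fun (a : env k^o) (t : C) => bm_act t a)
  (fun (a : env k^o) (n : N) => a *: n) (fun (t' : C) (n : N) => lpure (cmul t t') (dia m n)).
Proof.
split=> [t' t'' n|t' n n'|a t' n].
- by rewrite /cmul mulrDr lpureDl.
- by rewrite diaDr lpureDr.
- by rewrite /cmul actC -dia_zr -lpureB -scalerAr.
Qed.
Lemma xi_inE t m t' n : xi_in t m (lpure t' n) = lpure (cmul t t') (dia m n).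
Proof. exact: tliftE (xi_in_bal t m). Qed.
Lemma xi_inD t (m : M) : {morph xi_in t m : x y / x + y}.
Proof. exact: tliftD (xi_in_bal t m). Qed.
Definition xi_mid (v : lten C N) (u : lten C M) : lten C (diamond M N) :=
  tlift (fun t m => xi_in t m v) u.
Fact xi_mid_bal v : balanced (fun (a : env k^o) (t : C) => bm_act t a)
  (fun (a : env k^o) (m : M) => a *: m) (fun t m => xi_in t m v).
Proof.
split=> [t t' m|t m m'|a t m]; rewrite /xi_in -?tlift_add; apply: eq_tlift => t'' n.
- by rewrite /cmul mulrDl lpureDl.
- by rewrite diaDl lpureDr.
- by rewrite /cmul actC -dia_zl -lpureB -scalerAl.
Qed.
Lemma xi_midE v t m : xi_mid v (lpure t m) = xi_in t m v.
Proof. exact: tliftE (xi_mid_bal v). Qed.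
Lemma xi_midD v : {morph xi_mid v : x y / x + y}.
Proof. exact: tliftD (xi_mid_bal v). Qed.
Lemma xi_midDr u : {morph xi_mid^~ u : x y / x + y}.
Proof.
move=> v v'; rewrite /xi_mid -tlift_add; apply: eq_tlift => t m.
exact: xi_inD.
Qed.
Definition xi_fun (x : diamond (lten C M) (lten C N)) : lten C (diamond M N) :=
  dia_lift (fun u v => xi_mid v u) x.
Fact xi_bal : dia_balanced (fun (u : lten C M) (v : lten C N) => xi_mid v u).
Proof.
split=> [u u' v|u v v'|r u v]; [exact: xi_midD | exact: xi_midDr|].
elim/lten_ind: u => [t m||u u' IH IH'].
- elim/lten_ind: v => [t' n||v v' IH IH'].
  + by rewrite tgt_lpure src_lpure !xi_midE !xi_inE /cmul mulrA.
  + by rewrite /src_act scaler0 !(morph_add0 (@xi_midDr _)).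
  + by rewrite src_actD !xi_midDr IH IH'.
- by rewrite /tgt_act scaler0 !(morph_add0 (@xi_midD _)).
- by rewrite tgt_actD !xi_midD IH IH'.
Qed.
Lemma xiE t m t' n : xi_fun (dia (lpure t m) (lpure t' n)) = lpure (cmul t t') (dia m n).
Proof. by rewrite -xi_inE -xi_midE; exact: dia_liftE xi_bal. Qed.
Lemma xiD : {morph xi_fun : x y / x + y}.
Proof. exact: dia_liftD xi_bal. Qed.

Lemma dia_lten_ext (G : zmodType) (f f' : diamond (lten C M) (lten C N) -> G) :
  {morph f : x y / x + y} -> {morph f' : x y / x + y} ->
  (forall t m t' n, f (dia (lpure t m) (lpure t' n)) = f' (dia (lpure t m) (lpure t' n))) ->
  f =1 f'.
Proof.
move=> fD fD' ff'; apply: (dia_ext (@spanning_lten _ _ _ _ _) (@spanning_lten _ _ _ _ _)) => // -[t m] [t' n].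
Qed.

Fact xi_linear : is_linear xi_fun.
Proof.
apply: env_linear => [|r s x]; first exact: xiD.
move: x; apply: dia_lten_ext => [x y|x y|t m t' n].
- by rewrite scalerDr xiD.
- by rewrite xiD scalerDr.
- rewrite dia_actE src_lpure tgt_lpure !xiE lpureZ; congr lpure.
  by rewrite -[RHS]/(ev _ _) ev_eten /cmul !mulrA.
Qed.
Definition xi := mk_linear xi_linear.
Lemma xi_pureE t m t' n :
  xi (dia (lpure t m) (lpure t' n)) = lpure (cmul t t') (dia m n).
Proof. exact: xiE. Qed.

Definition xiV_in (t : C) (z : diamond M N) : diamond (lten C M) (lten C N) :=
  dia_lift (fun m n => dia (lpure t m) (lpure ((1 : R) : C) n)) z.
Fact xiV_in_bal t : dia_balanced (fun (m : M) (n : N) =>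
  dia (lpure t m) (lpure ((1 : R) : C) n)).
Proof.
split=> [m m' n|m n n'|a m n].
- by rewrite lpureDr diaDl.
- by rewrite lpureDr diaDr.
- rewrite src_actk tgt_actk !lpurek.
  by rewrite -tgt_actZ1 diaB src_actZ1.
Qed.
Lemma xiV_inE t m n : xiV_in t (dia m n) = dia (lpure t m) (lpure ((1 : R) : C) n).
Proof. exact: dia_liftE (xiV_in_bal t). Qed.
Lemma xiV_inD t : {morph xiV_in t : x y / x + y}.
Proof. exact: dia_liftD (xiV_in_bal t). Qed.
Definition xiV (w : lten C (diamond M N)) : diamond (lten C M) (lten C N) := tlift xiV_in w.
Fact xiV_bal : balanced (fun (a : env k^o) (t : C) => bm_act t a)
  (fun (a : env k^o) (z : diamond M N) => a *: z) xiV_in.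
Proof.
split=> [t t' z|t z z'|a t z].
- by rewrite /xiV_in -dia_lift_add; apply: eq_dia_lift => m n; rewrite lpureDl diaDl.
- exact: xiV_inD.
- elim/dia_ind: z => [m n||z z' IH IH'].
  + by rewrite dia_zl !xiV_inE lpureB.
  + by rewrite scaler0 !(morph_add0 (@xiV_inD _)).
  + by rewrite scalerDr !xiV_inD IH IH'.
Qed.
Lemma xiVE t m n : xiV (lpure t (dia m n)) = dia (lpure t m) (lpure ((1 : R) : C) n).
Proof. by rewrite -xiV_inE; exact: tliftE xiV_bal. Qed.
Lemma xiVD : {morph xiV : x y / x + y}.
Proof. exact: tliftD xiV_bal. Qed.

Lemma lten_dia_ext (G : zmodType) (f f' : lten C (diamond M N) -> G) :
  {morph f : x y / x + y} -> {morph f' : x y / x + y} ->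
  (forall t m n, f (lpure t (dia m n)) = f' (lpure t (dia m n))) -> f =1 f'.
Proof.
move=> fD fD' ff'; apply: lten_ext => // t z.
elim/dia_ind: z => [m n||z z' IH IH']; first exact: ff'.
- by rewrite lpure0r !morph_add0.
- by rewrite lpureDr fD fD' IH IH'.
Qed.

(** The inverse puts all of R in the first factor: [t' (x) n] is [t'] acting on [1 (x) n], and
    crossing the diamond turns [t (x) m] into [t t' (x) m]. *)
Fact xi_bij : bijective xi.
Proof.
exists xiV.
- apply: dia_lten_ext => [x y|//|t m t' n]; first by rewrite raddfD xiVD.
  by rewrite /= xiE xiVE (lpure_1l t') -diaB tgt_lpure.
- apply: lten_dia_ext => [x y|//|t m n]; first by rewrite xiVD raddfD.
  by rewrite xiVE /= xiE /cmul mulr1.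
Qed.
End Xi.

Definition xi_unit (t : unitobj R) : lten C (unitobj k^o) := lpure (t : C) ((1 : k^o) : unitobj k^o).
Fact xi_unit_linear : is_linear xi_unit.
Proof. by move=> e t t'; rewrite /xi_unit lpureDl lpureZ. Qed.
Lemma xi_unitD : {morph xi_unit : x y / x + y}.
Proof. by move=> t t'; rewrite /xi_unit lpureDl. Qed.
Lemma lpure_unit (t : C) (a : k) : lpure t ((a : k^o) : unitobj k^o) = xi_unit (a *: (t : R)).
Proof.
rewrite /xi_unit -[a in RHS]kevZ1 -actC lpureB; congr lpure.
by rewrite -[RHS]/(ev _ _) evZl ev1; exact/esym/mulr1.
Qed.
Fact xi_unit_bij : bijective xi_unit.
Proof.
pose g (t : C) (a : unitobj k^o) : unitobj R := (a : k) *: (t : R).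
have gb : balanced (fun (a : env k^o) (t : C) => bm_act t a)
  (fun (a : env k^o) (z : unitobj k^o) => a *: z) g.
  split=> [t t' a|t a a'|b t a].
  - exact: (scalerDr (a : k) (t : R) (t' : R)).
  - exact: (scalerDl (t : R) (a : k) (a' : k)).
  - rewrite /g actC scalerA.
    by rewrite -[b *: a]/(ev b a) [b in RHS]kevE evZl ev1 mulrC.
exists (fun x => tlift g x) => [t|].
  by rewrite /xi_unit /lpure (tliftE _ _ gb) /g scale1r.
apply: lten_ext => [x y|//|t a].
  by rewrite (tliftD gb) xi_unitD.
by rewrite /lpure (tliftE _ _ gb) -[RHS]/(lpure _ _) lpure_unit.
Qed.

Fact xi_nat M M' N N' (f : {linear M -> M'}) (g : {linear N -> N'}) x :
  xi M' N' (dia_map (fun_map F f) (fun_map F g) x) = fun_map F (dia_map f g) (xi M N x).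
Proof.
move: x; apply: dia_lten_ext => [x y|x y|t m t' n]; try by rewrite !raddfD.
by rewrite dia_mapE !lten_functorE !xi_pureE !lten_functorE /= dia_mapE.
Qed.
Fact xi_assoc M N P x :
  fun_map F (@dia_assoc _ _ M N P) (xi (diamond M N) P (dia_map (xi M N) idfun x)) =
  xi M (diamond N P) (dia_map idfun (xi N P) (dia_assoc x)).
Proof.
move: x; apply: (dia_ext (spanning_dia (@spanning_lten _ _ _ C M) (@spanning_lten _ _ _ C N))
  (@spanning_lten _ _ _ C P)) => [x y|x y|[[t m] [t' n]] [t'' p]];
  try by rewrite !raddfD.
rewrite -[X in dia_map _ _ X]/(dia (dia (lpure t m) (lpure t' n)) (lpure t'' p)).
rewrite -[X in dia_assoc X]/(dia (dia (lpure t m) (lpure t' n)) (lpure t'' p)).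
rewrite dia_assocE !dia_mapE !xi_pureE lten_functorE [X in lpure _ X = _]dia_assocE.
by rewrite /cmul mulrA.
Qed.
Fact xi_lunit M x :
  fun_map F (@dia_lunit _ _ M) (xi (unitobj k^o) M (dia_map (mk_linear xi_unit_linear) idfun x)) =
  dia_lunit x.
Proof.
move: x; apply: (dia_ext (@spanning_id (unitobj R)) (@spanning_lten _ _ _ C M))
  => [x y|x y|t [t' m]]; try by rewrite !raddfD.
rewrite -[X in dia_map _ _ X]/(dia t (lpure t' m)) -[X in _ = dia_lunit X]/(dia t (lpure t' m)).
rewrite dia_mapE xi_pureE lten_functorE.
by rewrite [X in lpure _ X = _]dia_lunitE dia_lunitE src_act1 src_lpure.
Qed.
Fact xi_runit M x :
  fun_map F (@dia_runit _ _ M) (xi M (unitobj k^o) (dia_map idfun (mk_linear xi_unit_linear) x)) =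
  dia_runit x.
Proof.
move: x; apply: (dia_ext (@spanning_lten _ _ _ C M) (@spanning_id (unitobj R)))
  => [x y|x y|[t m] t']; try by rewrite !raddfD.
rewrite -[X in dia_map _ _ X]/(dia (lpure t m) t') -[X in _ = dia_runit X]/(dia (lpure t m) t').
rewrite dia_mapE xi_pureE lten_functorE.
by rewrite [X in lpure _ X = _]dia_runitE dia_runitE tgt_act1 tgt_lpure.
Qed.

Definition unit_functor : monoidal_functor k^o R :=
  @MonoidalFunctor k k^o R F xi (mk_linear xi_unit_linear) xi_bij xi_unit_bij xi_nat
    xi_assoc xi_lunit xi_runit.
End UnitFunctor.

Lemma unit_functor_equivalence (k : comNzRingType) (R : algType k) :
  frame R -> klinear_monoidal_equivalence (unit_functor R).
Proof.
move=> Fr; split; first exact: lten_functor_klinear.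
exact: lten_functor_equivalence Fr.
Qed.

(** * Bialgebroids and centralizers *)

Section Comultiplication.
Variables (k : comNzRingType) (R : algType k) (L : algring (env R)).
Implicit Types a b l : L.

Fact rmul_linear a : is_linear (fun l : ar_reg L => ((l : L) * a) : ar_reg L).
Proof. by move=> e u v; rewrite -[(e *: u + v : ar_reg L)]/(ar_map L e * u + v) mulrDl -mulrA. Qed.
Definition rmulL a := mk_linear (rmul_linear a).

(** The relations of the diamond involve only left actions, so right multiplication is defined on
    all of it, for arbitrary [a] and [b]. *)
Definition rmul a b (x : xsq L) : xsq L := dia_map (rmulL a) (rmulL b) x.

Lemma rmulE a b l l' : rmul a b (xten l l') = xten (l * a) (l' * b).
Proof. exact: dia_mapE. Qed.
Lemma rmulD a b : {morph rmul a b : x y / x + y}.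
Proof. exact: dia_mapD. Qed.
Lemma rmulZ a b e x : rmul a b (e *: x) = e *: rmul a b x.
Proof. exact: (linearZZ (dia_map (rmulL a) (rmulL b))). Qed.
Lemma rmul_xlift a b x : rmul a b x = xlift (fun l l' => xten (l * a) (l' * b)) x.
Proof. by []. Qed.

Lemma xsq_ext (G : zmodType) (f f' : xsq L -> G) :
  {morph f : x y / x + y} -> {morph f' : x y / x + y} ->
  (forall l l', f (xten l l') = f' (xten l l')) -> f =1 f'.
Proof.
by move=> fD fD' ff'; apply: (dia_ext (@spanning_id (ar_reg L)) (@spanning_id (ar_reg L))).
Qed.

Lemma xten_addl a a' b : xten (a + a') b = xten a b + xten a' b.
Proof. exact: diaDl. Qed.
Lemma xten_addr a b b' : xten a (b + b') = xten a b + xten a b'.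
Proof. exact: diaDr. Qed.

Lemma rmul_mul a b a' b' x : rmul a' b' (rmul a b x) = rmul (a * a') (b * b') x.
Proof.
move: x; apply: xsq_ext => [x y|x y|l l']; rewrite ?rmulD // !rmulE.
by rewrite !mulrA.
Qed.
Lemma rmulDl a a' b x : rmul (a + a') b x = rmul a b x + rmul a' b x.
Proof.
move: x; apply: xsq_ext => [x y|x y|l l'].
- exact: rmulD.
- by rewrite !rmulD addrACA.
- by rewrite !rmulE mulrDr xten_addl.
Qed.
Lemma rmulDr a b b' x : rmul a (b + b') x = rmul a b x + rmul a b' x.
Proof.
move: x; apply: xsq_ext => [x y|x y|l l'].
- exact: rmulD.
- by rewrite !rmulD addrACA.
- by rewrite !rmulE mulrDr xten_addr.
Qed.
Lemma rmul11 x : rmul 1 1 x = x.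
Proof. by move: x; apply: xsq_ext => [x y|//|l l']; rewrite ?rmulD // rmulE !mulr1. Qed.

Lemma takeuchiE (x : xsq L) s : takeuchi x -> rmul (xtgt L s) 1 x = rmul 1 (xsrc L s) x.
Proof.
move=> /(_ s) tx; rewrite rmul_xlift.
under eq_xlift do rewrite mulr1.
rewrite tx rmul_xlift; by under [in RHS]eq_xlift do rewrite mulr1.
Qed.

(* The inner map of [xsq_mul] is not balanced, but after exchanging the two sums
   it is so, by the Takeuchi condition. *)
Lemma xsq_mul_takeuchi x y : xsq_mul x y = xlift (fun a b => rmul a b x) y.
Proof.
rewrite /xsq_mul /xlift /dia_lift tlift.unlock /fsum.
under [RHS]eq_bigr => p _ do rewrite rmul_xlift /xlift /dia_lift tlift.unlock /fsum.
exact: exchange_big.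
Qed.
Lemma rmul_bal x : takeuchi x ->
  dia_balanced (M := ar_reg L) (N := ar_reg L) (fun a b : L => rmul a b x).
Proof.
move=> tx; split=> [a a' b|a b b'|r a b].
- exact: rmulDl.
- exact: rmulDr.
- rewrite -[tgt_act r a]/(xtgt L r * a) -[src_act r b]/(xsrc L r * b).
  by rewrite -[b in LHS]mul1r -[a in RHS]mul1r -!rmul_mul (takeuchiE r tx).
Qed.
Lemma xsq_mulr x a b : takeuchi x -> xsq_mul x (xten a b) = rmul a b x.
Proof. by move=> /rmul_bal bf; rewrite xsq_mul_takeuchi; exact: dia_liftE bf. Qed.
Lemma xsq_mulDr (x : xsq L) : takeuchi x -> {morph xsq_mul x : y z / y + z}.
Proof.
by move=> /rmul_bal bf y z; rewrite !xsq_mul_takeuchi; exact: dia_liftD bf _ _.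
Qed.

Lemma xsq_env r s (x : xsq L) :
  eten r s *: x = xlift (fun a b => xten (xsrc L r * a) (xtgt L s * b)) x.
Proof.
have fb : dia_balanced (M := ar_reg L) (N := ar_reg L)
    (fun a b : L => xten (xsrc L r * a) (xtgt L s * b)).
  exact: (tmap_balanced (dia_act2_compat _ _ r s)).
move: x; apply: xsq_ext => [x y|x y|l l'].
- by rewrite scalerDr.
- exact: dia_liftD fb _ _.
- by rewrite dia_actE; exact/esym/dia_liftE.
Qed.
Lemma xsq_mull_bal y : dia_balanced (M := ar_reg L) (N := ar_reg L) (fun a b : L =>
  xlift (fun a' b' => xten (a * a') (b * b')) y).
Proof.
split=> [a a' b|a b b'|r a b]; rewrite -?xlift_add; apply: eq_xlift => a0 b0.
- by rewrite mulrDl xten_addl.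
- by rewrite mulrDl xten_addr.
- rewrite -[tgt_act r a]/(xtgt L r * a) -[src_act r b]/(xsrc L r * b) -!mulrA.
  exact: (diaB (M := ar_reg L) (N := ar_reg L)).
Qed.
Lemma xsq_mull r s y : xsq_mul (xten (xsrc L r) (xtgt L s)) y = eten r s *: y.
Proof. by rewrite xsq_env; exact: dia_liftE (xsq_mull_bal y). Qed.

Variable X : xbialg_on L.
Local Notation Delta := (xb_delta X).

Lemma delta_envl (e : env R) l : Delta (ar_map L e * l) = e *: Delta l.
Proof.
elim/eten_ind: e => [r s||e e' IH IH'].
- by rewrite xb_deltaM xb_delta_env xsq_mull.
- by rewrite rmorph0 mul0r raddf0 scale0r.
- by rewrite rmorphD mulrDl raddfD IH IH' scalerDl.
Qed.
Lemma delta_envr r s l : Delta (l * ar_map L (eten r s)) = rmul (xsrc L r) (xtgt L s) (Delta l).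
Proof. by rewrite xb_deltaM xb_delta_env xsq_mulr //; exact: xb_takeuchi. Qed.
Lemma delta1 : Delta 1 = xten 1 1.
Proof. by rewrite -[1 in LHS](rmorph1 (ar_map L)) -eten1 xb_delta_env /xsrc /xtgt esrc1 etgt1 rmorph1. Qed.

Lemma eps_env (e : env R) l t : xb_eps X (ar_map L e * l) t = ev e (xb_eps X l t).
Proof.
elim/eten_ind: e => [r s||e e' IH IH'].
- by rewrite xb_epsM xb_eps_env ev_eten.
- apply: (addrI (xb_eps X (ar_map L 0 * l) t)).
  by rewrite -xb_epsD -mulrDl -rmorphD addr0 ev0l addr0.
- by rewrite rmorphD mulrDl xb_epsD IH IH' evDl.
Qed.
Lemma eps_ar_map (e : env R) t : xb_eps X (ar_map L e) t = ev e t.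
Proof.
rewrite -[ar_map L e]mulr1 eps_env; congr ev.
by rewrite -[1 in LHS](rmorph1 (ar_map L)) -eten1 xb_eps_env mul1r mulr1.
Qed.
Lemma eps_envr (e : env R) l t : xb_eps X (l * ar_map L e) t = xb_eps X l (ev e t).
Proof. by rewrite xb_epsM eps_ar_map. Qed.
End Comultiplication.

Section Centralizer.
Variables (k : comNzRingType) (A : algType k) (L : algring A).

Definition centpred : {pred L} := fun l => `[< forall e, ar_map L e * l = l * ar_map L e >].
Lemma centpredP l : reflect (forall e, ar_map L e * l = l * ar_map L e) (l \in centpred).
Proof. exact: asboolP. Qed.
Fact centpred_subalg : subalg_closed centpred.
Proof.
split=> [|a u v /centpredP hu /centpredP hv|u v /centpredP hu /centpredP hv];
  apply/centpredP => e.
- by rewrite mulr1 mul1r.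
- by rewrite mulrDr mulrDl -scalerAr -scalerAl hu hv.
- by rewrite mulrA hu -!mulrA hv.
Qed.
HB.instance Definition _ := GRing.isSubalgClosed.Build k L centpred centpred_subalg.

Record centralizer := Centralizer { cent_val :> L; cent_valP : cent_val \in centpred }.
HB.instance Definition _ := [isSub for cent_val].
HB.instance Definition _ := [Choice of centralizer by <:].
HB.instance Definition _ := [SubChoice_isSubAlgebra of centralizer by <:].

Lemma cent_comm (h : centralizer) e : ar_map L e * cent_val h = cent_val h * ar_map L e.
Proof. by have /centpredP := cent_valP h. Qed.
Lemma cent_valM (h h' : centralizer) : cent_val (h * h') = cent_val h * cent_val h'.
Proof. exact: (rmorphM val). Qed.
Lemma cent_val1 : cent_val (1 : centralizer) = 1.
Proof. exact: (rmorph1 val). Qed.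
Lemma cent_valD (h h' : centralizer) : cent_val (h + h') = cent_val h + cent_val h'.
Proof. exact: (raddfD val). Qed.
Lemma cent_valZ a (h : centralizer) : cent_val (a *: h) = a *: cent_val h.
Proof. exact: (linearZZ val). Qed.
End Centralizer.

(** * The retraction of L onto the centralizer *)

Section Invariants.
Variables (k : comNzRingType) (R : algType k) (M : lmodType (env R)).

(** Module form of [mul_dual]: [r \bar s v = r s v] on an invariant vector. *)
Lemma invariant_act (v : M) (e : env R) :
  (forall r, src_act r v = tgt_act r v) -> e *: v = src_act (ev e 1) v.
Proof.
move=> vi; elim/eten_ind: e => [r s||a b IH IH'].
- by rewrite ev_eten mulr1 src_actM vi src_act_tgt.
- by rewrite ev0l scale0r -[0 in RHS](scale0r (1 : R)) /src_act esrcZ !scale0r.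
- by rewrite evDl scalerDl src_actDl IH IH'.
Qed.

Lemma dual_invariant (d : dual R) (v : M) r :
  src_act r (dual_val d *: v) = tgt_act r (dual_val d *: v).
Proof. by rewrite /src_act /tgt_act !scalerA src_dual. Qed.

(** In the diagonal action, [r] on [v] equals [\bar r] on [v] and crosses to [r] on [n], while
    [\bar s] acts on [n] anyway. *)
Lemma invariant_dia (N : lmodType (env R)) (e : env R) (v : M) (n : N) :
  (forall r, src_act r v = tgt_act r v) -> e *: dia v n = dia v (e *: n).
Proof.
move=> vi; elim/eten_ind: e => [r s||a b IH IH'].
- by rewrite dia_actE vi diaB src_act_tgt.
- by rewrite !scale0r dia0r.
- by rewrite !scalerDl IH IH' diaDr.
Qed.
End Invariants.

Section SourceMap.
Variables (k : comNzRingType) (R : algType k).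
Lemma esrc_sum I (r : seq I) (F : I -> R) :
  esrc (\sum_(i <- r) F i) = \sum_(i <- r) esrc (F i).
Proof. exact: (big_morph _ (@esrcD _ R) (morph_add0 (@esrcD _ R))). Qed.
End SourceMap.

Section TensorSums.
Variables (k : comNzRingType) (U V : lmodType k).
Implicit Types (u : U) (v : V).
Lemma ten_addl u u' v : ten (u + u') v = ten u v + ten u' v.
Proof. exact: pureDl. Qed.
Lemma ten_addr u v v' : ten u (v + v') = ten u v + ten u v'.
Proof. exact: pureDr. Qed.
Lemma ten_suml (I : Type) (r : seq I) (F : I -> U) v :
  ten (\sum_(i <- r) F i) v = \sum_(i <- r) ten (F i) v.
Proof.
elim: r => [|i r IH]; last by rewrite !big_cons ten_addl IH.
by rewrite !big_nil; exact: (morph_add0 (fun a b => ten_addl a b v)).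
Qed.
Lemma ten_sumr (I : Type) (r : seq I) (F : I -> V) u :
  ten u (\sum_(i <- r) F i) = \sum_(i <- r) ten u (F i).
Proof. exact: (big_morph (ten u) (ten_addr u) (morph_add0 (ten_addr u))). Qed.
End TensorSums.

Section Slice.
Variables (k : comNzRingType) (R : algType k) (Fr : frame R) (L : algring (env R)).
Local Notation x := (fr_x (f := Fr)).
Local Notation f := (fr_df (Fr := Fr)).
Local Notation e0 := (fr_de Fr).
Local Notation H := (centralizer L).
Local Notation io := (ar_map L).

Lemma ar_mapZ (c : k) (e : env R) : io (c *: e) = c *: io e.
Proof. exact: linearZZ. Qed.

Lemma ar_map_sumZ (I : Type) (r : seq I) (c : I -> k) (F : I -> env R) :
  io (\sum_(i <- r) c i *: F i) = \sum_(i <- r) c i *: io (F i).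
Proof. by rewrite linear_sum; apply: eq_bigr => i _; exact: linearZZ. Qed.
Lemma ar_map_sum (I : Type) (r : seq I) (F : I -> env R) :
  io (\sum_(i <- r) F i) = \sum_(i <- r) io (F i).
Proof. exact: raddf_sum. Qed.
Lemma ar_map1 : io 1 = 1. Proof. exact: rmorph1. Qed.
Lemma ar_mapM (e e' : env R) : io (e * e') = io e * io e'.
Proof. exact: rmorphM. Qed.
Lemma io_frame_sum : \sum_p io (esrc (x p)) * io (dual_val (f p)) = 1.
Proof.
rewrite -ar_map1 -(frame_sum Fr) ar_map_sum; apply: eq_bigr => p _.
by rewrite ar_mapM.
Qed.
Lemma dual_mul_dual (d d' : dual R) : dual_val d * dual_val d' = dval Fr d 1 *: dual_val d'.
Proof. by rewrite -(dual_src_mul Fr) esrc1 mul1r. Qed.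
Lemma dual_frame (e : env R) (d : dual R) :
  dual_val d * e = \sum_i dval Fr d (ev e (x i)) *: dual_val (f i).
Proof.
rewrite -[LHS]/(dual_val (dual_mul d e)) [LHS](frame_dual_env Fr).
by apply: eq_bigr => i _; rewrite dval_mul.
Qed.

Lemma io_dual (d : dual R) (e : env R) :
  io (dual_val d) * io e = \sum_i dval Fr d (ev e (x i)) *: io (dual_val (f i)).
Proof. by rewrite -ar_mapM dual_frame ar_map_sumZ. Qed.
Lemma io_mul_dual (d : dual R) (e : env R) :
  io e * io (dual_val d) = io (esrc (ev e 1)) * io (dual_val d).
Proof. by rewrite -!ar_mapM mul_dual. Qed.
Lemma io_src (t : R) : io (esrc t) = \sum_q fr_c (f := Fr) q t *: io (esrc (x q)).
Proof.
rewrite {1}(fr_coord Fr t) esrc_sum -ar_map_sumZ; congr (io _).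
by apply: eq_bigr => q _; rewrite esrcZ.
Qed.

(** The analogue of the formula [\sum_p E_p1 l E_1p] for an entry of a matrix. On a product [e h]
    with [e] in R^e and [h] in the centralizer it gives [s(e . 1) h], where s is [fr_s]. *)
Definition slice0 (l : L) : L :=
  \sum_p io (esrc (x p)) * (io (dual_val e0) * l * io (dual_val (f p))).

(* [e x_p e0 = \sum_q c_q(e . x_p) x_q e0] and [f_q e = \sum_p c_q(e . x_p) f_p] *)
Fact slice_cent l : slice0 l \in @centpred _ _ L.
Proof.
apply/centpredP => e; rewrite /slice0 mulr_sumr mulr_suml.
have lhs p : io e * (io (esrc (x p)) * (io (dual_val e0) * l * io (dual_val (f p)))) =
    \sum_q fr_c (f := Fr) q (ev e (x p)) *:
      (io (esrc (x q)) * (io (dual_val e0) * l * io (dual_val (f p)))).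
  rewrite !mulrA -ar_mapM io_mul_dual evM ev_esrc mulr1 io_src !mulr_suml.
  by apply: eq_bigr => q _; rewrite -!scalerAl !mulrA.
have rhs q : io (esrc (x q)) * (io (dual_val e0) * l * io (dual_val (f q))) * io e =
    \sum_p fr_c (f := Fr) q (ev e (x p)) *:
      (io (esrc (x q)) * (io (dual_val e0) * l * io (dual_val (f p)))).
  rewrite -!mulrA io_dual !mulr_sumr.
  by apply: eq_bigr => p _; rewrite dval_f -!scalerAr !mulrA.
under eq_bigr do rewrite lhs.
under [in RHS]eq_bigr do rewrite rhs.
exact: exchange_big.
Qed.
Definition slice l : H := Centralizer (slice_cent l).
Lemma sliceE l : cent_val (slice l) = slice0 l. Proof. by []. Qed.

Lemma sliceD : {morph slice : a b / a + b}.
Proof.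
move=> a b; apply: val_inj; rewrite /= /slice0 -big_split /=; apply: eq_bigr => p _.
by rewrite mulrDr mulrDl mulrDr.
Qed.
Lemma sliceZ (c : k) l : slice (c *: l) = c *: slice l.
Proof.
apply: val_inj; rewrite /= /slice0 scaler_sumr; apply: eq_bigr => p _.
by rewrite -scalerAr -scalerAl -scalerAr.
Qed.
(** Here [e_0 d h f_p = d f_p h = d(1) f_p h], and the sum over p restores [h]. *)
Lemma slice_dual_cent (d : dual R) (h : H) :
  slice (io (dual_val d) * cent_val h) = dval Fr d 1 *: h.
Proof.
apply: val_inj; rewrite /= /slice0 -[RHS]/(cent_val (_ *: h)) cent_valZ.
rewrite -[cent_val h in RHS]mul1r -io_frame_sum mulr_suml scaler_sumr.
apply: eq_bigr => p _; rewrite -[X in _ *: X]mulrA scalerAr; congr (_ * _).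
rewrite !mulrA -ar_mapM e0_mul -mulrA -cent_comm mulrA -ar_mapM dual_mul_dual ar_mapZ.
by rewrite -scalerAl.
Qed.
Lemma slice_cent_val (h : H) : slice (cent_val h) = h.
Proof.
apply: val_inj; rewrite /= /slice0 -[RHS]/(cent_val h).
rewrite -[cent_val h in RHS]mul1r -io_frame_sum mulr_suml.
apply: eq_bigr => p _; rewrite -[RHS]mulrA; congr (_ * _).
by rewrite -mulrA -cent_comm mulrA -ar_mapM e0_mul.
Qed.

Section Projection.
Variables (N : lmodType (env R)) (G : lmodType k).

(** The second factor is kept general so that the construction can be iterated: [N] is L with [G]
    the centralizer H, and then [N] is L <> L with [G] equal to H (x) H. *)
Definition klin_out (q : N -> G) : Prop :=
  {morph q : n n' / n + n'} /\ forall (a : k) n, q ((a%:A : env R) *: n) = a *: q n.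
Definition klin_in (j : G -> N) : Prop :=
  {morph j : n n' / n + n'} /\ forall (a : k) n, j (a *: n) = (a%:A : env R) *: j n.

Variables (q : N -> G) (j : G -> N).
Hypotheses (qlin : klin_out q) (jlin : klin_in j).

(** For [l = h] in H the slice of [f_i h] is [c_i(1) h] and [\sum_i c_i(1) x_i = 1], so the result
    is [h (x) q n]. The sum over the dual basis makes the formula balanced over R. *)
Definition proj_in (l : L) (n : N) : otimes H G :=
  \sum_i ten (slice (io (dual_val (f i)) * l)) (q (src_act (x i) n)).
Definition proj (z : diamond (ar_reg L) N) : otimes H G :=
  dia_lift (M := ar_reg L) (N := N) proj_in z.

Lemma slice_sum (I : Type) (r : seq I) (F : I -> L) :
  slice (\sum_(i <- r) F i) = \sum_(i <- r) slice (F i).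
Proof. exact: (big_morph _ sliceD (morph_add0 sliceD)). Qed.

Lemma q_frame (t : R) (n : N) :
  q (src_act t n) = \sum_i (fr_c (f := Fr) i t : k) *: q (src_act (x i) n).
Proof.
case: qlin => qD qZ; rewrite {1}(fr_coord Fr t).
rewrite (big_morph (fun t => q (src_act t n)) (id1 := 0) (op1 := +%R)).
- by apply: eq_bigr => i _; rewrite /src_act esrcZ -qZ scalerA -scalerAl mul1r.
- by move=> a b; rewrite src_actDl qD.
- by rewrite /src_act (morph_add0 (@esrcD _ R)) scale0r (morph_add0 qD).
Qed.

(** Balancing holds because [f_i \bar r = \sum_m c_i(x_m r) f_m] on the left, and
    [x_m r = \sum_i c_i(x_m r) x_i] on the right: both sides have the same coefficients. *)
Fact proj_in_bal : dia_balanced (M := ar_reg L) (N := N) proj_in.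
Proof.
case: (qlin) => qD qZ; split=> [l l' n|l n n'|r l n].
- rewrite /proj_in -big_split; apply: eq_bigr => i _ /=.
  by rewrite mulrDr sliceD ten_addl.
- rewrite /proj_in -big_split; apply: eq_bigr => i _ /=.
  by rewrite src_actD qD ten_addr.
- rewrite -[tgt_act r l]/(io (etgt r) * l) /proj_in.
  have lhs i : slice (io (dual_val (f i)) * (io (etgt r) * l)) =
      \sum_m (fr_c (f := Fr) i (x m * r) : k) *: slice (io (dual_val (f m)) * l).
    rewrite mulrA io_dual mulr_suml slice_sum.
    by apply: eq_bigr => m _; rewrite dval_f ev_etgt -scalerAl sliceZ.
  under eq_bigr => i _ do rewrite lhs ten_suml.
  rewrite exchange_big; apply: eq_bigr => m _ /=.
  rewrite -src_actM q_frame ten_sumr; apply: eq_bigr => i _.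
  by rewrite tenZ.
Qed.
Lemma projE (l : L) n : proj (dia (l : ar_reg L) n) = proj_in l n.
Proof. exact: dia_liftE proj_in_bal. Qed.
Lemma projD : {morph proj : a b / a + b}.
Proof. exact: dia_liftD proj_in_bal. Qed.

Lemma proj_cent (h : H) n : proj (dia (cent_val h : ar_reg L) n) = ten h (q n).
Proof.
rewrite projE /proj_in -[n in RHS]src_act1 q_frame ten_sumr; apply: eq_bigr => i _.
by rewrite slice_dual_cent dval_f tenZ.
Qed.

Definition cmp (u : otimes H G) : diamond (ar_reg L) N :=
  tlift (fun (h : H) g => dia (cent_val h : ar_reg L) (j g)) u.
Fact cmp_bal : balanced (fun (c : k) (h : H) => c *: h) (fun (c : k) (g : G) => c *: g)
  (fun (h : H) g => dia (cent_val h : ar_reg L) (j g)).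
Proof.
case: (jlin) => jD jZ; split=> [h h' g|h g g'|c h g].
- by rewrite cent_valD diaDl.
- by rewrite jD diaDr.
- rewrite jZ cent_valZ -src_actZ1 -diaB tgt_actZ1; congr dia.
  by rewrite -[RHS]/(io _ * _) rmorph_alg -scalerAl mul1r.
Qed.
Lemma cmpE h g : cmp (ten h g) = dia (cent_val h : ar_reg L) (j g).
Proof. exact: tliftE cmp_bal. Qed.
Lemma cmpD : {morph cmp : a b / a + b}.
Proof. exact: tliftD cmp_bal. Qed.

(** The substitute for flatness: the comparison map into the diamond is split, hence injective. *)
Lemma proj_cmp : cancel j q -> cancel cmp proj.
Proof.
move=> jK; apply: (spanning_ext (@spanning_pure1 _ _ _ _ _)) => [a b|//|[h g]] /=.
  by rewrite cmpD projD.
by rewrite -[pure _ _]/(ten h g) cmpE proj_cent jK.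
Qed.
End Projection.
End Slice.

Section DiamondSums.
Variables (k : comNzRingType) (R : algType k) (M N : lmodType (env R)).
Lemma dia_suml (I : Type) (r : seq I) (F : I -> M) (n : N) :
  dia (\sum_(i <- r) F i) n = \sum_(i <- r) dia (F i) n.
Proof. exact: (big_morph (fun m => dia m n) (fun a b => diaDl a b n) (dia0l _ _)). Qed.
Lemma dia_sumr (I : Type) (r : seq I) (F : I -> N) (m : M) :
  dia m (\sum_(i <- r) F i) = \sum_(i <- r) dia m (F i).
Proof. exact: (big_morph (dia m) (diaDr m) (dia0r _ _)). Qed.
Variable Fr : frame R.
(** Write [m = \sum_i x_i f_i m]. On the invariant vector [f_i m] the element [x_i] acts as
    [\bar x_i] and crosses to [n]; then [e_0] moves to the second factor by [invariant_dia]. *)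
Lemma dia_e0 (m : M) (n : N) : dual_val (fr_de Fr) *: dia m n =
  \sum_i dia (dual_val (fr_df (Fr := Fr) i) *: m)
    (dual_val (fr_de Fr) *: src_act (fr_x (f := Fr) i) n).
Proof.
rewrite -[m in LHS]scale1r -(frame_sum Fr) scaler_suml dia_suml scaler_sumr.
apply: eq_bigr => i _; rewrite -invariant_dia; last exact: dual_invariant.
congr (_ *: _); rewrite -diaB -dual_invariant /src_act scalerA //.
Qed.
End DiamondSums.

Section Bialgebra.
Variables (k : comNzRingType) (R : algType k) (Fr : frame R) (L : algring (env R)).
Variable X : xbialg_on L.
Local Notation x := (fr_x (f := Fr)).
Local Notation f := (fr_df (Fr := Fr)).
Local Notation e0 := (fr_de Fr).
Local Notation H := (centralizer L).
Local Notation io := (ar_map L).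
Local Notation Delta := (xb_delta X).

Lemma regk (c : k) (l : ar_reg L) : (c%:A : env R) *: l = (c *: (l : L) : L).
Proof. by rewrite -[LHS]/(io _ * _) rmorph_alg -scalerAl mul1r. Qed.

Fact slice_klin : klin_out (N := ar_reg L) (G := H) (slice Fr (L := L)).
Proof.
by split=> [a b|c l]; [exact: sliceD | rewrite regk sliceZ].
Qed.
Fact cent_val_klin : klin_in (N := ar_reg L) (G := H) (fun h : H => cent_val h).
Proof. by split=> [a b|c h]; [exact: cent_valD | rewrite regk cent_valZ]. Qed.

Lemma io_e0_dual (d : dual R) (l : L) :
  io (dual_val e0) * (io (dual_val d) * l) = io (dual_val d) * l.
Proof. by rewrite mulrA -ar_mapM e0_mul. Qed.

Definition proj2 : xsq L -> otimes H H := proj Fr (N := ar_reg L) (slice Fr (L := L)).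
Definition cmp2 : otimes H H -> xsq L := cmp (N := ar_reg L) (fun h : H => cent_val h).
Lemma cmp2E h h' : cmp2 (ten h h') = xten (cent_val h) (cent_val h').
Proof. exact: cmpE cent_val_klin _ _. Qed.
Lemma cmp2D : {morph cmp2 : u v / u + v}.
Proof. exact: cmpD cent_val_klin. Qed.
Lemma proj2D : {morph proj2 : u v / u + v}.
Proof. exact: projD slice_klin. Qed.
Lemma proj_cmp2 : cancel cmp2 proj2.
Proof. by apply: (proj_cmp Fr slice_klin cent_val_klin) => h; exact: slice_cent_val. Qed.

Lemma otimes_ext (U V : lmodType k) (G : zmodType) (g g' : otimes U V -> G) :
  {morph g : u v / u + v} -> {morph g' : u v / u + v} ->
  (forall a b, g (ten a b) = g' (ten a b)) -> g =1 g'.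
Proof.
by move=> gD gD' gg'; apply: (spanning_ext (@spanning_pure1 _ _ _ _ _) gD gD') => -[].
Qed.

(** Both slices are expanded, over p and p'; the remaining sum over i is the one in [dia_e0] and
    becomes a diagonal action of [e_0]. The second outer factor can be written [\bar x_p'] because
    it acts on a vector in the image of [e_0]. *)
Lemma cmp_proj2 : forall z : xsq L, cmp2 (proj2 z) =
  \sum_p \sum_p' eten (x p) (x p') *:
    (dual_val e0 *: rmul (io (dual_val (f p))) (io (dual_val (f p'))) z).
Proof.
apply: xsq_ext => [u v|u v|l l'].
- by rewrite proj2D cmp2D.
- rewrite -big_split; apply: eq_bigr => p _ /=; rewrite -big_split; apply: eq_bigr => p' _ /=.
  by rewrite rmulD !scalerDr.
have -> : proj2 (xten l l') = \sum_i ten (slice Fr (io (dual_val (f i)) * l))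
    (slice Fr (io (esrc (x i)) * l')).
  exact: (projE Fr slice_klin l l').
rewrite (big_morph cmp2 cmp2D (morph_add0 cmp2D)).
under eq_bigr => i _.
  rewrite cmp2E !sliceE /slice0 [xten _ _]dia_suml.
  under eq_bigr => p _ do rewrite dia_sumr.
  over.
rewrite exchange_big; apply: eq_bigr => p _ /=.
rewrite exchange_big; apply: eq_bigr => p' _ /=.
rewrite rmulE [xten _ _]/dia dia_e0 scaler_sumr; apply: eq_bigr => i _.
rewrite dia_actE -dual_invariant.
rewrite /src_act -[_ *: (l * _ : ar_reg L)]/(io _ * (l * _)).
rewrite -[dual_val e0 *: _]/(io _ * (io _ * (l' * _))).
rewrite -[esrc (x p) *: _]/(io _ * _) -[esrc (x p') *: _]/(io _ * _).
by rewrite -!mulrA io_e0_dual.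
Qed.
End Bialgebra.

(** * The bialgebra structure of the centralizer *)

Section RingMaps.
Definition mk_rmorphism (A B : pzRingType) (f : A -> B) (fD : {morph f : x y / x + y})
    (fM : monoid_morphism f) : {rmorphism A -> B} :=
  HB.pack_for {rmorphism A -> B} f
    (GRing.isNmodMorphism.Build A B f (conj (morph_add0 fD) fD))
    (GRing.isMonoidMorphism.Build A B f fM).
Definition mk_lrmorphism (k : comNzRingType) (A B : algType k) (f : A -> B)
    (fl : is_linear f) (fM : monoid_morphism f) : {lrmorphism A -> B} :=
  HB.pack_for {lrmorphism A -> B} f
    (GRing.isLinear.Build k A B *:%R f fl)
    (GRing.isMonoidMorphism.Build A B f fM).
End RingMaps.

Lemma dia_assoc_addl (k : comNzRingType) (R : algType k) (M N P : lmodType (env R))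
    (u v : diamond M N) (p : P) :
  dia_assoc (dia (u + v) p) = dia_assoc (dia u p) + dia_assoc (dia v p).
Proof. by rewrite diaDl; exact: dia_assocD. Qed.

Section TensorAssociator.
Variables (k : comNzRingType) (A B C : lmodType k).

Lemma otimes_lift_morph (G G' : zmodType) (g : A -> B -> G) (h : G -> G') (u : otimes A B) :
  {morph h : a b / a + b} -> h (tlift g u) = tlift (fun a b => h (g a b)) u.
Proof. by move=> hD; rewrite tlift.unlock /fsum (big_morph h hD (morph_add0 hD)). Qed.

Fact otimes_assoc_in_bal (c : C) : balanced (fun (e : k) (a : A) => e *: a)
  (fun (e : k) (b : B) => e *: b) (fun (a : A) (b : B) => ten a (ten b c)).
Proof.
split=> [a a' b|a b b'|e a b].
- exact: pureDl.
- by rewrite [ten (b + b') c]pureDl [LHS]pureDr.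
- by rewrite tenZ otimesZ.
Qed.
Fact otimes_assoc_bal : balanced (fun (e : k) (u : otimes A B) => e *: u)
  (fun (e : k) (c : C) => e *: c) (fun (u : otimes A B) (c : C) =>
    tlift (fun (a : A) (b : B) => ten a (ten b c)) u).
Proof.
split=> [u u' c|u c c'|e u c].
- exact: tliftD (otimes_assoc_in_bal c) _ _.
- rewrite -tlift_add; apply: eq_tlift => a b.
  by rewrite [ten b (c + c')]pureDr [LHS]pureDr.
- move: u; apply: otimes_ext => [u v|u v|a b].
  + by rewrite scalerDr (tliftD (otimes_assoc_in_bal _)).
  + exact: tliftD (otimes_assoc_in_bal _) _ _.
  + by rewrite otimesZ !(tliftE _ _ (otimes_assoc_in_bal _)) tenZ otimesZ tenZ.
Qed.
Lemma otimes_assocE a b c :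
  otimes_assoc (ten (ten a b) c) = ten a (ten b c) :> otimes A (otimes B C).
Proof.
rewrite [LHS](tliftE _ _ otimes_assoc_bal); exact: tliftE (otimes_assoc_in_bal c).
Qed.
Lemma otimes_assocD : {morph @otimes_assoc k A B C : u v / u + v}.
Proof. exact: tliftD otimes_assoc_bal. Qed.
Lemma otimes_assoc_addl (u v : otimes A B) (c : C) :
  otimes_assoc (ten (u + v) c) = otimes_assoc (ten u c) + otimes_assoc (ten v c).
Proof. by rewrite ten_addl otimes_assocD. Qed.
End TensorAssociator.

Section Bialgebra.
Variables (k : comNzRingType) (R : algType k) (Fr : frame R) (L : algring (env R)).
Variable X : xbialg_on L.
Local Notation x := (fr_x (f := Fr)).
Local Notation f := (fr_df (Fr := Fr)).
Local Notation e0 := (fr_de Fr).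
Local Notation H := (centralizer L).
Local Notation io := (ar_map L).
Local Notation Delta := (xb_delta X).
Local Notation cmp2 := (@cmp2 k R L).
Local Notation proj2 := (@proj2 k R Fr L).

Definition deltaH (h : H) : otimes H H := proj2 (Delta (cent_val h)).

Lemma delta_comm (h : H) r s :
  eten r s *: Delta (cent_val h) = rmul (xsrc L r) (xtgt L s) (Delta (cent_val h)).
Proof. by rewrite -delta_envl cent_comm delta_envr. Qed.

Lemma xsrc_dual r (d : dual R) : xsrc L r * io (dual_val d) = xtgt L r * io (dual_val d).
Proof. by rewrite -!ar_mapM src_dual. Qed.
Lemma xsrc1 : xsrc L 1 = 1. Proof. by rewrite /xsrc esrc1 ar_map1. Qed.
Lemma xtgt1 : xtgt L 1 = 1. Proof. by rewrite /xtgt etgt1 ar_map1. Qed.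

(* [r] commutes with [Delta h] and [r d = \bar r d]; the Takeuchi condition then moves
   the right [\bar r] to a right [r] on the second factor. *)
Lemma delta_invariant (h : H) (d d' : dual R) r :
  let W := rmul (io (dual_val d)) (io (dual_val d')) (Delta (cent_val h)) in
  src_act r W = tgt_act r W.
Proof.
rewrite /= /src_act /tgt_act -!rmulZ esrcE etgtE !delta_comm !rmul_mul xsrc1 xtgt1 !mul1r.
rewrite xsrc_dual -[io (dual_val d') in LHS]mul1r -rmul_mul takeuchiE; last exact: xb_takeuchi.
by rewrite rmul_mul mul1r xsrc_dual.
Qed.

Lemma rmul_suml (I : Type) (s : seq I) (F : I -> L) b z :
  rmul (\sum_(i <- s) F i) b z = \sum_(i <- s) rmul (F i) b z.
Proof.
have D a a' : rmul (a + a') b z = rmul a b z + rmul a' b z by exact: rmulDl.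
exact: (big_morph (fun a => rmul a b z) D (morph_add0 (f := fun a => rmul a b z) D)).
Qed.
Lemma rmul_sumr (I : Type) (s : seq I) (F : I -> L) a z :
  rmul a (\sum_(i <- s) F i) z = \sum_(i <- s) rmul a (F i) z.
Proof.
have D b b' : rmul a (b + b') z = rmul a b z + rmul a b' z by exact: rmulDr.
exact: (big_morph (fun b => rmul a b z) D (morph_add0 (f := fun b => rmul a b z) D)).
Qed.

(* [delta_invariant] lets [e0] act trivially; then [x_p] and [\bar x_p'] are commuted
   past [Delta h] and summed up by [\sum_p x_p f_p = 1]. *)
Lemma cmp2_delta (h : H) : cmp2 (deltaH h) = Delta (cent_val h).
Proof.
rewrite /deltaH cmp_proj2 -[RHS]rmul11 -{1}(io_frame_sum Fr L) rmul_suml.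
apply: eq_bigr => p _; rewrite -(io_frame_sum Fr L) rmul_sumr; apply: eq_bigr => p' _.
rewrite [dual_val e0 *: _]invariant_act; last by move=> r; exact: delta_invariant.
rewrite ev_e1 src_act1 -rmulZ delta_comm rmul_mul; congr rmul.
exact/esym/xsrc_dual.
Qed.

(** Identities in H (x) H are checked in L <> L by means of this lemma, with [cmp2_delta] giving the
    comultiplication. *)
Lemma cmp2_inj : injective cmp2.
Proof. exact: can_inj (@proj_cmp2 k R Fr L). Qed.

Fact deltaHD : {morph deltaH : a b / a + b}.
Proof. by move=> a b; rewrite /deltaH cent_valD raddfD proj2D. Qed.

(** The Takeuchi condition makes [xsq_mul] additive on the right and equal to [rmul] on pure
    tensors, so [v] and then [u] can be taken pure. *)
Lemma cmp2M (u v : otimes H H) : takeuchi (cmp2 u) -> cmp2 (u * v) = xsq_mul (cmp2 u) (cmp2 v).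
Proof.
move=> tu; move: v; apply: otimes_ext => [v w|v w|a b].
- by rewrite mulrDr cmp2D.
- by rewrite cmp2D xsq_mulDr.
rewrite cmp2E xsq_mulr // => {tu}; move: u; apply: otimes_ext => [v w|v w|a' b'].
- by rewrite mulrDl cmp2D.
- by rewrite cmp2D rmulD.
- by rewrite [_ * _]tenM !cmp2E rmulE !cent_valM.
Qed.

Fact deltaH_monoid : monoid_morphism deltaH.
Proof.
split=> [|a b]; apply: cmp2_inj; rewrite ?cmp2M !cmp2_delta; try exact: xb_takeuchi.
  by rewrite cent_val1 delta1; have := cmp2E (1 : H) (1 : H); rewrite !cent_val1 => <-.
by rewrite cent_valM xb_deltaM.
Qed.
Definition deltaH_mor := mk_rmorphism deltaHD deltaH_monoid.

Lemma env_scale_ar (c : k) (l : L) : c *: l = io c%:A * l.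
Proof. by rewrite rmorph_alg -scalerAl mul1r. Qed.

Lemma cmp2Z (c : k) u : cmp2 (c *: u) = (c%:A : env R) *: cmp2 u.
Proof.
move: u; apply: otimes_ext => [v w|v w|a b].
- by rewrite scalerDr cmp2D.
- by rewrite cmp2D scalerDr.
- by rewrite otimesZ !cmp2E -src_actZ1 [src_act _ _]src_dia src_actZ1 regk cent_valZ.
Qed.

Fact deltaH_scalable : scalable deltaH_mor.
Proof.
move=> c h; apply: cmp2_inj; rewrite cmp2Z !cmp2_delta cent_valZ env_scale_ar.
exact: delta_envl.
Qed.

Definition epsH (h : H) : k^o := fr_s Fr (xb_eps X (cent_val h) 1).
(** The operator of [h] on R commutes with R^e. Hence it is multiplication by its value at 1, which
    is central and so a scalar. *)
Lemma eps_cent (h : H) t : xb_eps X (cent_val h) t = (epsH h : k) *: t.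
Proof.
rewrite -[t in LHS]mulr1 -ev_esrc -eps_envr -cent_comm eps_env ev_esrc.
rewrite [xb_eps _ _ 1](central_scalar Fr) => [|r]; last first.
  by rewrite -ev_esrc -ev_etgt -!eps_env !cent_comm !eps_envr ev_esrc ev_etgt mulr1 mul1r.
by rewrite -scalerAr mulr1.
Qed.
Fact epsH_linear : is_linear epsH.
Proof.
move=> c a b; rewrite /epsH cent_valD xb_epsD linearD cent_valZ env_scale_ar eps_env.
by rewrite evZl ev1 linearZ.
Qed.
Fact epsH_monoid : monoid_morphism epsH.
Proof.
split=> [|a b].
  by rewrite /epsH cent_val1 -ar_map1 eps_ar_map ev1 fr_s1.
rewrite {1}/epsH cent_valM xb_epsM !eps_cent scalerA linearZ /= fr_s1.
exact: mulr1.
Qed.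
Definition epsH_mor := mk_lrmorphism epsH_linear epsH_monoid.

Definition cmp3 : otimes H (otimes H H) -> diamond (ar_reg L) (xsq L) := cmp (N := xsq L) cmp2.
Definition proj3 : diamond (ar_reg L) (xsq L) -> otimes H (otimes H H) :=
  proj Fr (N := xsq L) proj2.

Fact cmp2_klin : klin_in (N := xsq L) cmp2.
Proof. by split; [exact: cmp2D | exact: cmp2Z]. Qed.
Fact proj2_klin : klin_out (N := xsq L) proj2.
Proof.
split=> [|c z]; first exact: proj2D.
move: z; apply: xsq_ext => [v w|v w|a b].
- by rewrite scalerDr proj2D.
- by rewrite proj2D scalerDr.
rewrite -src_actZ1 [src_act _ _]src_dia src_actZ1 regk.
have E l : proj2 (xten l b) = proj_in Fr (N := ar_reg L) (slice Fr (L := L)) l b.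
  exact: projE (slice_klin Fr L) l b.
rewrite [proj2 _]E E /proj_in scaler_sumr; apply: eq_bigr => i _.
by rewrite -scalerAr sliceZ otimesZ.
Qed.
Lemma cmp3E h u : cmp3 (ten h u) = dia (cent_val h : ar_reg L) (cmp2 u).
Proof. exact: cmpE cmp2_klin _ _. Qed.
Lemma cmp3D : {morph cmp3 : u v / u + v}.
Proof. exact: cmpD cmp2_klin. Qed.
Lemma cmp3_inj : injective cmp3.
Proof.
apply: (can_inj (g := proj3)); apply: (proj_cmp Fr proj2_klin cmp2_klin).
exact: proj_cmp2.
Qed.

Lemma cmp3_assoc v (b : H) :
  cmp3 (otimes_assoc (ten v b)) = dia_assoc (dia (cmp2 v) (cent_val b : ar_reg L)).
Proof.
move: v; apply: otimes_ext => [v w|v w|a a'].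
- by rewrite otimes_assoc_addl cmp3D.
- by rewrite cmp2D; exact: dia_assoc_addl.
- by rewrite otimes_assocE cmp3E !cmp2E dia_assocE.
Qed.

Lemma delta_srcl r (l : L) : Delta (src_act r (l : ar_reg L)) = src_act r (Delta l).
Proof. exact: delta_envl. Qed.
Lemma delta_tgtl r (l : L) : Delta (tgt_act r (l : ar_reg L)) = tgt_act r (Delta l).
Proof. exact: delta_envl. Qed.

(** Turns a sum over the comultiplication of H into one over that of L, where the axioms of L apply.
    Balancedness over k is balancedness over R at the scalars [c 1]. *)
Lemma tlift_cmp2 (G : zmodType) (g : L -> L -> G) (g' : H -> H -> G) u :
  dia_balanced (M := ar_reg L) (N := ar_reg L) g ->
  (forall a b : H, g' a b = g (cent_val a) (cent_val b)) ->
  tlift (al := fun (c : k) (a : H) => c *: a) (be := fun (c : k) (a : H) => c *: a) g' u =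
  xlift g (cmp2 u).
Proof.
move=> gb gg'; have gb' : balanced (fun (c : k) (a : H) => c *: a) (fun (c : k) (a : H) => c *: a) g'.
  case: gb => g1 g2 g3; split=> [a a' b|a b b'|c a b]; rewrite !gg' ?cent_valD //.
  by rewrite !cent_valZ -!regk -tgt_actZ1 g3 src_actZ1.
move: u; apply: otimes_ext => [v w|v w|a b].
- exact: tliftD gb' _ _.
- by rewrite cmp2D; exact: dia_liftD gb _ _.
- by rewrite cmp2E [LHS]tliftE // gg' [RHS]dia_liftE.
Qed.

Fact deltaH_coassoc h :
  tlift (fun a b : H => otimes_assoc (ten (deltaH_mor a) b)) (deltaH_mor h) =
  tlift (fun a b : H => ten a (deltaH_mor b)) (deltaH_mor h).
Proof.
apply: cmp3_inj; rewrite !(otimes_lift_morph _ _ cmp3D).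
rewrite (tlift_cmp2 (g := fun a b => dia_assoc (dia (Delta a) (b : ar_reg L)))); first last.
- by move=> a b; rewrite cmp3_assoc cmp2_delta.
- split=> [a a' b|a b b'|r a b].
  + by rewrite raddfD diaDl raddfD.
  + by rewrite diaDr raddfD.
  + by rewrite delta_tgtl diaB.
rewrite (tlift_cmp2 (g := fun a b => dia (a : ar_reg L) (Delta b))); first last.
- by move=> a b; rewrite cmp3E cmp2_delta.
- split=> [a a' b|a b b'|r a b].
  + exact: diaDl.
  + by rewrite raddfD diaDr.
  + by rewrite delta_srcl diaB.
by rewrite [deltaH_mor h]/(deltaH h) cmp2_delta xb_coassoc.
Qed.

Fact deltaH_counitl h : tlift (fun a b : H => (epsH_mor a : k) *: b) (deltaH_mor h) = h.
Proof.
apply: val_inj; rewrite /= (otimes_lift_morph _ _ (@cent_valD _ _ L)).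
rewrite (tlift_cmp2 (g := fun a b => xsrc L (xb_eps X a 1) * b)); first last.
- move=> a b; rewrite eps_cent cent_valZ env_scale_ar; congr (io _ * _).
  by rewrite esrcZ1.
- split=> [a a' b|a b b'|r a b].
  + by rewrite xb_epsD /xsrc esrcD raddfD mulrDl.
  + exact: mulrDr.
  + rewrite -[tgt_act r a]/(io _ * a) eps_env ev_etgt /xsrc esrcM ar_mapM.
    by rewrite -mulrA.
by rewrite cmp2_delta xb_counitl.
Qed.
Fact deltaH_counitr h : tlift (fun a b : H => (epsH_mor b : k) *: a) (deltaH_mor h) = h.
Proof.
apply: val_inj; rewrite /= (otimes_lift_morph _ _ (@cent_valD _ _ L)).
rewrite (tlift_cmp2 (g := fun a b => xtgt L (xb_eps X b 1) * a)); first last.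
- move=> a b; rewrite eps_cent cent_valZ env_scale_ar; congr (io _ * _).
  by rewrite etgtZ etgt1.
- split=> [a a' b|a b b'|r a b].
  + exact: mulrDr.
  + by rewrite xb_epsD /xtgt etgtD raddfD mulrDl.
  + rewrite -[src_act r b]/(io _ * b) eps_env ev_esrc /xtgt etgtM ar_mapM.
    by rewrite -mulrA.
by rewrite cmp2_delta xb_counitr.
Qed.

Definition cent_bialg : bialg k :=
  @Bialg k H deltaH_mor deltaH_scalable epsH_mor deltaH_coassoc deltaH_counitl deltaH_counitr.
End Bialgebra.

(** * Transport of structure *)

Section XLift.
Variables (k : comNzRingType) (R : algType k) (L : algring (env R)).

Lemma xlift_morph (G G' : zmodType) (g : L -> L -> G) (h : G -> G') (z : xsq L) :
  {morph h : a b / a + b} -> h (xlift g z) = xlift (fun a b => h (g a b)) z.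
Proof.
by move=> hD; rewrite /xlift /dia_lift tlift.unlock /fsum (big_morph h hD (morph_add0 hD)).
Qed.

Definition xbal (G : zmodType) (g : L -> L -> G) : Prop :=
  [/\ forall a a' b, g (a + a') b = g a b + g a' b,
      forall a b b', g a (b + b') = g a b + g a b'
    & forall r a b, g (xtgt L r * a) b = g a (xsrc L r * b)].

Lemma xbal_dia (G : zmodType) (g : L -> L -> G) : xbal g ->
  dia_balanced (M := ar_reg L) (N := ar_reg L) g.
Proof. by case=> g1 g2 g3; split=> [a a' b|a b b'|r a b]; [exact: g1|exact: g2|exact: g3]. Qed.
Lemma xlift_ten (G : zmodType) (g : L -> L -> G) a b : xbal g -> xlift g (xten a b) = g a b.
Proof. by move=> /xbal_dia gb; exact: dia_liftE gb. Qed.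
Lemma xlift_add_r (G : zmodType) (g : L -> L -> G) : xbal g -> {morph xlift g : z w / z + w}.
Proof. by move=> /xbal_dia gb; exact: dia_liftD gb. Qed.
Lemma xlift_rmul (G : zmodType) (g : L -> L -> G) a b z : xbal g ->
  xlift g (rmul a b z) = xlift (fun l l' => g (l * a) (l' * b)) z.
Proof.
move=> gb; rewrite rmul_xlift xlift_morph; last exact: xlift_add_r.
by apply: eq_xlift => l l'; exact: xlift_ten.
Qed.
End XLift.

Section Transport.
Variables (k : comNzRingType) (R : algType k) (L A : algring (env R)).
Variables (psi : {lrmorphism L -> A}) (phi : A -> L).
Hypotheses (psiK : cancel psi phi) (phiK : cancel phi psi).
Hypothesis psi_ar : forall e, psi (ar_map L e) = ar_map A e.

Lemma trD a b : psi (a + b) = psi a + psi b. Proof. exact: raddfD. Qed.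
Lemma trM a b : psi (a * b) = psi a * psi b. Proof. exact: rmorphM. Qed.
Lemma tr1 : psi 1 = 1. Proof. exact: rmorph1. Qed.
Lemma tr_src r : psi (xsrc L r) = xsrc A r. Proof. exact: psi_ar. Qed.
Lemma tr_tgt r : psi (xtgt L r) = xtgt A r. Proof. exact: psi_ar. Qed.
Lemma phi_add a b : phi (a + b) = phi a + phi b.
Proof. by apply: (can_inj psiK); rewrite trD !phiK. Qed.
Lemma phi_mul a b : phi (a * b) = phi a * phi b.
Proof. by apply: (can_inj psiK); rewrite trM !phiK. Qed.
Lemma phi_ar e : phi (ar_map A e) = ar_map L e.
Proof. by rewrite -psi_ar psiK. Qed.

Fact psi_env_linear : is_linear (M := ar_reg L) (N := ar_reg A) psi.
Proof.
move=> e a b; rewrite -[(e *: a + b : ar_reg L)]/(ar_map L e * a + b : L).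
by rewrite trD trM psi_ar.
Qed.
Definition psi_lin := mk_linear psi_env_linear.
Definition psi2 : xsq L -> xsq A := dia_map psi_lin psi_lin.
Lemma psi2E a b : psi2 (xten a b) = xten (psi a) (psi b).
Proof. exact: dia_mapE. Qed.
Lemma psi2D : {morph psi2 : z w / z + w}.
Proof. exact: dia_mapD. Qed.
Lemma psi2_xlift z : psi2 z = xlift (fun a b => xten (psi a) (psi b)) z.
Proof. by []. Qed.
Lemma psi2Z e z : psi2 (e *: z) = e *: psi2 z.
Proof. exact: (linearZZ (dia_map psi_lin psi_lin)). Qed.

Lemma xlift_psi2 (G : zmodType) (g : A -> A -> G) z : xbal g ->
  xlift g (psi2 z) = xlift (fun a b => g (psi a) (psi b)) z.
Proof.
move=> gb; rewrite psi2_xlift xlift_morph; last exact: xlift_add_r.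
by apply: eq_xlift => l l'; exact: xlift_ten.
Qed.

Lemma psi2_rmul a b z : psi2 (rmul a b z) = rmul (psi a) (psi b) (psi2 z).
Proof.
move: z; apply: xsq_ext => [z w|z w|l l'].
- by rewrite rmulD psi2D.
- by rewrite psi2D rmulD.
- by rewrite rmulE !psi2E rmulE !trM.
Qed.

Lemma takeuchiP (B : algring (env R)) (z : xsq B) :
  (forall s, rmul (xtgt B s) 1 z = rmul 1 (xsrc B s) z) -> takeuchi z.
Proof.
move=> tz s; have := tz s; rewrite !rmul_xlift.
under [in X in X = _ -> _]eq_xlift do rewrite mulr1.
by under [in X in _ = X -> _]eq_xlift do rewrite mulr1.
Qed.

Lemma psi2_takeuchi z : takeuchi z -> takeuchi (psi2 z).
Proof.
move=> tz; apply: takeuchiP => s.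
by rewrite -tr_tgt -tr_src -tr1 -!psi2_rmul takeuchiE.
Qed.
Lemma psi2_mul z w : takeuchi z -> psi2 (xsq_mul z w) = xsq_mul (psi2 z) (psi2 w).
Proof.
move=> tz; have tz' := psi2_takeuchi tz.
move: w; apply: xsq_ext => [v w|v w|a b].
- by rewrite xsq_mulDr // psi2D.
- by rewrite psi2D xsq_mulDr.
- by rewrite xsq_mulr // psi2E xsq_mulr // psi2_rmul.
Qed.

Variable X : xbialg_on L.
Local Notation Delta := (xb_delta X).

Definition tr_delta (a : A) : xsq A := psi2 (Delta (phi a)).
Fact tr_deltaD : {morph tr_delta : a b / a + b}.
Proof. by move=> a b; rewrite /tr_delta phi_add raddfD psi2D. Qed.
Definition tr_deltaL : {additive A -> xsq A} :=
  HB.pack_for {additive A -> xsq A} tr_delta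
    (GRing.isNmodMorphism.Build A (xsq A) tr_delta (conj (morph_add0 tr_deltaD) tr_deltaD)).
Definition tr_eps (a : A) := xb_eps X (phi a).

Lemma tr_deltaE l : tr_deltaL l = psi2 (Delta (phi l)). Proof. by []. Qed.

Fact tr_takeuchi l : takeuchi (tr_deltaL l).
Proof. by apply: psi2_takeuchi; exact: xb_takeuchi. Qed.
Fact tr_delta_env r s : tr_deltaL (ar_map A (eten r s)) = xten (xsrc A r) (xtgt A s).
Proof. by rewrite tr_deltaE phi_ar xb_delta_env psi2E tr_src tr_tgt. Qed.
Fact tr_deltaM l l' : tr_deltaL (l * l') = xsq_mul (tr_deltaL l) (tr_deltaL l').
Proof.
by rewrite !tr_deltaE phi_mul xb_deltaM psi2_mul //; exact: xb_takeuchi.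
Qed.
Fact tr_epsD l l' t : tr_eps (l + l') t = tr_eps l t + tr_eps l' t.
Proof. by rewrite /tr_eps phi_add xb_epsD. Qed.
Fact tr_eps_env r s t : tr_eps (ar_map A (eten r s)) t = r * t * s.
Proof. by rewrite /tr_eps phi_ar xb_eps_env. Qed.
Fact tr_epsM l l' t : tr_eps (l * l') t = tr_eps l (tr_eps l' t).
Proof. by rewrite /tr_eps phi_mul xb_epsM. Qed.

Lemma tr_delta_mull e a : tr_delta (ar_map A e * a) = e *: tr_delta a.
Proof. by rewrite /tr_delta phi_mul phi_ar delta_envl psi2Z. Qed.

Lemma dia_assoc_delta_bal : xbal (fun a b : A => dia_assoc (dia (tr_delta a) (b : ar_reg A))).
Proof.
split=> [a a' b|a b b'|r a b].
- by rewrite tr_deltaD; exact: dia_assoc_addl.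
- by rewrite diaDr raddfD.
- by rewrite tr_delta_mull -[_ *: _]/(tgt_act r _) diaB.
Qed.
Lemma dia_delta_bal : xbal (fun a b : A => dia (a : ar_reg A) (tr_delta b)).
Proof.
split=> [a a' b|a b b'|r a b].
- exact: diaDl.
- by rewrite tr_deltaD diaDr.
- by rewrite tr_delta_mull -[_ *: _]/(src_act r _) -diaB.
Qed.
Definition psi3 : diamond (ar_reg L) (xsq L) -> diamond (ar_reg A) (xsq A) :=
  dia_map psi_lin (dia_map psi_lin psi_lin).
Lemma psi3D : {morph psi3 : z w / z + w}.
Proof. exact: dia_mapD. Qed.
Lemma psi3E a z : psi3 (dia (a : ar_reg L) z) = dia (psi a : ar_reg A) (psi2 z).
Proof. exact: dia_mapE. Qed.
Lemma psi3_assoc z b :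
  psi3 (dia_assoc (dia z (b : ar_reg L))) = dia_assoc (dia (psi2 z) (psi b : ar_reg A)).
Proof.
move: z; apply: xsq_ext => [z w|z w|a a'].
- by rewrite dia_assoc_addl psi3D.
- by rewrite psi2D; exact: dia_assoc_addl.
- by rewrite dia_assocE psi3E !psi2E dia_assocE.
Qed.

Fact tr_coassoc l :
  xlift (fun a b : A => dia_assoc (dia (tr_deltaL a) (b : ar_reg A))) (tr_deltaL l) =
  xlift (fun a b : A => dia (a : ar_reg A) (tr_deltaL b)) (tr_deltaL l).
Proof.
rewrite (xlift_psi2 _ dia_assoc_delta_bal) (xlift_psi2 _ dia_delta_bal).
transitivity (xlift (fun a b : L => psi3 (dia_assoc (dia (Delta a) (b : ar_reg L)))) (Delta (phi l))).
  by apply: eq_xlift => a b; rewrite psi3_assoc /tr_delta psiK.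
rewrite -xlift_morph; last exact: psi3D.
rewrite xb_coassoc xlift_morph; last exact: psi3D.
by apply: eq_xlift => a b; rewrite psi3E /tr_delta psiK.
Qed.
Fact tr_counitr l : xlift (fun a b : A => xtgt A (tr_eps b 1) * a) (tr_deltaL l) = l.
Proof.
rewrite xlift_psi2; last first.
  split=> [a a' b|a b b'|r a b].
  - exact: mulrDr.
  - by rewrite tr_epsD /xtgt etgtD raddfD mulrDl.
  - rewrite /tr_eps phi_mul phi_ar eps_env ev_esrc /xtgt etgtM ar_mapM.
    by rewrite -mulrA.
rewrite -[RHS]phiK -[in RHS](xb_counitr X (phi l)) xlift_morph; last exact: trD.
by apply: eq_xlift => a b; rewrite trM tr_tgt /tr_eps psiK.
Qed.
Fact tr_counitl l : xlift (fun a b : A => xsrc A (tr_eps a 1) * b) (tr_deltaL l) = l.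
Proof.
rewrite xlift_psi2; last first.
  split=> [a a' b|a b b'|r a b].
  - by rewrite tr_epsD /xsrc esrcD raddfD mulrDl.
  - exact: mulrDr.
  - rewrite /tr_eps phi_mul phi_ar eps_env ev_etgt /xsrc esrcM ar_mapM.
    by rewrite -mulrA.
rewrite -[RHS]phiK -[in RHS](xb_counitl X (phi l)) xlift_morph; last exact: trD.
by apply: eq_xlift => a b; rewrite trM tr_src /tr_eps psiK.
Qed.

(** [A] will be the base change ring. It is given as a ring, and its structure maps are those of L
    read through the isomorphism. *)
Definition transport_xbialg : xbialg_on A :=
  @XBialgOn k R A tr_deltaL tr_eps tr_takeuchi tr_delta_env tr_deltaM tr_epsD tr_eps_env
    tr_epsM tr_coassoc tr_counitr tr_counitl.

Lemma transport_iso : xbialg_iso (XBialg X) (XBialg transport_xbialg).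
Proof.
exists psi; split=> [|e|l|l t].
- by exists phi.
- exact: psi_ar.
- by rewrite [LHS]tr_deltaE psiK.
- by rewrite [LHS]/(xb_eps X _ _) psiK.
Qed.
End Transport.

(** * Diagonal and base change actions *)

Section Action.
Variables (k : comNzRingType) (A : algType k) (L : algring A) (M : lmodType A).

(** [xdiag] and [base_change_act] take bare functions. These conditions, biadditivity and
    compatibility with A on both sides of L, make both constructions well defined and are inherited
    by them. *)
Record action (act : L -> M -> M) : Prop := Action {
  act_Dl : forall l l' m, act (l + l') m = act l m + act l' m;
  act_Dr : forall l m m', act l (m + m') = act l m + act l m';
  act_arl : forall a l m, act (ar_map L a * l) m = a *: act l m;
  act_arr : forall a l m, act (l * ar_map L a) m = act l (a *: m)
}.
End Action.

Section ScaleAction.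
Variables (k : comNzRingType) (R : algType k) (L : algring (env R)) (M : lmodType L).
Lemma ar_scale_action : action (@ar_scale _ _ _ M).
Proof.
split=> [l l' m|l m m'|a l m|a l m]; rewrite /ar_scale.
- exact: (scalerDl (m : M)).
- exact: (scalerDr l (m : M)).
- exact: (esym (scalerA (ar_map L a) l (m : M))).
- exact: (esym (scalerA l (ar_map L a) (m : M))).
Qed.
End ScaleAction.

Section DiagonalAction.
Variables (k : comNzRingType) (R : algType k) (L : algring (env R)) (X : xbialg_on L).
Variables (M N : lmodType (env R)) (actM : L -> M -> M) (actN : L -> N -> N).
Hypotheses (aM : action actM) (aN : action actN).

Lemma xdiag_xbal m n : xbal (fun a b => dia (actM a m) (actN b n)).
Proof.
split=> [a a' b|a b b'|r a b].
- by rewrite act_Dl // diaDl.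
- by rewrite act_Dl // diaDr.
- by rewrite !act_arl // diaB.
Qed.
(** Acting by [\bar r] on [m] multiplies the comultiplication of [l] on the right by [\bar r (x) 1];
    the Takeuchi condition changes this into [1 (x) r], that is, [r] acting on [n]. *)
Fact xdiag_bal l : dia_balanced (M := M) (N := N)
  (fun m n => xlift (fun a b => dia (actM a m) (actN b n)) (xb_delta X l)).
Proof.
split=> [m m' n|m n n'|r m n].
- by rewrite -xlift_add; apply: eq_xlift => a b; rewrite act_Dr // diaDl.
- by rewrite -xlift_add; apply: eq_xlift => a b; rewrite act_Dr // diaDr.
- have rm a b := xlift_rmul a b (xb_delta X l) (xdiag_xbal m n).
  transitivity (xlift (fun a b => dia (actM a m) (actN b n)) (rmul (xtgt L r) 1 (xb_delta X l))).
    by rewrite rm; apply: eq_xlift => a b; rewrite act_arr // mulr1.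
  rewrite takeuchiE; last exact: xb_takeuchi.
  by rewrite rm; apply: eq_xlift => a b; rewrite act_arr // mulr1.
Qed.
Lemma xdiagE l m n : xdiag X actM actN l (dia m n) =
  xlift (fun a b => dia (actM a m) (actN b n)) (xb_delta X l).
Proof. exact: dia_liftE (xdiag_bal l). Qed.
Lemma xdiagDr l : {morph xdiag X actM actN l : z w / z + w}.
Proof. exact: dia_liftD (xdiag_bal l). Qed.

Lemma xdiag_action : action (xdiag X actM actN).
Proof.
split=> [l l' z|l z w|e l z|e l z].
- rewrite /xdiag -dia_lift_add; apply: eq_dia_lift => m n.
  by rewrite raddfD xlift_add_r //; exact: xdiag_xbal.
- exact: xdiagDr.
- move: z; apply: (dia_ext (@spanning_id M) (@spanning_id N)) => [z w|z w|m n].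
  + exact: xdiagDr.
  + by rewrite xdiagDr scalerDr.
  rewrite !xdiagE delta_envl; move: (xb_delta X l).
  apply: xsq_ext => [z w|z w|a b].
  + by rewrite scalerDr xlift_add_r //; exact: xdiag_xbal.
  + by rewrite xlift_add_r ?scalerDr //; exact: xdiag_xbal.
  elim/eten_ind: e => [r s||e e' IH IH'].
  + rewrite [_ *: xten a b]dia_actE [LHS]xlift_ten; last exact: xdiag_xbal.
    rewrite xlift_ten; last exact: xdiag_xbal.
    by rewrite dia_actE [src_act r (a : ar_reg L)]/(ar_map L _ * a)
      [tgt_act s (b : ar_reg L)]/(ar_map L _ * b) !act_arl.
  + by rewrite !scale0r (morph_add0 (xlift_add_r (xdiag_xbal m n))).
  + by rewrite !scalerDl xlift_add_r ?IH ?IH' //; exact: xdiag_xbal.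
- elim/eten_ind: e => [r s||e e' IH IH'].
  + move: z; apply: (dia_ext (@spanning_id M) (@spanning_id N)) => [z w|z w|m n].
    * exact: xdiagDr.
    * by rewrite scalerDr xdiagDr.
    rewrite dia_actE !xdiagE delta_envr xlift_rmul; last exact: xdiag_xbal.
    by apply: eq_xlift => a b; rewrite !act_arr.
  + rewrite raddf0 mulr0 scale0r (morph_add0 (@xdiagDr l)).
    (* Additivity of the comultiplication gives [u + u = u] for the action of 0, so it vanishes. *)
    have E : xdiag X actM actN 0 z + xdiag X actM actN 0 z = xdiag X actM actN 0 z.
      rewrite {1 2}/xdiag -dia_lift_add -[in RHS](addr0 0) /xdiag; apply: eq_dia_lift => m n.
      by rewrite raddfD xlift_add_r //; exact: xdiag_xbal.
    by apply: (addrI (xdiag X actM actN 0 z)); rewrite E addr0.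
  + rewrite raddfD mulrDr scalerDl xdiagDr -IH -IH'.
    rewrite /xdiag -dia_lift_add; apply: eq_dia_lift => m n.
    by rewrite raddfD xlift_add_r //; exact: xdiag_xbal.
Qed.
End DiagonalAction.

Section CounitAction.
Variables (k : comNzRingType) (R : algType k) (L : algring (env R)) (X : xbialg_on L).
Lemma xb_eps_action : action (fun l (r : unitobj R) => xb_eps X l r : unitobj R).
Proof.
split=> [l l' t|l t t'|e l t|e l t].
- exact: xb_epsD.
- exact: (raddfD (xb_eps X l)).
- exact: eps_env.
- exact: eps_envr.
Qed.
End CounitAction.

Section BaseChangeAction.
Variables (k : comNzRingType) (A B : algType k) (X : morita_context A B) (L : algring A).
Variables (M : lmodType A) (act : L -> M -> M).
Hypothesis aA : action act.
Local Notation C := (mcC X).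
Local Notation D := (mcD X).
Local Notation psi := (fun d c => mc_psi X (lpure d c) : A).
Local Notation bca := (@base_change_act _ _ _ X L M act).

Lemma ar_map_mul (a b : A) : ar_map L (a * b) = ar_map L a * ar_map L b.
Proof. exact: rmorphM. Qed.

Definition bca_in (c : C) (l : L) (d : D) (w : lten C M) : lten C M :=
  tlift (fun (c' : C) (m : M) => lpure c (act (l * ar_map L (psi d c')) m)) w.
Fact bca_in_bal (c : C) (l : L) (d : D) : balanced (fun (a : A) (c : C) => bm_act c a)
  (fun (a : A) (m : M) => a *: m) (fun (c' : C) (m : M) => lpure c (act (l * ar_map L (psi d c')) m)).
Proof.
split=> [c' c'' m|c' m m'|a c' m].
- by rewrite lpureDr raddfD /= raddfD mulrDr act_Dl // lpureDr.
- by rewrite act_Dr // lpureDr.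
- by rewrite -(bten_actE d c' a) mc_psiR ar_map_mul mulrA act_arr.
Qed.
Lemma bca_inE (c : C) l (d : D) (c' : C) m :
  bca_in c l d (lpure c' m) = lpure c (act (l * ar_map L (psi d c')) m).
Proof. exact: tliftE (bca_in_bal c l d). Qed.
Lemma bca_inD (c : C) l (d : D) : {morph bca_in c l d : u v / u + v}.
Proof. exact: tliftD (bca_in_bal c l d). Qed.
Fact bca_bal w : tribalanced (X := X) (L := L) (fun c l d => bca_in c l d w).
Proof.
split=> [c c' l d|c l l' d|c l d d'|c a l d|c l a d];
  rewrite /bca_in -?tlift_add; apply: eq_tlift => c0 m.
- exact: lpureDl.
- by rewrite mulrDl act_Dl // lpureDr.
- by rewrite lpureDl raddfD /= raddfD mulrDr act_Dl // lpureDr.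
- by rewrite lpureB -act_arl // mulrA.
- by rewrite -mulrA -ar_map_mul -[lpure (a *: d) c0]lpureZ linearZZ.
Qed.
Lemma bca_tri (c : C) l (d : D) w : bca (tri c l d) w = bca_in c l d w.
Proof. exact: triliftE (bca_bal w). Qed.
Lemma bcaE (c : C) l (d : D) (c' : C) m :
  bca (tri c l d) (lpure c' m) = lpure c (act (l * ar_map L (psi d c')) m).
Proof. by rewrite bca_tri bca_inE. Qed.
Lemma bcaDl x y w : bca (x + y) w = bca x w + bca y w.
Proof. exact: triliftD (bca_bal w) _ _. Qed.
Lemma bca0l w : bca 0 w = 0.
Proof. exact: trilift0 (bca_bal w). Qed.
Lemma bcaDr x : {morph bca x : u v / u + v}.
Proof.
move=> u v; rewrite /base_change_act -trilift_add; apply: eq_trilift => c l d.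
exact: bca_inD.
Qed.

Lemma bca_action : action bca.
Proof.
split=> [x y w|x w w'|b x w|b x w]; [exact: bcaDl | exact: bcaDr | |].
- rewrite -[ar_map _ b * x]/(ltilde_mul (ltilde_unit X L b) x) ltilde_unitMl.
  elim/tri_ind: x => [c l d||x y IH IH'].
  + rewrite ltilde_scaleBE !bca_tri; move: w; apply: lten_ext => [u v|u v|c' m].
    * exact: bca_inD.
    * by rewrite bca_inD scalerDr.
    * by rewrite !bca_inE lpureZ.
  + by rewrite ltilde_scaleB0 !bca0l scaler0.
  + by rewrite ltilde_scaleBD !bcaDl IH IH' scalerDr.
- rewrite -[x * ar_map _ b]/(ltilde_mul x (ltilde_unit X L b)) ltilde_unitMr.
  elim/tri_ind: x => [c l d||x y IH IH'].
  + rewrite [bm_act _ _]bten_actE [LHS]bca_tri bca_tri.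
    move: w; apply: lten_ext => [u v|u v|c' m].
    * exact: bca_inD.
    * by rewrite scalerDr bca_inD.
    * by rewrite lpureZ !bca_inE lpureB.
  + by rewrite [bm_act _ _]bten_act0 !bca0l.
  + by rewrite [bm_act _ _]bten_actDl !bcaDl IH IH'.
Qed.
End BaseChangeAction.

(** * Recovering L by base change *)

Lemma lpure_suml (k : comNzRingType) (A B : algType k) (C : bimod B A) (N : lmodType A)
    (I : Type) (r : seq I) (F : I -> C) (n : N) :
  lpure (\sum_(i <- r) F i) n = \sum_(i <- r) lpure (F i) n.
Proof.
elim: r => [|i r IH]; last by rewrite !big_cons lpureDl IH.
by rewrite !big_nil; apply: (addrI (lpure 0 n)); rewrite -lpureDl !addr0.
Qed.

Section Reconstruction.
Variables (k : comNzRingType) (R : algType k) (Fr : frame R) (L : algring (env R)).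
Variable X : xbialg_on L.
Local Notation x := (fr_x (f := Fr)).
Local Notation f := (fr_df (Fr := Fr)).
Local Notation e0 := (fr_de Fr).
Local Notation H := (centralizer L).
Local Notation io := (ar_map L).
Local Notation Hb := (cent_bialg Fr X).
Local Notation HX := (xbialg_of_bialg Hb).
Local Notation MC := (azumaya_context Fr).
Local Notation Lt := (base_change_ring MC HX).
Local Notation C := (unit_bimod R).
Local Notation D := (dual_bimod R).
Local Notation Delta := (xb_delta X).

Lemma bialg_arE (a : env k^o) : ar_map HX a = (kev a)%:A :> H.
Proof. by rewrite [a in LHS]kevE; exact: (rmorph_alg (ar_map HX)). Qed.

Definition recon_fun (c : C) (h : H) (d : D) : L :=
  io (esrc (c : R) * dual_val d) * cent_val h.
Fact recon_bal : tribalanced (X := MC) (L := HX) recon_fun.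
Proof.
split=> [c c' h d|c h h' d|c h d d'|c a h d|c h a d]; rewrite /recon_fun.
- by rewrite [esrc _]esrcD mulrDl raddfD mulrDl.
- by rewrite cent_valD mulrDr.
- by rewrite dual_valD mulrDr raddfD mulrDl.
- rewrite bialg_arE [esrc _]esrcZ -scalerAl ar_mapZ -scalerAl scalerAr.
  by rewrite -[_%:A * h]scalerAl mul1r cent_valZ.
- rewrite bialg_arE -[h * _%:A]scalerAr mulr1 cent_valZ dual_valZ -[in RHS]scalerAr ar_mapZ.
  by rewrite -scalerAl scalerAr.
Qed.
Definition recon (y : Lt) : L :=
  trilift (X := MC) (L := HX) recon_fun y.
Lemma reconE (c : C) (h : H) (d : D) :
  recon (tri (X := MC) (L := HX) c h d) = recon_fun c h d.
Proof. exact: triliftE recon_bal. Qed.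
Lemma reconD : {morph recon : y z / y + z}.
Proof. exact: triliftD recon_bal. Qed.
Lemma recon0 : recon 0 = 0.
Proof. exact: trilift0 recon_bal. Qed.

Lemma Lt_ext (G : zmodType) (g g' : Lt -> G) :
  {morph g : y z / y + z} -> {morph g' : y z / y + z} ->
  (forall (c : C) (h : H) (d : D),
     g (tri (X := MC) (L := HX) c h d) = g' (tri (X := MC) (L := HX) c h d)) ->
  g =1 g'.
Proof.
move=> gD gD' gg'; elim/tri_ind => [c h d||y z IH IH'].
- exact: gg'.
- by rewrite !morph_add0.
- by rewrite gD gD' IH IH'.
Qed.

Lemma recon_scaleB (b : env R) (y : Lt) : recon (ltilde_scaleB b y) = io b * recon y.
Proof.
move: y; apply: Lt_ext => [y z|y z|c h d].
- by rewrite ltilde_scaleBD reconD.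
- by rewrite reconD mulrDr.
rewrite ltilde_scaleBE !reconE /recon_fun mulrA -ar_mapM mulrA [in RHS]mul_dual evM ev_esrc.
by rewrite mulr1.
Qed.
Lemma recon_ar (b : env R) : recon (ar_map Lt b) = io b.
Proof.
have -> : ar_map Lt b = ltilde_scaleB b 1.
  by rewrite -[RHS]ltilde_unitMl; exact/esym/mulr1.
rewrite recon_scaleB -[RHS]mulr1; congr (_ * _).
rewrite -[1 in LHS]/(ltilde_unit MC HX 1) -[RHS](ar_map1 L).
elim/(B_ind (X := MC)): (1 : env R) => [c d||y z IH IH'].
- rewrite ltilde_unit_phi reconE /recon_fun cent_val1 mulr1.
  by rewrite -phiE.
- by rewrite ltilde_unit0 recon0 raddf0.
- by rewrite ltilde_unitD reconD IH IH' raddfD.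
Qed.
(** As [h] commutes with R^e, [(c d h) (c' d' h') = c (d c' d') h h' = d(c') c d' h h'], and [d(c')]
    is the pairing in the multiplication of the base change ring. *)
Fact recon_monoid : monoid_morphism recon.
Proof.
split=> [|y z]; first by rewrite -[1 in LHS](rmorph1 (ar_map Lt)) recon_ar ar_map1.
move: y; apply: Lt_ext => [y y'|y y'|c h d].
- by rewrite mulrDl reconD.
- by rewrite reconD mulrDl.
move: z; apply: Lt_ext => [z z'|z z'|c' h' d'].
- by rewrite mulrDr reconD.
- by rewrite reconD mulrDr.
rewrite [_ * _]ltilde_mulE !reconE /recon_fun.
rewrite [X in ar_map HX X](_ : _ = (dval Fr d (c' : R))%:A); last exact: psiE.
rewrite bialg_arE kevZ1 -[h * _%:A]scalerAr mulr1 -scalerAl cent_valZ cent_valM.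
rewrite [RHS]mulrA -[X in _ = X * _]mulrA -cent_comm [X in _ = X * _]mulrA -ar_mapM.
rewrite -[X in _ = io X * _ * _]mulrA (dual_src_mul Fr) -[X in _ = io X * _ * _]scalerAr.
by rewrite ar_mapZ -!scalerAl -scalerAr mulrA.
Qed.
Fact recon_linear : is_linear recon.
Proof.
move=> c y z; rewrite reconD; congr (_ + _).
by rewrite [_ *: y]/(ltilde_scaleB c%:A y) recon_scaleB -env_scale_ar.
Qed.
Definition unrecon (l : L) : Lt := \sum_i \sum_j tri (X := MC) (L := HX)
  (x i : C) (slice Fr (io (dual_val (f i)) * l * io (esrc (x j)))) (f j : D).

(** Use [d x_p e_0 = d(x_p) e_0] in each summand of the slice, and then [\sum_p d(x_p) f_p = d]. *)
Lemma dual_slice (d : dual R) (l : L) :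
  io (dual_val d) * cent_val (slice Fr l) = io (dual_val e0) * l * io (dual_val d).
Proof.
rewrite sliceE /slice0 mulr_sumr.
have E p : io (dual_val d) * (io (esrc (x p)) * (io (dual_val e0) * l * io (dual_val (f p)))) =
    io (dual_val e0) * l * io (dval Fr d (x p) *: dual_val (f p)).
  rewrite ar_mapZ -scalerAr -!mulrA (mulrA (io (dual_val d))) -ar_mapM mulrA -ar_mapM.
  by rewrite -mulrA (dual_src_mul Fr) ar_mapZ -scalerAl.
under eq_bigr => p _ do rewrite E.
by rewrite -mulr_sumr -ar_map_sum -frame_dual_env.
Qed.

(** By [dual_slice] the summand for i and j becomes [x_i f_i l x_j f_j], and [\sum_i x_i f_i = 1] is
    applied on either side of [l]. *)
Lemma unreconK : cancel unrecon recon.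
Proof.
move=> l; rewrite /unrecon (big_morph recon reconD recon0).
rewrite -[RHS]mul1r -(io_frame_sum Fr L) mulr_suml; apply: eq_bigr => i _.
rewrite (big_morph recon reconD recon0) -[RHS]mulr1 -(io_frame_sum Fr L) mulr_sumr.
apply: eq_bigr => j _; rewrite reconE /recon_fun ar_mapM -[LHS]mulrA dual_slice.
by rewrite -!mulrA io_e0_dual.
Qed.
Lemma unreconD : {morph unrecon : a b / a + b}.
Proof.
move=> a b; rewrite /unrecon -big_split; apply: eq_bigr => i _ /=.
rewrite -big_split; apply: eq_bigr => j _ /=.
by rewrite mulrDr mulrDl sliceD -triDm.
Qed.

Lemma triZl (a : k) (c : C) (h : H) (d : D) :
  tri (X := MC) (L := HX) (a *: (c : R)) h d = tri (X := MC) (L := HX) c (a *: h) d.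
Proof.
have := triBl (X := MC) (L := HX) c a%:A h d.
rewrite bialg_arE kevZ1 -[_%:A * h]scalerAl mul1r => <-; congr tri.
by rewrite [bm_act _ _]/(kev _ *: _) kevZ1.
Qed.
Lemma triZr (a : k) (c : C) (h : H) (d : D) :
  tri (X := MC) (L := HX) c h (a%:A *: d) = tri (X := MC) (L := HX) c (a *: h) d.
Proof.
have <- := triBr (X := MC) (L := HX) c h a%:A d.
by rewrite bialg_arE kevZ1 -[h * _%:A]scalerAr mulr1.
Qed.

Lemma reconK : cancel recon unrecon.
Proof.
apply: Lt_ext => [y z|//|c h d]; first by rewrite reconD unreconD.
rewrite reconE /unrecon.
(* The argument is [f_i c d h x_j = c_i(c) (d x_j) h], whose slice is [c_i(c) d(x_j) h]; the two
   coefficients are then absorbed by the coordinates of [c] and of [d]. *)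
have E i j : slice Fr (io (dual_val (f i)) * recon_fun c h d * io (esrc (x j))) =
    (fr_c (f := Fr) i (c : R) : k) *: ((dval Fr d (x j) : k) *: h).
  rewrite /recon_fun mulrA -ar_mapM (dual_src_mul Fr) dval_f ar_mapZ -!scalerAl sliceZ.
  rewrite -mulrA -cent_comm mulrA -ar_mapM; congr (_ *: _).
  by rewrite -[dual_val d * _]/(dual_val (dual_mul d _)) slice_dual_cent dval_mul ev_esrc mulr1.
under eq_bigr => i _ do under eq_bigr => j _ do rewrite E -triZl -triZr.
have -> : tri (X := MC) (L := HX) c h d =
    tri (X := MC) (L := HX) (\sum_i (fr_c (f := Fr) i (c : R) : k) *: (x i : R)) h
      (\sum_j (dval Fr d (x j))%:A *: f j).
  by rewrite -(frame_dual Fr) -(fr_coord Fr).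
rewrite (big_morph (fun c => tri (X := MC) (L := HX) c h _) (id1 := 0) (op1 := +%R)); first last.
- exact: (morph_add0 (fun a b => triDl (X := MC) (L := HX) a b h _)).
- by move=> a b; exact: triDl.
apply: eq_bigr => i _.
rewrite (big_morph (fun d => tri (X := MC) (L := HX) _ h d) (id1 := 0) (op1 := +%R)) //.
- by move=> a b; exact: triDr.
- exact: (morph_add0 (triDr (X := MC) (L := HX) _ h)).
Qed.
Lemma unreconM a b : unrecon (a * b) = unrecon a * unrecon b.
Proof. by apply: (can_inj reconK); rewrite recon_monoid.2 !unreconK. Qed.
Fact unrecon_monoid : monoid_morphism unrecon.
Proof.
split; last exact: unreconM.
by apply: (can_inj reconK); rewrite unreconK recon_monoid.1.
Qed.
Fact unrecon_linear : is_linear unrecon.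
Proof.
by move=> c a b; apply: (can_inj reconK); rewrite recon_linear !unreconK.
Qed.
Definition unrecon_mor := mk_lrmorphism unrecon_linear unrecon_monoid.
Lemma unrecon_ar e : unrecon_mor (io e) = ar_map Lt e.
Proof. by apply: (can_inj reconK); rewrite recon_ar [LHS]unreconK. Qed.

Definition recon_xbialg : xbialg_on Lt :=
  transport_xbialg (psi := unrecon_mor) unreconK reconK unrecon_ar X.
Lemma recon_iso : xbialg_iso (XBialg X) (XBialg recon_xbialg).
Proof. exact: transport_iso. Qed.

(** Elements [r \bar s h] suit the comparison of structures: their comultiplication is [r \bar s]
    acting on that of [h], and [bca_unrecon] describes how they act. *)
Lemma Lt_env_ind (P : Lt -> Prop) :
  (forall r s (h : H), P (unrecon (io (eten r s) * cent_val h))) -> P 0 ->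
  (forall y z, P y -> P z -> P (y + z)) -> forall y, P y.
Proof.
move=> Pr P0 PD y; elim/tri_ind: y => [c h d|//|]; last exact: PD.
rewrite -[tri _ _ _]reconK reconE /recon_fun.
elim/eten_ind: (esrc _ * _) => [r s||e e' IH IH'].
- exact: Pr.
- by rewrite raddf0 mul0r (morph_add0 unreconD).
- by rewrite raddfD mulrDl unreconD; exact: PD.
Qed.

Lemma Lt_env_ext (G : zmodType) (g g' : Lt -> G) :
  {morph g : y z / y + z} -> {morph g' : y z / y + z} ->
  (forall r s (h : H), g (unrecon (io (eten r s) * cent_val h)) =
                       g' (unrecon (io (eten r s) * cent_val h))) ->
  g =1 g'.
Proof.
move=> gD gD' gg'; apply: Lt_env_ind => [//||y z IH IH']; first by rewrite !morph_add0.
by rewrite gD gD' IH IH'.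
Qed.

Section Act.
Variables (M : lmodType (env k^o)) (act : HX -> M -> M).
Hypothesis aA : action act.
Local Notation bca := (@base_change_act _ _ _ MC HX M act).

Lemma unrecon_env e (h : H) : unrecon (io e * cent_val h) =
  \sum_i tri (X := MC) (L := HX) (ev e (x i) : C) h (f i : D).
Proof.
apply: (can_inj reconK); rewrite unreconK (big_morph recon reconD recon0).
rewrite [e in LHS](frame_env Fr) ar_map_sum mulr_suml.
by apply: eq_bigr => i _; rewrite reconE.
Qed.

(** On R (x) M the enveloping algebra acts on R and the centralizer on M. The pairing of [f_i] with
    [c] is [c_i(c)], and [\sum_i c_i(c) (e . x_i) = e . c]. *)
Lemma bca_unrecon e (h : H) (c : C) (m : M) :
  bca (unrecon (io e * cent_val h)) (lpure c m) = lpure (ev e (c : R) : C) (act h m).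
Proof.
rewrite unrecon_env (big_morph (bca^~ (lpure c m)) (fun y z => bcaDl aA y z _) (bca0l aA _)).
have E i : bca (tri (X := MC) (L := HX) (ev e (x i) : C) h (f i : D)) (lpure c m) =
    lpure (((fr_c (f := Fr) i (c : R) : k) *: ev e (x i) : R) : C) (act h m).
  rewrite bcaE // [X in ar_map HX X](_ : _ = (dval Fr (f i) (c : R))%:A); last exact: psiE.
  rewrite bialg_arE kevZ1 dval_f -[h * _%:A]scalerAr mulr1.
  have -> : (fr_c (f := Fr) i (c : R) : k) *: h = ar_map HX (fr_c (f := Fr) i (c : R) : k)%:A * h.
    by rewrite bialg_arE kevZ1 -[RHS]scalerAl mul1r.
  rewrite act_arl // -lpureB; congr lpure.
  by rewrite [LHS]/(kev _ *: _) kevZ1.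
rewrite (eq_bigr _ (fun i _ => E i)).
rewrite -lpure_suml.
congr lpure; rewrite [c in RHS](fr_coord Fr) ev_sumr.
by apply: eq_bigr => i _; rewrite evZr.
Qed.
End Act.

Local Notation F := (unit_functor R).
Local Notation Y := recon_xbialg.
Local Notation theta := (fun M : lmodType (env k^o) => idfun : {linear lten (mcC MC) M -> F M}).

Lemma dia_map_id (M N : lmodType (env R)) (z : diamond M N) :
  dia_map (idfun : {linear M -> M}) (idfun : {linear N -> N}) z = z.
Proof.
move: z; apply: (dia_ext (@spanning_id M) (@spanning_id N)) => [z w|//|m n].
- exact: dia_mapD.
- exact: dia_mapE.
Qed.

Section Tensor.
Variables M N : lmodType HX.
Local Notation actM := (@ar_scale _ _ _ M).
Local Notation actN := (@ar_scale _ _ _ N).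
Local Notation bcaM := (@base_change_act _ _ _ MC HX _ actM).
Local Notation bcaN := (@base_change_act _ _ _ MC HX _ actN).
Local Notation bcaMN := (@base_change_act _ _ _ MC HX _ (xdiag HX actM actN)).

Let aM := bca_action MC (ar_scale_action M).
Let aN := bca_action MC (ar_scale_action N).
Let aMN := xdiag_action HX (ar_scale_action M) (ar_scale_action N).

Lemma bialg_bal (m : M) (n : N) : balanced (fun (c : k) (a : H) => c *: a)
  (fun (c : k) (b : H) => c *: b)
  (fun a b : H => dia (actM a (m : ar_lmod M)) (actN b (n : ar_lmod N))).
Proof.
have [g1 g2 g3] := xdiag_xbal (ar_scale_action M) (ar_scale_action N) m n.
split=> // c a b; have := g3 c a b.
by rewrite bialg_tgt bialg_src -!scalerAl !mul1r.
Qed.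
Lemma xdiag_bialg (h : H) (m : M) (n : N) :
  xdiag HX actM actN h (dia (m : ar_lmod M) (n : ar_lmod N)) =
  tlift (fun a b : H => dia (actM a m) (actN b n)) (bi_delta Hb h).
Proof.
rewrite (xdiagE HX (ar_scale_action M) (ar_scale_action N)) [LHS]xlift_cmp //.
by case: (bialg_bal m n).
Qed.

(** An arbitrary [u] takes the place of the comultiplication of [h], so that by additivity it can be
    taken pure. *)
Lemma xi_xdiag_env r s (c c' : C) (m : M) (n : N) (u : otimes H H) :
  xi R (ar_lmod M) (ar_lmod N) (xlift
    (fun a b : Lt => dia (bcaM a (lpure c (m : ar_lmod M))) (bcaN b (lpure c' (n : ar_lmod N))))
    (psi2 unrecon_ar (eten r s *: cmp2 u))) =
  lpure (ev (eten r s) ((c : R) * (c' : R)) : C)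
    (tlift (fun a b : H => dia (actM a (m : ar_lmod M)) (actN b (n : ar_lmod N))) u).
Proof.
have gb := xdiag_xbal aM aN (lpure c (m : ar_lmod M)) (lpure c' (n : ar_lmod N)).
move: u; apply: otimes_ext => [u v|u v|a b].
- by rewrite cmp2D scalerDr psi2D xlift_add_r // raddfD.
- by rewrite (tliftD (bialg_bal m n)) lpureDr.
rewrite cmp2E [_ *: xten _ _]dia_actE [psi2 _ _]psi2E xlift_ten //.
rewrite [src_act r _]/(io (esrc r) * cent_val a) [tgt_act s _]/(io (etgt s) * cent_val b).
rewrite !bca_unrecon; try exact: ar_scale_action.
rewrite xi_pureE (tliftE _ _ (bialg_bal m n)); congr lpure.
by rewrite ev_eten /cmul ev_esrc ev_etgt !mulrA.
Qed.

(** For [y = r \bar s h] the comultiplication is [r \bar s] applied to [cmp2 (deltaH h)], by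
    [cmp2_delta], which reduces the claim to pure tensors in H (x) H. *)
Lemma xi_xdiag (y : Lt) (z : diamond (lten C (ar_lmod M)) (lten C (ar_lmod N))) :
  xi R (ar_lmod M) (ar_lmod N) (xdiag Y bcaM bcaN y z) =
  bcaMN y (xi R (ar_lmod M) (ar_lmod N) z).
Proof.
move: y; apply: Lt_env_ext => [y y'|y y'|r s h].
- by rewrite (act_Dl (xdiag_action Y aM aN)) raddfD.
- exact: (bcaDl aMN y y' _).
move: z; apply: dia_lten_ext => [z z'|z z'|c m c' n].
- by rewrite (act_Dr (xdiag_action Y aM aN)) raddfD.
- exact: etrans (congr1 (bcaMN _) (raddfD _ _ _)) (bcaDr aMN _ _ _).
rewrite (xdiagE Y aM aN) xi_pureE (bca_unrecon aMN) xdiag_bialg.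
rewrite [xb_delta Y _]/(psi2 unrecon_ar (Delta (recon _))) unreconK delta_envl -(cmp2_delta Fr).
exact: xi_xdiag_env.
Qed.
End Tensor.

(** The functor is R (x) - itself, so [theta] is the identity and the hypothesis relating [z] and
    [w] says that [xi] maps [z] to [w]. *)
Lemma recon_transported_tensor : transported_tensor theta Y.
Proof.
move=> M N y z w; rewrite !dia_map_id => wE.
exact: etrans (xi_xdiag y z) (congr1 (base_change_act _ y) wE).
Qed.

Lemma recon_epsE y t : xb_eps Y y t = xb_eps X (recon y) t. Proof. by []. Qed.
(** For [y = r \bar s h] both sides come down to [r t s] times the scalar [epsH h], by
    [eps_cent]. *)
Lemma recon_transported_unit : transported_unit theta Y.
Proof.
move=> y t w wE; have {wE} -> : w = xi_unit t by exact: esym wE.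
rewrite -[LHS]/(xi_unit _) -[RHS]/(base_change_act _ _ _).
have aE := xb_eps_action HX.
move: y; apply: Lt_env_ext => [y y'|y y'|r s h].
- by rewrite xb_epsD; exact: xi_unitD.
- exact: (bcaDl aE y y' _).
rewrite (bca_unrecon aE) recon_epsE unreconK eps_env (eps_cent Fr).
by rewrite evZr -lpure_unit; congr lpure; exact/esym/mulr1.
Qed.
End Reconstruction.

Theorem corollary4p5 (k : comNzRingType) (R : algType k) (L : xbialg R) :
  azumaya R ->
  exists (H : bialg k) (F : monoidal_functor k^o R) (Lt : xbialg R),
    [/\ klinear_monoidal_equivalence F,
        sqrt_morita_base_change F (xbialg_of_bialg H) Lt
      & xbialg_iso L Lt].
Proof.
move=> /azumaya_frame [Fr _]; case: L => L X.
exists (cent_bialg Fr X), (unit_functor R), (XBialg (recon_xbialg Fr X)); split.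
- exact: unit_functor_equivalence Fr.
- exists (azumaya_context Fr), (fun M => idfun), (recon_xbialg Fr X); split=> //.
  + by move=> M; exists id.
  + exact: recon_transported_tensor.
  + exact: recon_transported_unit.
- exact: recon_iso.
Qed.
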